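(* Let $\mathcal F$ be a nondegenerate germ of one-dimensional holomorphic foliation at $0\in\mathbb C^2$. Then $\mathcal F$ is analytically linearizable of Siegel type if and only if there exist local holomorphic coordinates $(z,w)$ centered at the origin and a sequence $r_j\downarrow 0$ such that $$M\bigl(\mathcal F,S^3_{(z,w)}(r_j)\bigr)$$ is a nonempty smooth real surface of dimension two for every $j$. Moreover, whenever such coordinates $(z,w)$ and such a sequence $r_j$ exist, then, in these Euclidean coordinates, after a unitary change of coordinates one has $$\mathcal F:\quad \mu w\,dz+\lambda z\,dw=0,\qquad \lambda,\mu>0,$$ and for every sufficiently small $r>0$ the tangency locus $M(\mathcal F,S^3_{(z,w)}(r))$ is the Clifford torus $$|z|^2=\frac{\mu}{\lambda+\mu}r^2,\qquad |w|^2=\frac{\lambda}{\lambda+\mu}r^2 .$$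
   Context: A germ of one-dimensional holomorphic foliation at $0\in\mathbb C^2$ is generated by a germ of holomorphic vector field $X$ with an isolated singularity at $0$ (unique up to multiplication by a holomorphic unit); it is nondegenerate if the linear part of $X$ at $0$ is invertible. It is analytically linearizable of Siegel type if there is a local biholomorphism $\Psi:(\mathbb C^2,0)\to(\mathbb C^2,0)$ such that $\Psi_*\mathcal F$ is the foliation $z\,dw-\tau w\,dz=0$ for some $\tau\in\mathbb R_{<0}$. For a smooth real hypersurface $H\subset\mathbb C^2$ and a point $p\in H$ at which $\mathcal F$ is regular, $\mathcal F$ is complex tangent to $H$ at $p$ if the tangent line of $\mathcal F$ at $p$ is contained in the complex tangent line $T_p^{\mathbb C}H$ (the maximal complex subspace of $T_pH$). $M(\mathcal F,H)$ denotes the set of such points $p$. For local complex coordinates $(z,w)$ centered at the origin, $S^3_{(z,w)}(r)=\{(z,w)\in\mathbb C^2:|z|^2+|w|^2=r^2\}$ (for $r$ small enough that it lies in the coordinate neighborhood). A unitary change of coordinates means a linear change of $(z,w)$ by an element of $U(2)$. *)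

(* Defs.v *)
(* Stdlib reals and Coquelicot.  C^2 is the type C * C; as C is R * R, the same
   type carries both the complex and the real normed-module structure. *)
From Stdlib Require Import Reals.
From Coquelicot Require Import Coquelicot.

Definition C2 : Type := (C * C)%type.

Definition C2_C : NormedModule C_AbsRing :=
  prod_NormedModule C_AbsRing C_NormedModule C_NormedModule.
Definition C2_R : NormedModule R_AbsRing :=
  prod_NormedModule R_AbsRing C_R_NormedModule C_R_NormedModule.

Definition origin : C2 := (RtoC 0, RtoC 0).

(** * Holomorphic maps *)

Definition holomorphic_on (U : C2 -> Prop) (f : C2 -> C2) : Prop :=
  forall p : C2, U p ->
    ex_filterdiff (K := C_AbsRing) (U := C2_C) (V := C2_C) f (locally (T := C2_C) p).

Definition partial_z (f : C2 -> C) (p : C2) : C :=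
  C_derive (fun t => f (t, snd p)) (fst p).
Definition partial_w (f : C2 -> C) (p : C2) : C :=
  C_derive (fun t => f (fst p, t)) (snd p).

Definition differential (f : C2 -> C2) (p v : C2) : C2 :=
  let f1 := fun q => fst (f q) in
  let f2 := fun q => snd (f q) in
  ((partial_z f1 p * fst v + partial_w f1 p * snd v)%C,
   (partial_z f2 p * fst v + partial_w f2 p * snd v)%C).

Definition jacobian_det (f : C2 -> C2) (p : C2) : C :=
  let f1 := fun q => fst (f q) in
  let f2 := fun q => snd (f q) in
  (partial_z f1 p * partial_w f2 p - partial_w f1 p * partial_z f2 p)%C.

Definition biholomorphism (U V : C2 -> Prop) (Phi Phi' : C2 -> C2) : Prop :=
  open (T := C2_C) U /\ open (T := C2_C) V /\
  holomorphic_on U Phi /\ holomorphic_on V Phi' /\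
  (forall p, U p -> V (Phi p) /\ Phi' (Phi p) = p) /\
  (forall q, V q -> U (Phi' q) /\ Phi (Phi' q) = q).

(** * Singular foliations, represented by a generating vector field *)

(* [X] represents the foliation on the neighbourhood [U] of the origin, the
   origin being its only singularity there. *)
Definition foliation_on (U : C2 -> Prop) (X : C2 -> C2) : Prop :=
  open (T := C2_C) U /\ U origin /\ holomorphic_on U X /\
  (forall p, U p -> (X p = origin <-> p = origin)).

Definition nondegenerate_foliation_germ (X : C2 -> C2) : Prop :=
  (exists U, foliation_on U X) /\ jacobian_det X origin <> RtoC 0.

Definition tangent_line (X : C2 -> C2) (p v : C2) : Prop :=
  exists c : C, v = scal (V := C2_C) c (X p).

(* The germ at the origin of the foliation of [X] is [P dz + Q dw = 0]. *)
Definition given_by_form (X : C2 -> C2) (P Q : C2 -> C) : Prop :=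
  locally (T := C2_C) origin (fun p => p <> origin ->
    forall v, tangent_line X p v <-> (P p * fst v + Q p * snd v)%C = RtoC 0).

(* The chart [Phi = (z,w) : U -> V], with inverse [Phi'], is centred at the
   origin, and the foliation has a representative on the whole of [U]. *)
Definition coordinates_for (X : C2 -> C2) (U V : C2 -> Prop) (Phi Phi' : C2 -> C2)
  : Prop :=
  foliation_on U X /\ biholomorphism U V Phi Phi' /\ Phi origin = origin.

(* Phi_* X, the expression of the foliation in the coordinates [Phi]. *)
Definition pushforward (Phi Phi' : C2 -> C2) (X : C2 -> C2) : C2 -> C2 :=
  fun q => differential Phi (Phi' q) (X (Phi' q)).

Definition linearizable_Siegel (X : C2 -> C2) : Prop :=
  exists (tau : R) (U V : C2 -> Prop) (Psi Psi' : C2 -> C2),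
    (tau < 0)%R /\ coordinates_for X U V Psi Psi' /\
    given_by_form (pushforward Psi Psi' X)
      (fun q => (- (RtoC tau * snd q))%C) (fun q => fst q).

(** * Tangency with real hypersurfaces *)

(* Velocities at [p] of curves lying in [H]; for a smooth hypersurface this is
   its real tangent space. *)
Definition tangent_space (H : C2 -> Prop) (p v : C2) : Prop :=
  exists gamma : R -> C2,
    gamma 0%R = p /\ locally 0%R (fun t => H (gamma t)) /\
    is_derive (K := R_AbsRing) (V := C2_R) gamma 0%R v.

(* T_p H intersected with i T_p H. *)
Definition complex_tangent_space (H : C2 -> Prop) (p v : C2) : Prop :=
  tangent_space H p v /\ tangent_space H p (scal (V := C2_C) Ci v).

Definition tangency_locus (X : C2 -> C2) (H : C2 -> Prop) (p : C2) : Prop :=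
  H p /\ X p <> origin /\
  (forall v, tangent_line X p v -> complex_tangent_space H p v).

Definition sphere (r : R) (q : C2) : Prop :=
  (Cmod (fst q) ^ 2 + Cmod (snd q) ^ 2 = r ^ 2)%R.

(** * Smooth real surfaces in C^2 = R^4 *)

Definition dir_derive (f : C2 -> R) (v p : C2) : R :=
  Derive (fun t : R => f (plus (G := C2_R) p (scal (V := C2_R) t v))) 0.

Fixpoint Ck (k : nat) (U : C2 -> Prop) (f : C2 -> R) : Prop :=
  match k with
  | O => forall p : C2, U p -> continuous (T := C2_R) (U := R_UniformSpace) f p
  | S k' =>
      (forall p : C2, U p ->
         ex_filterdiff (K := R_AbsRing) (U := C2_R) (V := R_NormedModule) f
           (locally (T := C2_R) p)) /\
      (forall v : C2, Ck k' U (dir_derive f v))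
  end.

Definition smooth_on (U : C2 -> Prop) (f : C2 -> R) : Prop :=
  forall k, Ck k U f.

(* Embedded two-dimensional submanifold of R^4: locally the common zero set of
   two smooth real functions with linearly independent differentials. *)
Definition smooth_surface (M : C2 -> Prop) : Prop :=
  forall p, M p ->
    exists (U : C2 -> Prop) (f g : C2 -> R),
      open (T := C2_R) U /\ U p /\ smooth_on U f /\ smooth_on U g /\
      (forall q, U q -> (M q <-> f q = 0%R /\ g q = 0%R)) /\
      (forall q, U q -> M q -> forall a b : R,
         (forall v, (a * dir_derive f v q + b * dir_derive g v q = 0)%R) ->
         a = 0%R /\ b = 0%R).

(* The radii [r j] decrease to 0, the corresponding spheres lie in the coordinate
   neighbourhood, and each tangency locus is a nonempty smooth surface. *)
Definition surface_tangency (X : C2 -> C2) (V : C2 -> Prop) (Phi Phi' : C2 -> C2)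
    (r : nat -> R) : Prop :=
  (forall j, (0 < r (S j) < r j)%R) /\ is_lim_seq r 0%R /\
  forall j,
    let M := tangency_locus (pushforward Phi Phi' X) (sphere (r j)) in
    (forall q, sphere (r j) q -> V q) /\ (exists q, M q) /\ smooth_surface M.

(** * Unitary changes of coordinates *)

Definition hermitian (u v : C2) : C :=
  (fst u * Cconj (fst v) + snd u * Cconj (snd v))%C.

Definition unitary (A : C2 -> C2) : Prop :=
  is_linear (K := C_AbsRing) (U := C2_C) (V := C2_C) A /\
  forall u v, hermitian (A u) (A v) = hermitian u v.

(* Main.v *)
Require Import Defs.
From Stdlib Require Import Reals Lra Lia Psatz ClassicalEpsilon.
From Coquelicot Require Import Coquelicot.
Local Open Scope R_scope.

(** Read in a chart, the foliation is generated by a field [(a, b)] with invertible linear part [L],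
    and a point of a sphere is a point of tangency exactly when the Hermitian product
    [h = a conj z + b conj w] vanishes there ([tangency_locus_tang]).  So the tangency locus on the
    sphere of radius [r] is given by three real equations, [|q|^2 = r^2], [Re h = 0] and [Im h = 0];
    that it is a surface means that they are dependent.  Precisely, by Lagrange multipliers, three
    functions that have a local minimum on a smooth surface at the same point have dependent
    gradients there ([smooth_surface_rigid]).  This is the only way in which smoothness is used.

    The linear part.  Rescale the loci to the unit sphere and let [q] be a limit of points on them.
    Then [|q| = 1], [L q] is orthogonal to [q], and dependence of gradients passes to the quadratic
    model [<L q, q>] of [h] ([dependence_at_cluster]).  After a rotation taking [q] to the first
    basis vector, dependence of the three equations forces the off-diagonal entries of [L] to have
    the same modulus ([cluster_e1_linear_part]), and they can be normalised to 1; the upper left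
    entry is 0.  If the remaining entry were not real, the rescaled loci would shrink to a circle,
    and a minimum of [Im (conj z w)] on them would have a gradient independent of the others
    ([second_diagonal_entry_real]).  So [L] is symmetric and real of negative determinant, and is
    diagonalised unitarily to [diag (lam, - mu)] with [lam, mu > 0] ([normal_form]).

    The limit points.  They lie on the Clifford torus [lam |z|^2 = mu |w|^2], [|q| = 1], and fill it
    ([clifford_cluster]): given one of them, a nearby point [t] of the torus is obtained from
    minimisers, on the loci, of the linear function whose minimum on the torus is [t].

    The nonlinear part.  Put [g = mu w a + lam z b]; the foliation is in normal form when [g = 0].
    The cancellation in the linear part makes [g] vanish to order 3.  At points of tangency
    [g / (a w - b z)] is real.  If [g] vanishes to order [m] with leading coefficient [c v] along
    [v], passing to the limit shows that [c t / (t_1 t_2)] is real for all [t] in the torus.  But this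
    quotient is multiplied by [cis ((m - 2) s)] when [t] is rotated by [cis s], and [m > 2]; so it
    vanishes ([leading_term_zero]).  By the maximum principle the resulting estimate on the cone
    over the torus spreads to a full neighbourhood ([spread_from_cone]): [g] vanishes to order
    [m + 1].  Hence [g] vanishes to all orders, and Schwarz's lemma gives [g = 0]
    ([defect_vanishes]).

    Conversely the loci of [mu w dz + lam z dw = 0] are Clifford tori ([tangency_locus_clifford]),
    which are smooth surfaces ([smooth_surface_torus]).  Division by [lam] turns the normal form into
    the linear foliation with [tau = - mu / lam], which gives both directions of the equivalence.

    The complex analysis behind this is Cauchy's theorem on rectangles, proved by bisection, and its
    consequences: the exponential carries it to annuli, which gives the mean value property and a
    formula for the derivative, hence the maximum principle, Taylor bounds of second order that
    depend only on a bound for the function, and the holomorphy of partial derivatives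
    ([hd_partials]), needed because the field in a chart involves the derivative of the chart. *)

(** * Preliminaries *)

Lemma lt_Rmin : forall x a b, x < Rmin a b -> x < a /\ x < b.
Proof. intros x a b H. pose proof (Rmin_l a b). pose proof (Rmin_r a b). lra. Qed.

Lemma lt_div : forall x a c, 0 < c -> x < a / c -> c * x < a.
Proof.
  intros x a c Hc H. apply Rmult_lt_compat_l with (r := c) in H; auto.
  replace (c * (a / c)) with a in H by (field; lra). exact H.
Qed.

Lemma div_le : forall x a c, 0 < c -> x <= c * a -> x / c <= a.
Proof.
  intros x a c Hc H. apply Rmult_le_reg_r with (1 := Hc). unfold Rdiv. rewrite Rmult_assoc, Rinv_l by lra. lra.
Qed.

Lemma choice_function : forall (A B : Type) (P : A -> B -> Prop), (forall x, exists y, P x y) -> exists f, forall x, P x (f x).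
Proof.
  intros A B P H. exists (fun x => proj1_sig (constructive_indefinite_description _ (H x))).
  intros x. exact (proj2_sig (constructive_indefinite_description _ (H x))).
Qed.

(** * One complex variable: differentiability *)

Lemma Cmod_triangle_sub : forall x y : C, Cmod (x - y) <= Cmod x + Cmod y.
Proof.
  intros x y. unfold Cminus. rewrite <- (Cmod_opp y). apply Cmod_triangle.
Qed.

Lemma Cmod_sub_sym : forall x y : C, Cmod (x - y) = Cmod (y - x).
Proof. intros x y. rewrite <- Cmod_opp. f_equal. ring. Qed.

Lemma Cmod_lower : forall x y : C, Cmod x - Cmod y <= Cmod (x + y).
Proof.
  intros x y. replace x with ((x + y) - y)%C at 1 by ring.
  pose proof (Cmod_triangle_sub (x + y) y). lra.
Qed.

Lemma Cmod_chain : forall x y z : C, Cmod (x - z) <= Cmod (x - y) + Cmod (y - z).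
Proof.
  intros x y z. replace (x - z)%C with ((x - y) + (y - z))%C by ring. apply Cmod_triangle.
Qed.

Lemma Cmod_RtoC_pos : forall r : R, 0 <= r -> Cmod (RtoC r) = r.
Proof. intros r H. rewrite Cmod_R. now apply Rabs_pos_eq. Qed.

Lemma Rabs_Re_le : forall z : C, Rabs (fst z) <= Cmod z.
Proof. intros z. eapply Rle_trans; [apply Rmax_l | apply Rmax_Cmod]. Qed.

Lemma Rabs_Im_le : forall z : C, Rabs (snd z) <= Cmod z.
Proof. intros z. eapply Rle_trans; [apply Rmax_r | apply Rmax_Cmod]. Qed.

Lemma Cmod_le_ReIm : forall z : C, Cmod z <= Rabs (fst z) + Rabs (snd z).
Proof.
  intros [x y]. simpl.
  replace (x, y) with (RtoC x + Ci * RtoC y)%C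
    by (apply injective_projections; simpl; ring).
  eapply Rle_trans; [apply Cmod_triangle|].
  rewrite Cmod_mult, Cmod_Ci, !Cmod_R. lra.
Qed.

Lemma Cmod_sqr : forall z : C, Cmod z ^ 2 = fst z ^ 2 + snd z ^ 2.
Proof. intros z. rewrite Cmod2_alt. reflexivity. Qed.

Lemma Cmod_lt_of_all : forall z : C, (forall eps, 0 < eps -> Cmod z <= eps) -> z = RtoC 0.
Proof.
  intros z H. apply Cmod_eq_0. destruct (Rle_lt_or_eq_dec _ _ (Cmod_ge_0 z)) as [h|h]; auto.
  specialize (H (Cmod z / 2)). lra.
Qed.

(** The epsilon-delta form is the one in which estimates are made; [cd_is_derive] gives access to
    the general rules of calculus. *)
Definition cd (f : C -> C) (z l : C) : Prop :=
  forall eps, 0 < eps -> exists delta, 0 < delta /\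
    forall h, Cmod h < delta -> Cmod (f (z + h) - f z - l * h)%C <= eps * Cmod h.

Lemma cd_ext_loc : forall f g z l, (exists d, 0 < d /\ forall h, Cmod h < d -> f (z + h)%C = g (z + h)%C) ->
  cd f z l -> cd g z l.
Proof.
  intros f g z l [d [Hd E]] H eps He. destruct (H eps He) as [d' [Hd' K]].
  exists (Rmin d d'). split; [now apply Rmin_glb_lt|].
  intros h Hh. rewrite <- E by (eapply Rlt_le_trans; [exact Hh|apply Rmin_l]).
  assert (E0 : f z = g z).
  { specialize (E (RtoC 0)). rewrite Cplus_0_r in E. apply E. rewrite Cmod_0. exact Hd. }
  rewrite <- E0. apply K. eapply Rlt_le_trans; [exact Hh|apply Rmin_r].
Qed.

Lemma cd_ext : forall f g z l, (forall h, f h = g h) -> cd f z l -> cd g z l.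
Proof.
  intros f g z l E. apply cd_ext_loc. exists 1. split; [lra|]. auto.
Qed.

Lemma cd_eq : forall f z l l', l = l' -> cd f z l -> cd f z l'.
Proof. intros; subst; auto. Qed.

Lemma cd_is_derive : forall f z l,
  cd f z l <-> is_derive (K := C_AbsRing) (V := AbsRing_NormedModule C_AbsRing) f z l.
Proof.
  intros f z l.
  assert (E : forall y : C, (z + (y - z))%C = y) by (intros y; ring). split; intros H.
  - split; [apply is_linear_scal_l|].
    intros x Hx. apply (is_filter_lim_locally_unique (K := C_AbsRing) (V := AbsRing_NormedModule C_AbsRing)) in Hx. subst x.
    intros eps. destruct (H eps (cond_pos eps)) as [d [Hd K]]. exists (mkposreal d Hd). intros y Hy.
    specialize (K _ Hy). rewrite E, (Cmult_comm l) in K. exact K.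
  - intros eps He. destruct (proj2 H z (fun P HP => HP) (mkposreal eps He)) as [d K].
    exists d. split; [apply cond_pos|]. intros h Hh. specialize (K (z + h)%C).
    assert (Eh : (z + h - z)%C = h) by ring.
    change (Cmod (z + h - z)%C < d -> Cmod (f (z + h) - f z - (z + h - z) * l)%C <= eps * Cmod (z + h - z)%C) in K.
    rewrite Eh, (Cmult_comm h) in K. exact (K Hh).
Qed.

Lemma cd_cont : forall f z l, cd f z l -> forall eps, 0 < eps -> exists d, 0 < d /\
  forall h, Cmod h < d -> Cmod (f (z + h) - f z)%C < eps.
Proof.
  intros f z l H eps He. destruct (H 1 Rlt_0_1) as [d [Hd K]].
  pose proof (Cmod_ge_0 l).
  assert (0 < eps / (Cmod l + 1)) by (apply Rdiv_lt_0_compat; lra).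
  exists (Rmin d (eps / (Cmod l + 1))). split; [now apply Rmin_glb_lt|].
  intros h Hh. apply lt_Rmin in Hh. destruct Hh as [h1 h2]. specialize (K h h1).
  apply lt_div in h2; [|lra].
  replace (f (z + h) - f z)%C with ((f (z + h) - f z - l * h) + l * h)%C by ring.
  eapply Rle_lt_trans; [apply Cmod_triangle|]. rewrite Cmod_mult. lra.
Qed.

Lemma cd_const : forall c z, cd (fun _ => c) z (RtoC 0).
Proof. intros c z. apply cd_is_derive. exact (is_derive_const (K := C_AbsRing) (V := AbsRing_NormedModule C_AbsRing) c z). Qed.

Lemma cd_id : forall z, cd (fun x => x) z (RtoC 1).
Proof. intros z. apply cd_is_derive. exact (is_derive_id (K := C_AbsRing) z). Qed.

Lemma cd_plus : forall f g z l m, cd f z l -> cd g z m -> cd (fun x => f x + g x)%C z (l + m)%C.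
Proof. intros f g z l m Hf Hg. apply cd_is_derive in Hf, Hg. apply cd_is_derive. exact (is_derive_plus (V := AbsRing_NormedModule C_AbsRing) f g z l m Hf Hg). Qed.

Lemma cd_minus : forall f g z l m, cd f z l -> cd g z m -> cd (fun x => f x - g x)%C z (l - m)%C.
Proof. intros f g z l m Hf Hg. apply cd_is_derive in Hf, Hg. apply cd_is_derive. exact (is_derive_minus (V := AbsRing_NormedModule C_AbsRing) f g z l m Hf Hg). Qed.

Lemma cd_mult : forall f g z l m, cd f z l -> cd g z m ->
  cd (fun x => f x * g x)%C z (l * g z + f z * m)%C.
Proof.
  intros f g z l m Hf Hg. apply cd_is_derive in Hf, Hg. apply cd_is_derive.
  exact (is_derive_mult f g z l m Hf Hg Cmult_comm).
Qed.

Lemma cd_comp : forall f g z l m, cd g z l -> cd f (g z) m -> cd (fun x => f (g x)) z (m * l)%C.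
Proof.
  intros f g z l m Hg Hf. apply cd_is_derive in Hf, Hg. apply cd_is_derive. rewrite Cmult_comm.
  exact (is_derive_comp (V := AbsRing_NormedModule C_AbsRing) f g z m l Hf Hg).
Qed.

Lemma cd_scal : forall c f z l, cd f z l -> cd (fun x => c * f x)%C z (c * l)%C.
Proof. intros c f z l H. eapply cd_eq; [|exact (cd_mult _ _ _ _ _ (cd_const c z) H)]. cbv beta. ring. Qed.

Lemma cd_sqr : forall z, cd (fun x => x * x)%C z (RtoC 2 * z)%C.
Proof.
  intros z. eapply cd_eq; [|exact (cd_mult _ _ _ _ _ (cd_id z) (cd_id z))].
  apply injective_projections; simpl; ring.
Qed.

Lemma cd_inv : forall z, z <> RtoC 0 -> cd (fun x => / x)%C z (- / (z * z))%C.
Proof.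
  intros z Hz eps He. pose proof (proj1 (Cmod_gt_0 z) Hz) as P.
  assert (P3 : 0 < Cmod z ^ 3) by now apply pow_lt.
  exists (Rmin (Cmod z / 2) (eps * Cmod z ^ 3 / 2)). split; [apply Rmin_glb_lt; nra|].
  intros h Hh. apply lt_Rmin in Hh. destruct Hh as [h1 h2].
  pose proof (Cmod_lower z h) as Lw.
  assert (N : (z + h)%C <> RtoC 0) by (apply Cmod_gt_0; lra).
  replace (/ (z + h) - / z - - / (z * z) * h)%C with (h * (h / ((z + h) * z * z)))%C by (field; auto).
  rewrite Cmod_mult, (Rmult_comm eps). apply Rmult_le_compat_l; [apply Cmod_ge_0|].
  rewrite Cmod_div, !Cmod_mult by (repeat apply Cmult_neq_0; auto).
  assert (Cmod z ^ 3 / 2 <= Cmod (z + h)%C * Cmod z * Cmod z).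
  { replace (Cmod z ^ 3 / 2) with (Cmod z / 2 * (Cmod z * Cmod z)) by field.
    rewrite Rmult_assoc. apply Rmult_le_compat_r; nra. }
  apply div_le; nra.
Qed.

Lemma cd_pow : forall n z, exists l, cd (fun x => x ^ n)%C z l.
Proof.
  induction n; intros z.
  - exists (RtoC 0). apply (cd_ext (fun _ => RtoC 1)); [reflexivity|apply cd_const].
  - destruct (IHn z) as [l H]. eexists. apply (cd_mult (fun x => x) _ _ _ _ (cd_id z) H).
Qed.

(** Mean value inequality along a segment; the real mean value theorem is applied to the
    component of [f] in the direction of the increment. *)
Lemma mean_value_inequality : forall f (f' : C -> C) z h D,
  (forall t, 0 <= t <= 1 -> cd f (z + RtoC t * h) (f' (z + RtoC t * h))%C /\
     Cmod (f' (z + RtoC t * h)%C) <= D) ->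
  Cmod (f (z + h) - f z)%C <= D * Cmod h.
Proof.
  intros f f' z h D H.
  set (u := (f (z + h) - f z)%C).
  destruct (Req_dec (Cmod u) 0) as [E|E].
  { rewrite E. destruct (H 0) as [_ K]; [lra|]. pose proof (Cmod_ge_0 h).
    pose proof (Cmod_ge_0 (f' (z + RtoC 0 * h)%C)). nra. }
  assert (P : 0 < Cmod u) by (pose proof (Cmod_ge_0 u); lra).
  set (psi := fun t => fst (Cconj u * f (z + RtoC t * h))%C).
  set (dpsi := fun t => fst (Cconj u * (f' (z + RtoC t * h) * h))%C).
  assert (Hd : forall t, 0 <= t <= 1 -> is_derive psi t (dpsi t)).
  { intros t Ht. destruct (H t Ht) as [K _]. apply is_derive_Reals. intros eps He.
    pose proof (Cmod_ge_0 h) as Ph. set (M := Cmod h + 1). assert (PM : 0 < M) by (unfold M; lra).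
    destruct (K (eps / 2 / (Cmod u * M))) as [d [Hd0 K1]]; [apply Rdiv_lt_0_compat; nra|].
    exists (mkposreal _ (Rdiv_lt_0_compat _ _ Hd0 PM)). simpl. intros s Hs Hs2. apply lt_div in Hs2; auto.
    pose proof (Rabs_pos_lt s Hs) as Ps. specialize (K1 (RtoC s * h)%C). rewrite !Cmod_mult, Cmod_R in K1.
    replace (M * Rabs s) with (Rabs s * Cmod h + Rabs s) in Hs2 by (unfold M; ring). specialize (K1 ltac:(lra)).
    replace (z + RtoC t * h + RtoC s * h)%C with (z + RtoC (t + s) * h)%C in K1 by (rewrite RtoC_plus; ring).
    unfold psi, dpsi.
    match goal with |- Rabs ?X < _ => replace X with
      (fst (Cconj u * (f (z + RtoC (t + s) * h) - f (z + RtoC t * h) - f' (z + RtoC t * h) * (RtoC s * h)))%C / s)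
      by (simpl; field; exact Hs) end.
    unfold Rdiv at 1. rewrite Rabs_mult, Rabs_inv.
    apply Rle_lt_trans with (eps / 2); [|lra]. apply div_le; auto.
    eapply Rle_trans; [apply Rabs_Re_le|]. rewrite Cmod_mult, Cmod_conj.
    apply Rle_trans with (Cmod u * (eps / 2 / (Cmod u * M) * (Rabs s * Cmod h))); [apply Rmult_le_compat_l; lra|].
    replace (Cmod u * (eps / 2 / (Cmod u * M) * (Rabs s * Cmod h))) with (Rabs s * (eps / 2) * (Cmod h / M)) by (field; lra).
    assert (Cmod h / M <= 1) by (apply div_le; unfold M; lra).
    rewrite <- (Rmult_1_r (Rabs s * (eps / 2))) at 2. apply Rmult_le_compat_l; nra. }
  destruct (MVT_gen psi 0 1 dpsi) as [c [Hc Ec]].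
  - intros x Hx. apply Hd. rewrite Rmin_left, Rmax_right in Hx by lra. lra.
  - intros x Hx. rewrite Rmin_left, Rmax_right in Hx by lra. apply derivable_continuous_pt.
    exists (dpsi x). apply is_derive_Reals. apply Hd. exact Hx.
  - rewrite Rmin_left, Rmax_right in Hc by lra.
    assert (X : psi 1 - psi 0 = Cmod u * Cmod u).
    { unfold psi. replace (z + RtoC 1 * h)%C with (z + h)%C by ring.
      replace (z + RtoC 0 * h)%C with z by ring.
      replace (Cmod u * Cmod u) with (Cmod u ^ 2) by ring. rewrite Cmod_sqr.
      unfold u. simpl. ring. }
    rewrite X in Ec. destruct (H c Hc) as [_ K].
    assert (Y : dpsi c <= Cmod u * (D * Cmod h)).
    { unfold dpsi. eapply Rle_trans; [apply Rle_abs|]. eapply Rle_trans; [apply Rabs_Re_le|].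
      rewrite !Cmod_mult, Cmod_conj. apply Rmult_le_compat_l; [lra|].
      apply Rmult_le_compat_r; [apply Cmod_ge_0|exact K]. }
    assert (Cmod u * Cmod u <= Cmod u * (D * Cmod h)) by lra.
    apply Rmult_le_reg_l with (Cmod u); auto.
Qed.

(** * Integrals of complex-valued functions of a real variable *)

Definition cint (f : R -> C) (a b : R) : C :=
  (RInt (fun t => fst (f t)) a b, RInt (fun t => snd (f t)) a b).

(** Componentwise, like the integral: the real theory then applies to each component. *)
Definition ccont (f : R -> C) (t : R) : Prop :=
  continuous (fun s => fst (f s)) t /\ continuous (fun s => snd (f s)) t.

Definition ccont_on (f : R -> C) (a b : R) : Prop := forall t, a <= t <= b -> ccont f t.

Lemma continuous_eps : forall (f : R -> R) t, continuous f t <->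
  forall eps, 0 < eps -> exists d, 0 < d /\ forall s, Rabs (s - t) < d -> Rabs (f s - f t) < eps.
Proof.
  intros f t. split; intros H.
  - intros eps He. apply continuity_pt_filterlim in H. destruct (H eps He) as [d [Hd K]]. exists d. split; auto.
    intros s Hs. destruct (Req_dec t s) as [<-|N].
    + rewrite Rminus_diag, Rabs_R0. exact He.
    + apply K. now repeat split.
  - apply continuity_pt_filterlim. intros eps He. destruct (H eps He) as [d [Hd K]]. exists d. split; auto.
    intros s [_ Hs]. exact (K s Hs).
Qed.

Lemma ccont_comp : forall (F : C -> C) f t l, ccont f t -> cd F (f t) l -> ccont (fun s => F (f s)) t.
Proof.
  intros F f t l [H1 H2] K.
  assert (Q : forall eps, 0 < eps -> exists d, 0 < d /\ forall s, Rabs (s - t) < d -> Cmod (F (f s) - F (f t))%C < eps).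
  { intros eps He. destruct (cd_cont _ _ _ K eps He) as [d [Hd D]].
    destruct (proj1 (continuous_eps _ _) H1 (d / 2)) as [d1 [Hd1 D1]]; [lra|].
    destruct (proj1 (continuous_eps _ _) H2 (d / 2)) as [d2 [Hd2 D2]]; [lra|].
    exists (Rmin d1 d2). split; [now apply Rmin_glb_lt|]. intros s Hs. apply lt_Rmin in Hs.
    specialize (D (f s - f t)%C). replace (f t + (f s - f t))%C with (f s) in D by ring. apply D.
    eapply Rle_lt_trans; [apply Cmod_le_ReIm|].
    specialize (D1 s (proj1 Hs)). specialize (D2 s (proj2 Hs)). simpl. unfold Rminus in *. lra. }
  split; apply continuous_eps; intros eps He; destruct (Q eps He) as [d [Hd D]]; exists d; split; auto;
    intros s Hs; eapply Rle_lt_trans; [|exact (D s Hs)| |exact (D s Hs)].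
  - exact (Rabs_Re_le (F (f s) - F (f t))%C).
  - exact (Rabs_Im_le (F (f s) - F (f t))%C).
Qed.

Lemma ccont_const : forall c t, ccont (fun _ => c) t.
Proof. intros c t. split; apply continuous_const. Qed.

Lemma ccont_mult : forall f g t, ccont f t -> ccont g t -> ccont (fun s => f s * g s)%C t.
Proof.
  intros f g t [F1 F2] [G1 G2]. split.
  - exact (continuous_minus (V := R_NormedModule) _ _ t (continuous_mult (K := R_AbsRing) _ _ t F1 G1) (continuous_mult (K := R_AbsRing) _ _ t F2 G2)).
  - exact (continuous_plus (V := R_NormedModule) _ _ t (continuous_mult (K := R_AbsRing) _ _ t F1 G2) (continuous_mult (K := R_AbsRing) _ _ t F2 G1)).
Qed.

Lemma ccont_scal : forall c f t, ccont f t -> ccont (fun s => c * f s)%C t.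
Proof. intros c f t H. apply ccont_mult; auto. apply ccont_const. Qed.

Lemma ccont_minus : forall f g t, ccont f t -> ccont g t -> ccont (fun s => f s - g s)%C t.
Proof.
  intros f g t [F1 F2] [G1 G2]. split.
  - exact (continuous_minus (V := R_NormedModule) _ _ t F1 G1).
  - exact (continuous_minus (V := R_NormedModule) _ _ t F2 G2).
Qed.

Lemma ex_RInt_fst : forall f a b, a <= b -> ccont_on f a b -> ex_RInt (fun t => fst (f t)) a b.
Proof.
  intros f a b Hab H. apply (ex_RInt_continuous (V := R_CompleteNormedModule)). intros t Ht.
  rewrite Rmin_left, Rmax_right in Ht by exact Hab. now apply H.
Qed.

Lemma ex_RInt_snd : forall f a b, a <= b -> ccont_on f a b -> ex_RInt (fun t => snd (f t)) a b.
Proof.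
  intros f a b Hab H. apply (ex_RInt_continuous (V := R_CompleteNormedModule)). intros t Ht.
  rewrite Rmin_left, Rmax_right in Ht by exact Hab. now apply H.
Qed.

Lemma cint_ext : forall f g a b, a <= b -> (forall t, a <= t <= b -> f t = g t) -> cint f a b = cint g a b.
Proof.
  intros f g a b Hab H. unfold cint. f_equal; apply RInt_ext; intros t Ht;
  rewrite Rmin_left, Rmax_right in Ht by exact Hab; rewrite H by lra; reflexivity.
Qed.

Lemma cint_plus : forall f g a b, a <= b -> ccont_on f a b -> ccont_on g a b ->
  cint (fun t => f t + g t)%C a b = (cint f a b + cint g a b)%C.
Proof.
  intros f g a b Hab Hf Hg. unfold cint. apply injective_projections; simpl.
  - rewrite (RInt_plus (V := R_CompleteNormedModule) (fun t => fst (f t)) (fun t => fst (g t)));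
      auto using ex_RInt_fst.
  - rewrite (RInt_plus (V := R_CompleteNormedModule) (fun t => snd (f t)) (fun t => snd (g t)));
      auto using ex_RInt_snd.
Qed.

Lemma cint_scal : forall c f a b, a <= b -> ccont_on f a b ->
  cint (fun t => c * f t)%C a b = (c * cint f a b)%C.
Proof.
  intros c f a b Hab Hf. unfold cint. apply injective_projections; simpl.
  - rewrite (RInt_minus (V := R_CompleteNormedModule)
       (fun t => scal (fst c) (fst (f t))) (fun t => scal (snd c) (snd (f t)))).
    + rewrite !(RInt_scal (V := R_CompleteNormedModule)); auto using ex_RInt_fst, ex_RInt_snd.
    + apply (ex_RInt_scal (V := R_NormedModule)). auto using ex_RInt_fst.
    + apply (ex_RInt_scal (V := R_NormedModule)). auto using ex_RInt_snd.
  - rewrite (RInt_plus (V := R_CompleteNormedModule)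
       (fun t => scal (fst c) (snd (f t))) (fun t => scal (snd c) (fst (f t)))).
    + rewrite !(RInt_scal (V := R_CompleteNormedModule)); auto using ex_RInt_fst, ex_RInt_snd.
    + apply (ex_RInt_scal (V := R_NormedModule)). auto using ex_RInt_snd.
    + apply (ex_RInt_scal (V := R_NormedModule)). auto using ex_RInt_fst.
Qed.

Lemma cint_minus : forall f g a b, a <= b -> ccont_on f a b -> ccont_on g a b ->
  cint (fun t => f t - g t)%C a b = (cint f a b - cint g a b)%C.
Proof.
  intros f g a b Hab Hf Hg.
  rewrite (cint_ext _ (fun t => f t + (- RtoC 1) * g t)%C) by (auto; intros; ring).
  rewrite cint_plus, cint_scal; auto. ring.
  intros t Ht. apply ccont_scal. auto.
Qed.

Lemma cint_chasles : forall f a b c, a <= b <= c -> ccont_on f a c ->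
  cint f a c = (cint f a b + cint f b c)%C.
Proof.
  intros f a b c Habc Hf.
  assert (H1 : ccont_on f a b) by (intros t Ht; apply Hf; lra).
  assert (H2 : ccont_on f b c) by (intros t Ht; apply Hf; lra).
  unfold cint. apply injective_projections; simpl.
  - rewrite <- (RInt_Chasles (V := R_CompleteNormedModule) _ a b c); auto; apply ex_RInt_fst; auto; lra.
  - rewrite <- (RInt_Chasles (V := R_CompleteNormedModule) _ a b c); auto; apply ex_RInt_snd; auto; lra.
Qed.

Lemma cint_const : forall c a b, cint (fun _ => c) a b = (RtoC (b - a) * c)%C.
Proof.
  intros c a b. unfold cint. rewrite !RInt_const. apply injective_projections; simpl;
  unfold scal; simpl; unfold mult; simpl; ring.
Qed.

(** Multiplication by the conjugate of the integral makes it real and positive; the bound is then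
    that of a real integral. *)
Lemma cint_bound : forall f a b M, a <= b -> ccont_on f a b ->
  (forall t, a <= t <= b -> Cmod (f t) <= M) -> Cmod (cint f a b) <= M * (b - a).
Proof.
  intros f a b M Hab Hf HM. set (u := cint f a b).
  assert (PM : 0 <= M) by (eapply Rle_trans; [apply Cmod_ge_0|apply (HM a); lra]).
  destruct (Rle_lt_or_eq_dec _ _ (Cmod_ge_0 u)) as [P|P].
  2:{ rewrite <- P. nra. }
  assert (E : Cmod u * Cmod u = fst (cint (fun t => Cconj u * f t)%C a b)).
  { rewrite cint_scal by auto. fold u. replace (Cmod u * Cmod u) with (Cmod u ^ 2) by ring.
    rewrite Cmod_sqr. simpl. ring. }
  assert (Hc : ccont_on (fun t => Cconj u * f t)%C a b) by (intros t Ht; apply ccont_scal; auto).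
  assert (L : fst (cint (fun t => Cconj u * f t)%C a b) <= RInt (fun _ => Cmod u * M) a b).
  { unfold cint. cbn [fst]. apply RInt_le; auto.
    - apply ex_RInt_fst; auto.
    - apply ex_RInt_const.
    - intros t Ht. eapply Rle_trans; [apply Rle_abs|]. eapply Rle_trans; [apply Rabs_Re_le|].
      rewrite Cmod_mult, Cmod_conj. apply Rmult_le_compat_l; [lra|]. apply HM; lra. }
  rewrite <- E, RInt_const in L. unfold scal in L; simpl in L; unfold mult in L; simpl in L.
  apply Rmult_le_reg_l with (Cmod u); auto.
  eapply Rle_trans; [exact L|]. right. ring.
Qed.

(** * Cauchy's theorem on rectangles *)

(** The boundary is run through counterclockwise; [dz = Ci dy] on the vertical sides. *)
Definition rect_int (F : C -> C) (a b c d : R) : C :=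
  (cint (fun x => F (x, c)) a b + Ci * cint (fun y => F (b, y)) c d
   - cint (fun x => F (x, d)) a b - Ci * cint (fun y => F (a, y)) c d)%C.

Definition cd_on_rect (F : C -> C) (a b c d : R) : Prop :=
  forall x y, a <= x <= b -> c <= y <= d -> exists l, cd F (x, y) l.

Lemma ccont_horizontal : forall F x y l, cd F (x, y) l -> ccont (fun s => F (s, y)) x.
Proof.
  intros F x y l H. apply (ccont_comp F (fun s => (s, y)) x l); auto.
  split; simpl; [apply continuous_id|apply continuous_const].
Qed.

Lemma ccont_vertical : forall F x y l, cd F (x, y) l -> ccont (fun s => F (x, s)) y.
Proof.
  intros F x y l H. apply (ccont_comp F (fun s => (x, s)) y l); auto.
  split; simpl; [apply continuous_const|apply continuous_id].
Qed.

Lemma ccont_on_horizontal : forall F a b c d y, cd_on_rect F a b c d -> c <= y <= d ->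
  ccont_on (fun s => F (s, y)) a b.
Proof. intros F a b c d y H Hy t Ht. destruct (H t y Ht Hy) as [l K]. eapply ccont_horizontal, K. Qed.

Lemma ccont_on_vertical : forall F a b c d x, cd_on_rect F a b c d -> a <= x <= b ->
  ccont_on (fun s => F (x, s)) c d.
Proof. intros F a b c d y H Hy t Ht. destruct (H y t Hy Ht) as [l K]. eapply ccont_vertical, K. Qed.

Lemma cd_on_rect_sub : forall F a b c d a' b' c' d', cd_on_rect F a b c d ->
  a <= a' -> b' <= b -> c <= c' -> d' <= d -> cd_on_rect F a' b' c' d'.
Proof. intros F a b c d a' b' c' d' H H1 H2 H3 H4 x y Hx Hy. apply H; lra. Qed.

Lemma rect_int_split : forall F a e b c f d, a <= e <= b -> c <= f <= d -> cd_on_rect F a b c d ->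
  rect_int F a b c d = (rect_int F a e c f + rect_int F e b c f + rect_int F a e f d + rect_int F e b f d)%C.
Proof.
  intros F a e b c f d He Hf H. unfold rect_int.
  rewrite (cint_chasles (fun x => F (x, c)) a e b), (cint_chasles (fun x => F (x, d)) a e b),
    (cint_chasles (fun y => F (a, y)) c f d), (cint_chasles (fun y => F (b, y)) c f d); try lra;
    try (eapply ccont_on_horizontal; [exact H|lra]); try (eapply ccont_on_vertical; [exact H|lra]).
  ring.
Qed.

Lemma RInt_identity : forall a b, RInt (fun x => x) a b = (b ^ 2 - a ^ 2) / 2.
Proof.
  intros a b. apply is_RInt_unique.
  replace ((b ^ 2 - a ^ 2) / 2) with (minus (b ^ 2 / 2) (a ^ 2 / 2))
    by (unfold minus, plus, opp; simpl; field).
  apply (is_RInt_derive (V := R_CompleteNormedModule) (fun x => x ^ 2 / 2)).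
  - intros x _. auto_derive; auto. field.
  - intros x _. apply continuous_id.
Qed.

Lemma rect_int_affine : forall k l a b c d, a <= b -> c <= d ->
  rect_int (fun z => k + l * z)%C a b c d = RtoC 0.
Proof.
  intros k l a b c d Hab Hcd.
  assert (A : forall y, cint (fun x => k + l * (x, y))%C a b
      = (RtoC (b - a) * k + l * ((b ^ 2 - a ^ 2) / 2, y * (b - a))%R)%C).
  { intros y. assert (Q : ccont_on (fun x => (x, y)) a b).
    { intros t _. split; simpl; [apply continuous_id|apply continuous_const]. }
    rewrite cint_plus, cint_const, cint_scal; auto.
    - unfold cint at 1. simpl. rewrite RInt_identity, RInt_const. unfold scal; simpl; unfold mult; simpl.
      f_equal. f_equal. f_equal. ring.
    - intros t _. apply ccont_const.
    - intros t Ht. apply ccont_scal; auto. }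
  assert (B : forall x, cint (fun y => k + l * (x, y))%C c d
      = (RtoC (d - c) * k + l * (x * (d - c), (d ^ 2 - c ^ 2) / 2)%R)%C).
  { intros x. assert (Q : ccont_on (fun y => (x, y)) c d).
    { intros t _. split; simpl; [apply continuous_const|apply continuous_id]. }
    rewrite cint_plus, cint_const, cint_scal; auto.
    - unfold cint at 1. simpl. rewrite RInt_identity, RInt_const. unfold scal; simpl; unfold mult; simpl.
      f_equal. f_equal. f_equal. ring.
    - intros t _. apply ccont_const.
    - intros t Ht. apply ccont_scal; auto. }
  unfold rect_int. rewrite !A, !B. apply injective_projections; simpl; field.
Qed.

(** Subtracting the affine approximation leaves the boundary integral unchanged, and the rest is
    small compared with the size of the rectangle. *)
Lemma rect_int_small : forall F a b c d z0 l eps, a <= b -> c <= d -> cd_on_rect F a b c d -> 0 <= eps ->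
  a <= fst z0 <= b -> c <= snd z0 <= d ->
  (forall x y, a <= x <= b -> c <= y <= d ->
     Cmod (F (x, y) - F z0 - l * ((x, y) - z0))%C <= eps * Cmod ((x, y) - z0)%C) ->
  Cmod (rect_int F a b c d) <= 2 * eps * ((b - a) + (d - c)) ^ 2.
Proof.
  intros F a b c d z0 l eps Hab Hcd H He Hx0 Hy0 K.
  set (A := fun z => ((F z0 - l * z0) + l * z)%C).
  set (D := fun z => (F z - A z)%C).
  assert (HA : cd_on_rect A a b c d).
  { intros x y _ _. exists (RtoC 0 + l * RtoC 1)%C. apply (cd_plus (fun _ => (F z0 - l * z0)%C)).
    apply cd_const. apply (cd_scal l (fun z => z)). apply cd_id. }
  assert (HD : cd_on_rect D a b c d).
  { intros x y Hx Hy. destruct (H x y Hx Hy) as [l1 K1]. destruct (HA x y Hx Hy) as [l2 K2].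
    exists (l1 - l2)%C. now apply cd_minus. }
  assert (E : rect_int F a b c d = rect_int D a b c d).
  { replace (rect_int D a b c d) with (rect_int F a b c d - rect_int A a b c d)%C.
    - unfold A. rewrite rect_int_affine by auto. ring.
    - unfold rect_int, D.
      rewrite !cint_minus; auto;
        try (eapply ccont_on_horizontal; [eassumption|lra]); try (eapply ccont_on_vertical; [eassumption|lra]).
      ring. }
  rewrite E. set (s := (b - a) + (d - c)).
  assert (Bd : forall x y, a <= x <= b -> c <= y <= d -> Cmod (D (x, y)) <= eps * s).
  { intros x y Hx Hy. unfold D, A.
    replace (F (x, y) - (F z0 - l * z0 + l * (x, y)))%C with (F (x, y) - F z0 - l * ((x, y) - z0))%C by ring.
    eapply Rle_trans; [apply K; auto|]. apply Rmult_le_compat_l; [exact He|].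
    eapply Rle_trans; [apply Cmod_le_ReIm|]. simpl. unfold s.
    apply Rplus_le_compat; apply Rabs_le; lra. }
  assert (H1 : Cmod (cint (fun x => D (x, c)) a b) <= eps * s * (b - a)).
  { apply cint_bound; auto. eapply ccont_on_horizontal; [exact HD|lra]. intros t Ht. apply Bd; lra. }
  assert (H2 : Cmod (cint (fun x => D (x, d)) a b) <= eps * s * (b - a)).
  { apply cint_bound; auto. eapply ccont_on_horizontal; [exact HD|lra]. intros t Ht. apply Bd; lra. }
  assert (H3 : Cmod (cint (fun y => D (a, y)) c d) <= eps * s * (d - c)).
  { apply cint_bound; auto. eapply ccont_on_vertical; [exact HD|lra]. intros t Ht. apply Bd; lra. }
  assert (H4 : Cmod (cint (fun y => D (b, y)) c d) <= eps * s * (d - c)).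
  { apply cint_bound; auto. eapply ccont_on_vertical; [exact HD|lra]. intros t Ht. apply Bd; lra. }
  unfold rect_int.
  eapply Rle_trans; [apply Cmod_triangle_sub|]. rewrite Cmod_mult, Cmod_Ci.
  eapply Rle_trans; [apply Rplus_le_compat_r, Cmod_triangle_sub|].
  eapply Rle_trans; [apply Rplus_le_compat_r, Rplus_le_compat_r, Cmod_triangle|].
  rewrite Cmod_mult, Cmod_Ci. unfold s in *. nra.
Qed.

(** Goursat's bisection.  A rectangle of the same shape and half the size carries at least a quarter
    of the integral; at the common point of a nested sequence of these, differentiability
    makes the integral smaller than any multiple of the area. *)
Lemma rect_int_zero : forall F a b c d, a <= b -> c <= d -> cd_on_rect F a b c d ->
  rect_int F a b c d = RtoC 0.
Proof.
  intros F a b c d Hab Hcd H.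
  set (ok := fun q : (R * R) * (R * R) => fst (fst q) <= snd (fst q) /\ fst (snd q) <= snd (snd q) /\
     cd_on_rect F (fst (fst q)) (snd (fst q)) (fst (snd q)) (snd (snd q))).
  set (I := fun q : (R * R) * (R * R) => Cmod (rect_int F (fst (fst q)) (snd (fst q)) (fst (snd q)) (snd (snd q)))).
  set (sub := fun q q' : (R * R) * (R * R) =>
     fst (fst q) <= fst (fst q') /\ snd (fst q') <= snd (fst q) /\
     fst (snd q) <= fst (snd q') /\ snd (snd q') <= snd (snd q) /\
     snd (fst q') - fst (fst q') = (snd (fst q) - fst (fst q)) / 2 /\
     snd (snd q') - fst (snd q') = (snd (snd q) - fst (snd q)) / 2).
  assert (Step : forall q, ok q -> exists q', ok q' /\ sub q q' /\ I q / 4 <= I q').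
  { intros [[x x'] [y y']] [Hx [Hy Hq]]. simpl in *.
    set (mx := (x + x') / 2). set (my := (y + y') / 2).
    assert (Mx : x <= mx <= x') by (unfold mx; lra).
    assert (My : y <= my <= y') by (unfold my; lra).
    assert (T : I ((x, x'), (y, y')) <= I ((x, mx), (y, my)) + I ((mx, x'), (y, my))
        + I ((x, mx), (my, y')) + I ((mx, x'), (my, y'))).
    { unfold I; simpl. rewrite (rect_int_split F x mx x' y my y') by auto.
      eapply Rle_trans; [apply Cmod_triangle|]. apply Rplus_le_compat_r.
      eapply Rle_trans; [apply Cmod_triangle|]. apply Rplus_le_compat_r. apply Cmod_triangle. }
    assert (G : forall q', I ((x, x'), (y, y')) / 4 <= I q' -> ok q' -> sub ((x, x'), (y, y')) q' ->
      exists q', ok q' /\ sub ((x, x'), (y, y')) q' /\ I ((x, x'), (y, y')) / 4 <= I q').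
    { intros q' h1 h2 h3. exists q'. auto. }
    (* when the first three quarters carry less than their share, the last one carries more *)
    destruct (Rle_dec (I ((x, x'), (y, y')) / 4) (I ((x, mx), (y, my)))) as [h1|h1];
      [apply (G _ h1)|].
    1-2: unfold ok, sub; simpl; repeat split;
      first [lra | unfold mx, my; lra | eapply cd_on_rect_sub; [exact Hq|lra..]].
    destruct (Rle_dec (I ((x, x'), (y, y')) / 4) (I ((mx, x'), (y, my)))) as [h2|h2];
      [apply (G _ h2)|].
    1-2: unfold ok, sub; simpl; repeat split;
      first [lra | unfold mx, my; lra | eapply cd_on_rect_sub; [exact Hq|lra..]].
    destruct (Rle_dec (I ((x, x'), (y, y')) / 4) (I ((x, mx), (my, y')))) as [h3|h3];
      [apply (G _ h3)|].
    1-2: unfold ok, sub; simpl; repeat split;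
      first [lra | unfold mx, my; lra | eapply cd_on_rect_sub; [exact Hq|lra..]].
    apply (G ((mx, x'), (my, y'))); [lra|..];
    unfold ok, sub; simpl; repeat split;
      first [lra | unfold mx, my; lra | eapply cd_on_rect_sub; [exact Hq|lra..]]. }
  set (nxt := fun q => match excluded_middle_informative (ok q) with
     | left h => proj1_sig (constructive_indefinite_description _ (Step q h)) | right _ => q end).
  assert (Nx : forall q, ok q -> ok (nxt q) /\ sub q (nxt q) /\ I q / 4 <= I (nxt q)).
  { intros q h. unfold nxt. destruct (excluded_middle_informative (ok q)) as [h'|h']; [|contradiction].
    exact (proj2_sig (constructive_indefinite_description _ (Step q h'))). }
  set (q0 := ((a, b), (c, d))).
  set (u := fun n => Nat.iter n nxt q0).
  assert (Ok : forall n, ok (u n)).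
  { induction n; [unfold u, ok; simpl; auto|]. apply (Nx _ IHn). }
  assert (Mono : forall n k, fst (fst (u n)) <= fst (fst (u (n + k)%nat)) /\ snd (fst (u (n + k)%nat)) <= snd (fst (u n)) /\
     fst (snd (u n)) <= fst (snd (u (n + k)%nat)) /\ snd (snd (u (n + k)%nat)) <= snd (snd (u n))).
  { intros n. induction k; [rewrite Nat.add_0_r; lra|]. rewrite Nat.add_succ_r.
    destruct (Nx _ (Ok (n + k)%nat)) as [_ [S _]]. destruct S as [S1 [S2 [S3 [S4 _]]]].
    change (nxt (u (n + k)%nat)) with (u (S (n + k))) in *. lra. }
  assert (Len : forall n, snd (fst (u n)) - fst (fst (u n)) = (b - a) / 2 ^ n /\
      snd (snd (u n)) - fst (snd (u n)) = (d - c) / 2 ^ n).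
  { induction n; [simpl; lra|]. destruct (Nx _ (Ok n)) as [_ [S _]].
    destruct S as [_ [_ [_ [_ [S5 S6]]]]]. change (nxt (u n)) with (u (S n)) in *.
    destruct IHn as [L1 L2]. rewrite S5, S6, L1, L2. simpl.
    assert (0 < 2 ^ n) by (apply pow_lt; lra). split; field; lra. }
  assert (Int : forall n, I q0 / 4 ^ n <= I (u n)).
  { induction n; [simpl; unfold u; simpl; lra|]. destruct (Nx _ (Ok n)) as [_ [_ Q]].
    change (nxt (u n)) with (u (S n)) in *.
    replace (I q0 / 4 ^ S n) with (I q0 / 4 ^ n / 4). lra.
    simpl. assert (0 < 4 ^ n) by (apply pow_lt; lra). field; lra. }
  assert (Nested : forall lo hi : nat -> R, (forall n m, lo n <= hi m) -> exists x, forall n, lo n <= x <= hi n).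
  { intros lo hi Hlh.
    destruct (completeness (fun y => exists n, y = lo n)) as [x [X1 X2]].
    - exists (hi 0%nat). intros y [n ->]. apply Hlh.
    - exists (lo 0%nat). now exists 0%nat.
    - exists x. intros n. split; [apply X1; now exists n|]. apply X2. intros y [m ->]. apply Hlh. }
  destruct (Nested (fun n => fst (fst (u n))) (fun n => snd (fst (u n)))) as [x Hx].
  { intros n m. destruct (Mono n m) as [A1 _]. destruct (Mono m n) as [_ [A2 _]].
    destruct (Ok (n + m)%nat) as [A3 _]. rewrite (Nat.add_comm m n) in A2. lra. }
  destruct (Nested (fun n => fst (snd (u n))) (fun n => snd (snd (u n)))) as [y Hy].
  { intros n m. destruct (Mono n m) as [_ [_ [A1 _]]]. destruct (Mono m n) as [_ [_ [_ A2]]].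
    destruct (Ok (n + m)%nat) as [_ [A3 _]]. rewrite (Nat.add_comm m n) in A2. lra. }
  apply Cmod_eq_0. change (I q0 = 0).
  destruct (Rle_lt_or_eq_dec 0 (I q0) (Cmod_ge_0 _)) as [P|P]; [exfalso|auto].
  destruct (H x y (Hx 0%nat) (Hy 0%nat)) as [l K].
  set (s := (b - a) + (d - c)).
  assert (Ps : 0 <= s) by (unfold s; lra).
  set (eps := I q0 / (4 * (s + 1) ^ 2)).
  assert (Pe : 0 < eps) by (apply Rdiv_lt_0_compat; [exact P|nra]).
  destruct (K eps Pe) as [del [Pd Kd]].
  assert (Small : exists n, (s + 1) / 2 ^ n < del).
  { destruct (Pow_x_infinity 2 ltac:(rewrite Rabs_pos_eq; lra) ((s + 1) / del + 1)) as [n Hn].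
    exists n. specialize (Hn n (le_n n)). rewrite Rabs_pos_eq in Hn by (apply pow_le; lra).
    assert (0 < 2 ^ n) by (apply pow_lt; lra).
    apply Rmult_lt_reg_r with (2 ^ n); auto. unfold Rdiv. rewrite Rmult_assoc, Rinv_l, Rmult_1_r by lra.
    apply Rmult_lt_reg_r with (/ del); [now apply Rinv_0_lt_compat|].
    replace (del * 2 ^ n * / del) with (2 ^ n) by (field; lra). unfold Rdiv in Hn. lra. }
  destruct Small as [n Hn]. destruct (Len n) as [L1 L2]. specialize (Hx n). specialize (Hy n).
  assert (P2 : 0 < 2 ^ n) by (apply pow_lt; lra).
  assert (Sn : (s + 1) / 2 ^ n = (b - a) / 2 ^ n + (d - c) / 2 ^ n + 1 / 2 ^ n) by (unfold s; field; lra).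
  assert (P3 : 0 < 1 / 2 ^ n) by (apply Rdiv_lt_0_compat; lra).
  destruct (Ok n) as [O1 [O2 O3]].
  assert (Q : I (u n) <= 2 * eps * ((snd (fst (u n)) - fst (fst (u n))) + (snd (snd (u n)) - fst (snd (u n)))) ^ 2).
  { apply rect_int_small with (z0 := (x, y)) (l := l); simpl; auto; [lra|].
    intros x' y' Hx' Hy'. set (h := ((x', y') - (x, y))%C).
    replace (x', y') with ((x, y) + h)%C by (unfold h; ring).
    apply Kd. eapply Rle_lt_trans; [apply Cmod_le_ReIm|]. unfold h; simpl.
    apply Rle_lt_trans with ((b - a) / 2 ^ n + (d - c) / 2 ^ n); [|lra].
    apply Rplus_le_compat; apply Rabs_le; lra. }
  rewrite L1, L2 in Q. pose proof (Int n) as Q2.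
  replace ((b - a) / 2 ^ n + (d - c) / 2 ^ n) with (s / 2 ^ n) in Q by (unfold s; field; lra).
  assert (E4 : 4 ^ n = 2 ^ n * 2 ^ n).
  { replace 4 with (2 * 2) by ring. apply Rpow_mult_distr. }
  rewrite E4 in Q2.
  assert (Q3 : I q0 / (2 ^ n * 2 ^ n) <= 2 * eps * (s / 2 ^ n) ^ 2) by lra.
  apply Rmult_le_compat_r with (r := 2 ^ n * 2 ^ n) in Q3; [|nra].
  replace (I q0 / (2 ^ n * 2 ^ n) * (2 ^ n * 2 ^ n)) with (I q0) in Q3 by (field; lra).
  replace (2 * eps * (s / 2 ^ n) ^ 2 * (2 ^ n * 2 ^ n)) with (2 * eps * s ^ 2) in Q3 by (field; lra).
  assert (Q4 : eps * (4 * (s + 1) ^ 2) = I q0) by (unfold eps; field; nra).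
  nra.
Qed.

(** * Circle means and the maximum principle *)

Definition cis (t : R) : C := (cos t, sin t).

Lemma Cmod_cis : forall t, Cmod (cis t) = 1.
Proof.
  intros t. pose proof (Cmod_sqr (cis t)) as E. unfold cis in *. simpl fst in E. simpl snd in E.
  pose proof (sin2_cos2 t) as H. unfold Rsqr in H. pose proof (Cmod_ge_0 (cos t, sin t)). nra.
Qed.

Lemma cis_add : forall s t, cis (s + t) = (cis s * cis t)%C.
Proof. intros s t. unfold cis. rewrite cos_plus, sin_plus. apply injective_projections; simpl; ring. Qed.

Lemma ccont_cis : forall t, ccont cis t.
Proof.
  intros t. split; unfold cis; simpl.
  - apply continuity_pt_filterlim, continuity_cos.
  - apply continuity_pt_filterlim, continuity_sin.
Qed.

Definition cexp (z : C) : C := (RtoC (exp (fst z)) * cis (snd z))%C.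

Lemma cexp_add : forall z w, cexp (z + w)%C = (cexp z * cexp w)%C.
Proof.
  intros z w. unfold cexp. simpl. rewrite exp_plus, cis_add, RtoC_mult. ring.
Qed.

Lemma Cmod_cexp : forall z, Cmod (cexp z) = exp (fst z).
Proof.
  intros z. unfold cexp. rewrite Cmod_mult, Cmod_cis, Cmod_RtoC_pos; [ring|]. left; apply exp_pos.
Qed.

Lemma derivative_at_0 : forall f l, derivable_pt_lim f 0 l -> forall eps, 0 < eps ->
  exists d, 0 < d /\ forall x, Rabs x < d -> Rabs (f x - f 0 - l * x) <= eps * Rabs x.
Proof.
  intros f l H eps He. destruct (H eps He) as [d K]. exists d. split; [apply cond_pos|].
  intros x Hx. destruct (Req_dec x 0) as [->|N].
  { replace (f 0 - f 0 - l * 0) with 0 by ring. rewrite Rabs_R0. lra. }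
  specialize (K x N Hx). rewrite Rplus_0_l in K.
  replace (f x - f 0 - l * x) with (((f x - f 0) / x - l) * x) by (field; exact N).
  rewrite Rabs_mult. apply Rmult_le_compat_r; [apply Rabs_pos|lra].
Qed.

(** Only the derivative at 0 needs an estimate; the addition formula transports it elsewhere. *)
Lemma cd_cexp : forall z, cd cexp z (cexp z).
Proof.
  assert (H0 : cd cexp (RtoC 0) (RtoC 1)).
  { intros eps He.
    set (e := Rmin 1 (eps / 16)).
    assert (P : 0 < e) by (apply Rmin_glb_lt; lra).
    assert (e1 : e <= 1) by apply Rmin_l. assert (e2 : e <= eps / 16) by apply Rmin_r.
    clearbody e.
    pose proof (derivable_pt_lim_exp 0) as D1. rewrite exp_0 in D1.
    pose proof (derivable_pt_lim_cos 0) as D2. rewrite sin_0 in D2.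
    pose proof (derivable_pt_lim_sin 0) as D3. rewrite cos_0 in D3.
    destruct (derivative_at_0 _ _ D1 e P) as [d1 [Q1 K1]].
    destruct (derivative_at_0 _ _ D2 e P) as [d2 [Q2 K2]].
    destruct (derivative_at_0 _ _ D3 e P) as [d3 [Q3 K3]].
    rewrite exp_0 in K1. rewrite cos_0 in K2. rewrite sin_0 in K3.
    exists (Rmin (Rmin d1 d2) (Rmin d3 e)). split; [repeat apply Rmin_glb_lt; auto|].
    intros [x y] Hh.
    assert (Hm : Cmod (x, y) < d1 /\ Cmod (x, y) < d2 /\ Cmod (x, y) < d3 /\ Cmod (x, y) < e).
    { pose proof (Rmin_l (Rmin d1 d2) (Rmin d3 e)). pose proof (Rmin_r (Rmin d1 d2) (Rmin d3 e)).
      pose proof (Rmin_l d1 d2). pose proof (Rmin_r d1 d2).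
      pose proof (Rmin_l d3 e). pose proof (Rmin_r d3 e). lra. }
    destruct Hm as [M1 [M2 [M3 M4]]].
    pose proof (Rabs_Re_le (x, y)) as Bx. pose proof (Rabs_Im_le (x, y)) as By. simpl in Bx, By.
    set (m := Cmod (x, y)) in *.
    specialize (K1 x ltac:(lra)). specialize (K2 y ltac:(lra)). specialize (K3 y ltac:(lra)).
    set (a := exp x - 1 - 1 * x) in K1.
    set (b := cos y - 1 - - (0) * y) in K2.
    set (c := sin y - 0 - 1 * y) in K3.
    assert (Ea : exp x = 1 + x + a) by (unfold a; ring).
    assert (Eb : cos y = 1 + b) by (unfold b; ring).
    assert (Ec : sin y = y + c) by (unfold c; ring).
    assert (Z : cexp (RtoC 0) = RtoC 1).
    { unfold cexp, cis. simpl. rewrite exp_0, cos_0, sin_0. apply injective_projections; simpl; ring. }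
    rewrite Cplus_0_l, Z.
    eapply Rle_trans; [apply Cmod_le_ReIm|]. unfold cexp, cis. simpl. rewrite Ea, Eb, Ec.
    pose proof (Rabs_pos x). pose proof (Rabs_pos y).
    assert (Ba : Rabs a <= e * m) by nra.
    assert (Bb : Rabs b <= e * m) by nra.
    assert (Bc : Rabs c <= e * m) by nra.
    assert (m0 : 0 <= m) by (unfold m; apply Cmod_ge_0).
    clearbody a b c m. clear K1 K2 K3.
    apply Rabs_le_between in Ba. apply Rabs_le_between in Bb. apply Rabs_le_between in Bc.
    assert (Bx' : Rabs x <= m) by lra. assert (By' : Rabs y <= m) by lra.
    apply Rabs_le_between in Bx'. apply Rabs_le_between in By'.
    assert (U : forall s t p q, -p <= s <= p -> -q <= t <= q -> - (p*q) <= s * t <= p * q).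
    { intros s t p q [h1 h2] [h3 h4]. split; nra. }
    pose proof (U _ _ _ _ Bx' Bb) as U1. pose proof (U _ _ _ _ Ba Bb) as U2.
    pose proof (U _ _ _ _ Bx' By') as U3. pose proof (U _ _ _ _ Bx' Bc) as U4.
    pose proof (U _ _ _ _ Ba By') as U5. pose proof (U _ _ _ _ Ba Bc) as U6.
    assert (V1 : m * (e * m) <= e * m) by nra.
    assert (V2 : e * m * (e * m) <= e * m) by nra.
    assert (V3 : m * m <= e * m) by nra.
    assert (V4 : e * m * m <= e * m) by nra.
    assert (W : 8 * (e * m) <= eps * m) by nra.
    assert (T1 : Rabs ((1 + x + a) * (1 + b) - 0 * (y + c) + - (1) + - (1 * x - 0 * y)) <= 4 * (e * m)).
    { apply Rabs_le. nra. }
    assert (T2 : Rabs ((1 + x + a) * (y + c) + 0 * (1 + b) + - 0 + - (1 * y + 0 * x)) <= 4 * (e * m) + e * m).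
    { apply Rabs_le. nra. }
    nra. }
  intros z. eapply cd_ext; [|eapply cd_eq; [|apply (cd_scal (cexp z) (fun w => cexp (w - z)%C) z (RtoC 1))]].
  - intros w. simpl. rewrite <- cexp_add. f_equal. ring.
  - ring.
  - apply (cd_eq _ _ (RtoC 1 * (RtoC 1 - RtoC 0))%C); [ring|].
    apply (cd_comp cexp (fun w => (w - z)%C)).
    + apply (cd_minus (fun w => w)). apply cd_id. apply cd_const.
    + replace (z - z)%C with (RtoC 0) by ring. exact H0.
Qed.

Definition circ (P : C -> C) (r : R) : C := cint (fun t => P (RtoC r * cis t)%C) 0 (2 * PI).

Lemma two_PI_pos : 0 < 2 * PI.
Proof. pose proof PI_RGT_0. lra. Qed.

Lemma ccont_circle : forall (P : C -> C) r t l, cd P (RtoC r * cis t)%C l ->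
  ccont (fun t => P (RtoC r * cis t)%C) t.
Proof.
  intros P r t l H. eapply ccont_comp; [apply ccont_scal, ccont_cis|exact H].
Qed.

Lemma Cmod_circle : forall r t, 0 <= r -> Cmod (RtoC r * cis t)%C = r.
Proof. intros r t H. rewrite Cmod_mult, Cmod_cis, Cmod_RtoC_pos; lra. Qed.

(** Cauchy's theorem for the annulus: in logarithmic coordinates the annulus becomes a
    rectangle whose two horizontal sides cancel by periodicity. *)
Lemma circ_const : forall P r R0, 0 < r <= R0 ->
  (forall z, z <> RtoC 0 -> Cmod z <= R0 -> exists l, cd P z l) -> circ P r = circ P R0.
Proof.
  intros P r R0 Hr H. pose proof two_PI_pos as P2.
  set (F := fun z => P (cexp z)).
  assert (L : ln r <= ln R0).
  { destruct Hr as [h1 h2]. destruct (Rle_lt_or_eq_dec _ _ h2) as [h|h]; [|subst; lra].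
    left. apply ln_increasing; lra. }
  assert (HF : cd_on_rect F (ln r) (ln R0) 0 (2 * PI)).
  { intros x y Hx Hy. destruct (H (cexp (x, y))) as [l Hl].
    - apply Cmod_gt_0. rewrite Cmod_cexp. apply exp_pos.
    - rewrite Cmod_cexp. simpl. rewrite <- (exp_ln R0) by lra.
      destruct (Rle_lt_or_eq_dec _ _ (proj2 Hx)) as [h|h]; [left; now apply exp_increasing|subst; lra].
    - exists (l * cexp (x, y))%C. apply (cd_comp P cexp); auto. apply cd_cexp. }
  pose proof (rect_int_zero F _ _ _ _ L (Rlt_le _ _ P2) HF) as Z.
  unfold rect_int in Z.
  rewrite (cint_ext (fun x => F (x, 2 * PI)) (fun x => F (x, 0))) in Z; auto.
  2:{ intros t _. unfold F, cexp, cis. simpl. rewrite cos_2PI, sin_2PI, cos_0, sin_0. reflexivity. }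
  assert (X : forall q, 0 < q -> cint (fun y => F (ln q, y)) 0 (2 * PI) = circ P q).
  { intros q Hq. unfold circ. apply cint_ext; [lra|]. intros t _. unfold F, cexp. simpl.
    rewrite exp_ln; auto. }
  rewrite !X in Z by lra.
  assert (Y : (Ci * (circ P R0 - circ P r))%C = RtoC 0) by (rewrite <- Z; ring).
  apply Ceq_minus. destruct (Ceq_dec (circ P R0 - circ P r)%C (RtoC 0)) as [E|E].
  - replace (circ P r - circ P R0)%C with (- (circ P R0 - circ P r))%C by ring. rewrite E. ring.
  - exfalso. apply (Cmult_neq_0 Ci (circ P R0 - circ P r)%C Ci_nz E Y).
Qed.

(** As the circle integral does not depend on the radius, its value is decided by the limit of [P]
    at the puncture. *)
Lemma circ_limit : forall P R0 L, 0 < R0 ->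
  (forall z, z <> RtoC 0 -> Cmod z <= R0 -> exists l, cd P z l) ->
  (forall eps, 0 < eps -> exists d, 0 < d /\ forall z, z <> RtoC 0 -> Cmod z < d -> Cmod (P z - L)%C <= eps) ->
  circ P R0 = (RtoC (2 * PI) * L)%C.
Proof.
  intros P R0 L HR H HL. pose proof two_PI_pos as P2.
  apply Ceq_minus. apply Cmod_lt_of_all. intros eps He.
  destruct (HL (eps / (2 * PI))) as [d [Hd K]]; [now apply Rdiv_lt_0_compat|].
  set (r := Rmin R0 (d / 2)).
  assert (Pr : 0 < r) by (apply Rmin_glb_lt; lra).
  assert (r1 : r <= R0) by apply Rmin_l. assert (r2 : r <= d / 2) by apply Rmin_r.
  rewrite <- (circ_const P r R0) by (auto; lra).
  assert (N : forall t, (RtoC r * cis t)%C <> RtoC 0).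
  { intros t. apply Cmod_gt_0. rewrite Cmod_circle; lra. }
  assert (Hc : ccont_on (fun t => P (RtoC r * cis t)%C) 0 (2 * PI)).
  { intros t _. destruct (H (RtoC r * cis t)%C) as [l Hl]; auto.
    - rewrite Cmod_circle; lra.
    - eapply ccont_circle, Hl. }
  replace (RtoC (2 * PI) * L)%C with (cint (fun _ => L) 0 (2 * PI)).
  2:{ rewrite cint_const. f_equal. f_equal. ring. }
  unfold circ. rewrite <- cint_minus; auto; [|lra|intros t _; apply ccont_const].
  replace eps with (eps / (2 * PI) * (2 * PI - 0)) by (field; pose proof PI_RGT_0; lra).
  apply cint_bound; [lra| |].
  - intros t Ht. apply ccont_minus; [auto|apply ccont_const].
  - intros t _. apply K; auto. rewrite Cmod_circle; lra.
Qed.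

Lemma mean_value : forall f R0, 0 < R0 -> (forall z, Cmod z <= R0 -> exists l, cd f z l) ->
  circ f R0 = (RtoC (2 * PI) * f (RtoC 0))%C.
Proof.
  intros f R0 HR H. apply circ_limit; auto.
  destruct (H (RtoC 0)) as [l K]; [rewrite Cmod_0; lra|].
  intros eps He. destruct (cd_cont _ _ _ K eps He) as [d [Hd D]]. exists d. split; auto.
  intros z _ Hz. specialize (D z Hz). rewrite Cplus_0_l in D. lra.
Qed.

Lemma cd_quotient : forall f g z l m, cd f z l -> cd g z m -> g z <> RtoC 0 ->
  exists k, cd (fun w => f w / g w)%C z k.
Proof.
  intros f g z l m Hf Hg N. eexists. unfold Cdiv. apply cd_mult; [exact Hf|].
  eapply cd_comp; [exact Hg|]. apply cd_inv. exact N.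
Qed.

(** The derivative at the centre is a circle mean of difference quotients. *)
Lemma circ_derivative : forall f R0 l, 0 < R0 -> (forall z, Cmod z <= R0 -> exists l, cd f z l) ->
  cd f (RtoC 0) l ->
  circ (fun z => (f z - f (RtoC 0)) / z)%C R0 = (RtoC (2 * PI) * l)%C.
Proof.
  intros f R0 l HR H Hl. apply circ_limit; auto.
  - intros z N Hz. destruct (H z Hz) as [k Hk].
    eapply (cd_quotient (fun z => f z - f (RtoC 0))%C (fun z => z)); [|apply cd_id|exact N].
    apply cd_minus; [exact Hk|apply cd_const].
  - intros eps He. destruct (Hl eps He) as [d [Hd K]]. exists d. split; auto.
    intros z N Hz. specialize (K z Hz). rewrite Cplus_0_l in K.
    replace ((f z - f (RtoC 0)) / z - l)%C with ((f z - f (RtoC 0) - l * z) * / z)%C by (field; auto).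
    pose proof (proj1 (Cmod_gt_0 z) N).
    rewrite Cmod_mult, Cmod_inv by auto. apply Rmult_le_reg_r with (Cmod z); auto.
    rewrite Rmult_assoc, Rinv_l by lra. lra.
Qed.

Lemma circ_bound : forall P r M, 0 < r -> (forall t, ccont (fun t => P (RtoC r * cis t)%C) t) ->
  (forall z, Cmod z = r -> Cmod (P z) <= M) -> Cmod (circ P r) <= 2 * PI * M.
Proof.
  intros P r M Hr Hc HM. unfold circ. replace (2 * PI * M) with (M * (2 * PI - 0)) by ring.
  pose proof two_PI_pos.
  apply cint_bound; [lra|intros t _; apply Hc|]. intros t _. apply HM. rewrite Cmod_circle; lra.
Qed.

Lemma two_PI_mult_le : forall x M, Cmod (RtoC (2 * PI) * x)%C <= 2 * PI * M -> Cmod x <= M.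
Proof.
  intros x M H. pose proof two_PI_pos as P. rewrite Cmod_mult, Cmod_RtoC_pos in H by lra.
  apply Rmult_le_reg_l with (1 := P). exact H.
Qed.

(** A disc automorphism carries an arbitrary interior point to the centre, where the mean
    value property bounds [f] by its boundary values. *)
Lemma maximum_principle_unit : forall f B, (forall z, Cmod z <= 1 -> exists l, cd f z l) ->
  (forall z, Cmod z = 1 -> Cmod (f z) <= B) -> forall u, Cmod u <= 1 -> Cmod (f u) <= B.
Proof.
  intros f B H HB u Hu.
  destruct (Rle_lt_or_eq_dec _ _ Hu) as [Lu|Eu]; [|auto].
  set (m := fun z => ((z + u) / (1 + Cconj u * z))%C).
  assert (Den : forall z, Cmod z <= 1 -> (1 + Cconj u * z)%C <> RtoC 0).
  { intros z Hz. apply Cmod_gt_0. pose proof (Cmod_lower (RtoC 1) (Cconj u * z)%C) as L.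
    rewrite Cmod_1, Cmod_mult, Cmod_conj in L.
    pose proof (Cmod_ge_0 z). pose proof (Cmod_ge_0 u). nra. }
  assert (Id : forall z, Cmod (1 + Cconj u * z)%C ^ 2 - Cmod (z + u)%C ^ 2 = (1 - Cmod z ^ 2) * (1 - Cmod u ^ 2)).
  { intros z. rewrite !Cmod_sqr. simpl. ring. }
  assert (Mm : forall z, Cmod z <= 1 -> Cmod (m z) <= 1).
  { intros z Hz. unfold m. rewrite Cmod_div by auto.
    pose proof (proj1 (Cmod_gt_0 _) (Den z Hz)) as P. apply Rmult_le_reg_r with (1 := P).
    unfold Rdiv. rewrite Rmult_assoc, Rinv_l by lra.
    specialize (Id z). pose proof (Cmod_ge_0 z). pose proof (Cmod_ge_0 u).
    assert (0 <= (1 - Cmod z ^ 2) * (1 - Cmod u ^ 2)) by (apply Rmult_le_pos; nra).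
    pose proof (Cmod_ge_0 (z + u)%C). nra. }
  assert (M1 : forall z, Cmod z = 1 -> Cmod (m z) = 1).
  { intros z Hz. unfold m. rewrite Cmod_div by (apply Den; lra).
    pose proof (proj1 (Cmod_gt_0 _) (Den z (Req_le _ _ Hz))) as P.
    specialize (Id z). rewrite Hz in Id. pose proof (Cmod_ge_0 (z + u)%C).
    assert (E : Cmod (z + u)%C = Cmod (1 + Cconj u * z)%C) by nra.
    rewrite E. field. lra. }
  set (g := fun z => f (m z)).
  assert (Hg : forall z, Cmod z <= 1 -> exists l, cd g z l).
  { intros z Hz. destruct (H (m z) (Mm z Hz)) as [l Hl].
    destruct (cd_quotient (fun z => z + u)%C (fun z => 1 + Cconj u * z)%C z (RtoC 1 + RtoC 0) (RtoC 0 + Cconj u * RtoC 1))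
      as [k Hk]; [| |apply (Den z Hz)|].
    - apply (cd_plus (fun z => z)). apply cd_id. apply cd_const.
    - apply (cd_plus (fun _ => RtoC 1)). apply cd_const. apply (cd_scal _ (fun z => z)), cd_id.
    - exists (l * k)%C. apply (cd_comp f m); auto. }
  pose proof (mean_value g 1 Rlt_0_1 Hg) as MV.
  assert (E0 : g (RtoC 0) = f u) by (unfold g, m; f_equal; field; split; apply C1_nz).
  rewrite E0 in MV. apply two_PI_mult_le. rewrite <- MV. apply circ_bound; [lra| |].
  - intros t. destruct (Hg (RtoC 1 * cis t)%C) as [l Hl]; [rewrite Cmod_circle; lra|].
    eapply ccont_circle, Hl.
  - intros z Hz. unfold g. apply HB. auto.
Qed.

Lemma maximum_principle : forall f r B, 0 < r -> (forall z, Cmod z <= r -> exists l, cd f z l) ->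
  (forall z, Cmod z = r -> Cmod (f z) <= B) -> forall u, Cmod u <= r -> Cmod (f u) <= B.
Proof.
  intros f r B Hr H HB u Hu.
  assert (N : RtoC r <> RtoC 0) by (intros E; apply RtoC_inj in E; lra).
  assert (Sc : forall z, Cmod (RtoC r * z)%C = r * Cmod z).
  { intros z. rewrite Cmod_mult, Cmod_RtoC_pos; lra. }
  replace u with (RtoC r * (u / RtoC r))%C by (field; exact N).
  apply (maximum_principle_unit (fun z => f (RtoC r * z)%C)).
  - intros z Hz. destruct (H (RtoC r * z)%C) as [l Hl]; [rewrite Sc; nra|].
    exists (l * (RtoC r * RtoC 1))%C. apply (cd_comp f (fun z => RtoC r * z)%C); auto.
    apply (cd_scal _ (fun z => z)), cd_id.
  - intros z Hz. apply HB. rewrite Sc, Hz. ring.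
  - rewrite Cmod_div by exact N. rewrite Cmod_RtoC_pos by lra.
    apply Rmult_le_reg_r with (1 := Hr). unfold Rdiv. rewrite Rmult_assoc, Rinv_l; lra.
Qed.

Lemma cd_translate : forall f z0 z l, cd f (z0 + z)%C l -> cd (fun w => f (z0 + w)%C) z l.
Proof.
  intros f z0 z l H. eapply cd_eq; [|apply (cd_comp f (fun w => (z0 + w)%C))].
  2:{ apply (cd_plus (fun _ => z0)). apply cd_const. apply cd_id. }
  2: exact H. ring.
Qed.

(** The factor 2 comes from the increment [f w - f 0] in the difference quotients averaged by
    [circ_derivative]. *)
Lemma cauchy_estimate : forall f l B, (forall z, Cmod z <= 1 -> exists l, cd f z l) -> cd f (RtoC 0) l ->
  (forall z, Cmod z <= 1 -> Cmod (f z) <= B) -> Cmod l <= 2 * B.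
Proof.
  intros f l B Hf Hl HB. apply two_PI_mult_le. rewrite <- (circ_derivative f 1 l Rlt_0_1 Hf Hl).
  assert (N1 : forall z, Cmod z = 1 -> z <> RtoC 0) by (intros z Hz; apply Cmod_gt_0; lra).
  apply circ_bound; [lra| |].
  - intros t. assert (Ct : Cmod (RtoC 1 * cis t)%C = 1) by (apply Cmod_circle; lra).
    destruct (Hf (RtoC 1 * cis t)%C) as [m Hm]; [lra|].
    destruct (cd_quotient (fun w => f w - f (RtoC 0))%C (fun w => w) (RtoC 1 * cis t)%C (m - RtoC 0)%C (RtoC 1)) as [k Hk]; auto.
    + apply cd_minus; [exact Hm|apply cd_const].
    + apply cd_id.
    + exact (ccont_circle (fun w => (f w - f (RtoC 0)) / w)%C 1 t k Hk).
  - intros w Hw. rewrite Cmod_div, Hw by auto. unfold Rdiv. rewrite Rinv_1, Rmult_1_r.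
    eapply Rle_trans; [apply Cmod_triangle_sub|].
    assert (Cmod (f w) <= B) by (apply HB; lra). assert (Cmod (f (RtoC 0)) <= B) by (apply HB; rewrite Cmod_0; lra). lra.
Qed.

(** Cauchy's estimate on unit discs bounds [f'], hence the increments of [f]; applied to these
    increments it bounds those of [f']. *)
Lemma taylor2_bound : forall f (f' : C -> C) B, (forall z, Cmod z <= 4 -> cd f z (f' z)) ->
  (forall z, Cmod z <= 4 -> Cmod (f z) <= B) ->
  (forall z, Cmod z <= 3 -> Cmod (f' z) <= 2 * B) /\
  (forall h, Cmod h <= 1 -> Cmod (f h - f (RtoC 0) - f' (RtoC 0) * h)%C <= 4 * B * Cmod h ^ 2).
Proof.
  intros f f' B H HB.
  assert (Tr : forall z w, Cmod z <= 3 -> Cmod w <= 1 -> Cmod (z + w)%C <= 4) by (intros z w; pose proof (Cmod_triangle z w); lra).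
  assert (At0 : forall z, Cmod z <= 3 -> cd (fun w => f (z + w)%C) (RtoC 0) (f' z)).
  { intros z Hz. apply cd_translate. rewrite Cplus_0_r. apply H. lra. }
  assert (E1 : forall z, Cmod z <= 3 -> Cmod (f' z) <= 2 * B).
  { intros z Hz. apply (cauchy_estimate (fun w => f (z + w)%C)); auto.
    intros w Hw. exists (f' (z + w)%C). apply cd_translate, H; auto. }
  split; [exact E1|].
  assert (E2 : forall z h, Cmod z <= 2 -> Cmod h <= 1 -> Cmod (f (z + h) - f z)%C <= 2 * B * Cmod h).
  { intros z h Hz Hh. apply (mean_value_inequality f f'). intros t Ht.
    assert (Cmod (z + RtoC t * h)%C <= 3).
    { eapply Rle_trans; [apply Cmod_triangle|]. rewrite Cmod_mult, Cmod_RtoC_pos by lra.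
      pose proof (Cmod_ge_0 h). nra. }
    split; [apply H; lra|apply E1; lra]. }
  assert (E3 : forall h, Cmod h <= 1 -> Cmod (f' h - f' (RtoC 0))%C <= 4 * B * Cmod h).
  { intros h Hh. replace (4 * B * Cmod h) with (2 * (2 * B * Cmod h)) by ring.
    apply (cauchy_estimate (fun w => f (h + w) - f (RtoC 0 + w))%C).
    - intros w Hw. exists (f' (h + w) - f' (RtoC 0 + w))%C.
      apply cd_minus; apply cd_translate, H, Tr; auto; rewrite ?Cmod_0; lra.
    - apply cd_minus; apply At0; rewrite ?Cmod_0; lra.
    - intros w Hw. rewrite Cplus_0_l, (Cplus_comm h). apply E2; lra. }
  intros h Hh.
  pose proof (mean_value_inequality (fun z => f z - f' (RtoC 0) * z)%C (fun z => f' z - f' (RtoC 0) * RtoC 1)%C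
    (RtoC 0) h (4 * B * Cmod h)) as MV. cbv beta in MV.
  replace (f (0 + h) - f' (RtoC 0) * (0 + h) - (f (RtoC 0) - f' (RtoC 0) * RtoC 0))%C
    with (f h - f (RtoC 0) - f' (RtoC 0) * h)%C in MV by (rewrite Cplus_0_l; ring).
  replace (4 * B * Cmod h ^ 2) with (4 * B * Cmod h * Cmod h) by ring. apply MV.
  intros t Ht. rewrite Cplus_0_l.
  assert (B0 : 0 <= B) by (eapply Rle_trans; [apply Cmod_ge_0|apply (HB (RtoC 0)); rewrite Cmod_0; lra]).
  assert (Ct : Cmod (RtoC t * h)%C <= Cmod h).
  { rewrite Cmod_mult, Cmod_RtoC_pos by lra. pose proof (Cmod_ge_0 h). nra. }
  split.
  - apply cd_minus; [apply H; lra|]. apply (cd_scal _ (fun z => z)), cd_id.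
  - rewrite Cmult_1_r. eapply Rle_trans; [apply E3; lra|]. apply Rmult_le_compat_l; lra.
Qed.

(** * Two complex variables *)

Definition vadd (p q : C2) : C2 := ((fst p + fst q)%C, (snd p + snd q)%C).
Definition vscal (c : C) (p : C2) : C2 := ((c * fst p)%C, (c * snd p)%C).
Definition vsub (p q : C2) : C2 := ((fst p - fst q)%C, (snd p - snd q)%C).
(** The sum of the moduli, not the Euclidean norm: error estimates in C^2 then reduce to the two
    components.  Spheres are described by the Euclidean [sqn] below. *)
Definition nrm (p : C2) : R := Cmod (fst p) + Cmod (snd p).

Lemma C2_eq : forall p q : C2, fst p = fst q -> snd p = snd q -> p = q.
Proof. intros [a b] [c d]; simpl; intros; subst; reflexivity. Qed.

Ltac c2ring := apply C2_eq; unfold vadd, vscal, vsub, origin; simpl; ring.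

Lemma nrm_ge_0 : forall p, 0 <= nrm p.
Proof. intros p. unfold nrm. pose proof (Cmod_ge_0 (fst p)). pose proof (Cmod_ge_0 (snd p)). lra. Qed.

Lemma nrm_add : forall p q, nrm (vadd p q) <= nrm p + nrm q.
Proof.
  intros p q. unfold nrm, vadd. simpl.
  pose proof (Cmod_triangle (fst p) (fst q)). pose proof (Cmod_triangle (snd p) (snd q)). lra.
Qed.

Lemma nrm_scal : forall c p, nrm (vscal c p) = Cmod c * nrm p.
Proof. intros c p. unfold nrm, vscal. simpl. rewrite !Cmod_mult. ring. Qed.

Lemma nrm_sub_sym : forall p q, nrm (vsub p q) = nrm (vsub q p).
Proof. intros p q. unfold nrm, vsub. simpl. now rewrite (Cmod_sub_sym (fst p)), (Cmod_sub_sym (snd p)). Qed.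

Lemma nrm_chain : forall p q r, nrm (vsub p r) <= nrm (vsub p q) + nrm (vsub q r).
Proof.
  intros p q r. unfold nrm, vsub. simpl.
  pose proof (Cmod_chain (fst p) (fst q) (fst r)). pose proof (Cmod_chain (snd p) (snd q) (snd r)). lra.
Qed.

Lemma nrm_origin : nrm origin = 0.
Proof. unfold nrm, origin. simpl. rewrite Cmod_0. ring. Qed.

Lemma nrm_eq_0 : forall p, nrm p = 0 -> p = origin.
Proof.
  intros p H. unfold nrm in H. pose proof (Cmod_ge_0 (fst p)). pose proof (Cmod_ge_0 (snd p)).
  apply C2_eq; simpl; apply Cmod_eq_0; lra.
Qed.

Lemma Cmod_fst_nrm : forall p, Cmod (fst p) <= nrm p.
Proof. intros p. unfold nrm. pose proof (Cmod_ge_0 (snd p)). lra. Qed.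

Lemma Cmod_snd_nrm : forall p, Cmod (snd p) <= nrm p.
Proof. intros p. unfold nrm. pose proof (Cmod_ge_0 (fst p)). lra. Qed.

(** * Compactness in C^2 *)

Definition tends (u : nat -> C2) (l : C2) : Prop :=
  forall eps, 0 < eps -> exists N, forall n, (N <= n)%nat -> nrm (vsub (u n) l) < eps.

(** Subsequences are described by indices with [n <= phi n]; such indices tend to infinity, which is
    what limits require, and they are easy to choose one by one. *)
Definition extraction (phi : nat -> nat) : Prop := forall n, (n <= phi n)%nat.

Lemma extraction_comp : forall phi psi, extraction phi -> extraction psi -> extraction (fun n => phi (psi n)).
Proof. intros phi psi H K n. specialize (H (psi n)). specialize (K n). lia. Qed.

Lemma tends_extraction : forall u l phi, tends u l -> extraction phi -> tends (fun n => u (phi n)) l.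
Proof.
  intros u l phi H K eps He. destruct (H eps He) as [N HN]. exists N. intros n Hn. apply HN.
  specialize (K n). lia.
Qed.

Lemma inv_succ_lt : forall eps, 0 < eps -> exists N, forall n, (N <= n)%nat -> / (INR n + 1) < eps.
Proof.
  intros eps He. destruct (INR_unbounded (/ eps)) as [N HN]. exists N. intros n Hn.
  apply le_INR in Hn. pose proof (Rinv_0_lt_compat _ He). pose proof (pos_INR n).
  rewrite <- (Rinv_inv eps). apply Rinv_lt_contravar; [nra|lra].
Qed.

Lemma bolzano_real : forall (u : nat -> R) B, (forall n, Rabs (u n) <= B) ->
  exists phi l, extraction phi /\ forall eps, 0 < eps -> exists N, forall n, (N <= n)%nat -> Rabs (u (phi n) - l) < eps.
Proof.
  intros u B H.
  destruct (Bolzano_Weierstrass u (fun x => - B <= x <= B)) as [l Hl].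
  - apply compact_P3.
  - intros n. specialize (H n). apply Rabs_le_between in H. exact H.
  - assert (S : forall n : nat, exists p, (n <= p)%nat /\ Rabs (u p - l) < / (INR n + 1)).
    { intros n. assert (P : 0 < / (INR n + 1)) by (apply Rinv_0_lt_compat; pose proof (pos_INR n); lra).
      destruct (Hl (disc l (mkposreal _ P)) n) as [p [Hp1 Hp2]].
      - exists (mkposreal _ P). intros x Hx. exact Hx.
      - exists p. split; auto. }
    destruct (choice_function _ _ _ S) as [phi K]. exists phi, l. split; [intros n; apply K|].
    intros eps He. destruct (inv_succ_lt eps He) as [N HN]. exists N. intros n Hn.
    destruct (K n) as [_ h]. specialize (HN n Hn). lra.
Qed.

Lemma bolzano_complex : forall (u : nat -> C) B, (forall n, Cmod (u n) <= B) ->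
  exists phi l, extraction phi /\ forall eps, 0 < eps -> exists N, forall n, (N <= n)%nat -> Cmod (u (phi n) - l)%C < eps.
Proof.
  intros u B H.
  destruct (bolzano_real (fun n => fst (u n)) B) as [p1 [x [E1 L1]]].
  { intros n. eapply Rle_trans; [apply Rabs_Re_le|apply H]. }
  destruct (bolzano_real (fun n => snd (u (p1 n))) B) as [p2 [y [E2 L2]]].
  { intros n. eapply Rle_trans; [apply Rabs_Im_le|apply H]. }
  exists (fun n => p1 (p2 n)), (x, y). split; [now apply extraction_comp|].
  intros eps He. destruct (L1 (eps / 2)) as [N1 K1]; [lra|]. destruct (L2 (eps / 2)) as [N2 K2]; [lra|].
  exists (Nat.max N1 N2). intros n Hn.
  eapply Rle_lt_trans; [apply Cmod_le_ReIm|]. simpl.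
  specialize (E2 n). specialize (K1 (p2 n) ltac:(lia)). specialize (K2 n ltac:(lia)).
  unfold Rminus in *. lra.
Qed.

Lemma bolzano : forall (u : nat -> C2) B, (forall n, nrm (u n) <= B) ->
  exists phi l, extraction phi /\ tends (fun n => u (phi n)) l.
Proof.
  intros u B H.
  destruct (bolzano_complex (fun n => fst (u n)) B) as [p1 [x [E1 L1]]].
  { intros n. eapply Rle_trans; [apply Cmod_fst_nrm|apply H]. }
  destruct (bolzano_complex (fun n => snd (u (p1 n))) B) as [p2 [y [E2 L2]]].
  { intros n. eapply Rle_trans; [apply Cmod_snd_nrm|apply H]. }
  exists (fun n => p1 (p2 n)), (x, y). split; [now apply extraction_comp|].
  intros eps He. destruct (L1 (eps / 2)) as [N1 K1]; [lra|]. destruct (L2 (eps / 2)) as [N2 K2]; [lra|].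
  exists (Nat.max N1 N2). intros n Hn. unfold nrm, vsub. simpl.
  specialize (E2 n). specialize (K1 (p2 n) ltac:(lia)). specialize (K2 n ltac:(lia)). lra.
Qed.

(** * Complex differentiability in two variables *)

Definition lin (a b : C) (h : C2) : C := (a * fst h + b * snd h)%C.

Lemma Cmod_lin : forall a b h, Cmod (lin a b h) <= (Cmod a + Cmod b) * nrm h.
Proof.
  intros a b h. unfold lin. eapply Rle_trans; [apply Cmod_triangle|]. rewrite !Cmod_mult. unfold nrm.
  pose proof (Cmod_ge_0 a). pose proof (Cmod_ge_0 b).
  pose proof (Cmod_ge_0 (fst h)). pose proof (Cmod_ge_0 (snd h)). nra.
Qed.

(** Complex differentiability with [a] and [b] as the two partial derivatives. *)
Definition hd (F : C2 -> C) (p : C2) (a b : C) : Prop :=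
  forall eps, 0 < eps -> exists d, 0 < d /\
    forall h, nrm h < d -> Cmod (F (vadd p h) - F p - lin a b h)%C <= eps * nrm h.

Lemma hd_eq : forall F p a b a' b', a = a' -> b = b' -> hd F p a b -> hd F p a' b'.
Proof. intros; subst; auto. Qed.

Lemma vadd_0 : forall p, vadd p origin = p.
Proof. intros p. c2ring. Qed.

Lemma vadd_sub : forall p q, vadd p (vsub q p) = q.
Proof. intros p q. c2ring. Qed.

Lemma vsub_add : forall p h, vsub (vadd p h) p = h.
Proof. intros p q. c2ring. Qed.

Lemma vsub_diag : forall p, vsub p p = origin.
Proof. intros p. c2ring. Qed.

Lemma hd_ext_loc : forall F G p a b, (exists d, 0 < d /\ forall q, nrm (vsub q p) < d -> F q = G q) ->
  hd F p a b -> hd G p a b.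
Proof.
  intros F G p a b [d [Hd E]] H eps He. destruct (H eps He) as [d' [Hd' K]].
  exists (Rmin d d'). split; [now apply Rmin_glb_lt|]. intros h Hh.
  rewrite <- !E.
  - apply K. eapply Rlt_le_trans; [exact Hh|apply Rmin_r].
  - now rewrite vsub_diag, nrm_origin.
  - rewrite vsub_add. eapply Rlt_le_trans; [exact Hh|apply Rmin_l].
Qed.

Lemma hd_ext : forall F G p a b, (forall q, F q = G q) -> hd F p a b -> hd G p a b.
Proof. intros F G p a b E. apply hd_ext_loc. exists 1. split; [lra|auto]. Qed.

Lemma hd_lipschitz : forall F p a b, hd F p a b -> exists d, 0 < d /\
  forall h, nrm h < d -> Cmod (F (vadd p h) - F p)%C <= (Cmod a + Cmod b + 1) * nrm h.
Proof.
  intros F p a b H. destruct (H 1 Rlt_0_1) as [d [Hd K]]. exists d. split; auto.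
  intros h Hh. specialize (K h Hh). pose proof (Cmod_lin a b h).
  replace (F (vadd p h) - F p)%C with ((F (vadd p h) - F p - lin a b h) + lin a b h)%C by ring.
  eapply Rle_trans; [apply Cmod_triangle|]. lra.
Qed.

Definition cont2 (F : C2 -> C) (p : C2) : Prop := forall eps, 0 < eps -> exists d, 0 < d /\
  forall q, nrm (vsub q p) < d -> Cmod (F q - F p)%C < eps.

Lemma hd_cont : forall F p a b, hd F p a b -> cont2 F p.
Proof.
  intros F p a b H eps He. destruct (hd_lipschitz _ _ _ _ H) as [d [Hd K]].
  pose proof (Cmod_ge_0 a). pose proof (Cmod_ge_0 b).
  set (L := Cmod a + Cmod b + 1) in *. assert (PL : 0 < L) by (unfold L; lra).
  assert (0 < eps / L) by (apply Rdiv_lt_0_compat; lra).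
  exists (Rmin d (eps / L)). split; [now apply Rmin_glb_lt|].
  intros q Hq. apply lt_Rmin in Hq. destruct Hq as [h1 h2]. specialize (K _ h1). rewrite vadd_sub in K.
  eapply Rle_lt_trans; [exact K|]. now apply lt_div in h2.
Qed.

Lemma hd_const : forall c p, hd (fun _ => c) p (RtoC 0) (RtoC 0).
Proof.
  intros c p eps He. exists 1. split; [lra|]. intros h _. unfold lin.
  replace (c - c - (RtoC 0 * fst h + RtoC 0 * snd h))%C with (RtoC 0) by ring.
  rewrite Cmod_0. pose proof (nrm_ge_0 h). nra.
Qed.

Lemma hd_lin : forall a b p, hd (fun q => lin a b q) p a b.
Proof.
  intros a b p eps He. exists 1. split; [lra|]. intros h _. unfold lin, vadd. simpl.
  match goal with |- Cmod ?X <= _ => replace X with (RtoC 0) by ring end.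
  rewrite Cmod_0. pose proof (nrm_ge_0 h). nra.
Qed.

Lemma hd_fst : forall p, hd (fun q => fst q) p (RtoC 1) (RtoC 0).
Proof. intros p. apply (hd_ext (lin (RtoC 1) (RtoC 0))); [intros q; unfold lin; ring|apply hd_lin]. Qed.

Lemma hd_snd : forall p, hd (fun q => snd q) p (RtoC 0) (RtoC 1).
Proof. intros p. apply (hd_ext (lin (RtoC 0) (RtoC 1))); [intros q; unfold lin; ring|apply hd_lin]. Qed.

Lemma hd_product_map : forall p : C2, hd (fun q => fst q * snd q)%C p (snd p) (fst p).
Proof.
  intros p eps He. exists eps. split; [lra|]. intros h Hh. unfold lin, vadd. simpl.
  match goal with |- Cmod ?X <= _ => replace X with (fst h * snd h)%C by ring end.
  rewrite Cmod_mult. pose proof (Cmod_fst_nrm h). pose proof (Cmod_snd_nrm h).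
  pose proof (Cmod_ge_0 (fst h)). pose proof (Cmod_ge_0 (snd h)). nra.
Qed.

(** Sums and products are composites with a linear and with a quadratic map, so their rules are
    special cases of this chain rule. *)
Lemma hd_comp : forall F G1 G2 p a b a1 b1 a2 b2, hd G1 p a1 b1 -> hd G2 p a2 b2 ->
  hd F (G1 p, G2 p) a b ->
  hd (fun q => F (G1 q, G2 q)) p (a * a1 + b * a2)%C (a * b1 + b * b2)%C.
Proof.
  intros F G1 G2 p a b a1 b1 a2 b2 H1 H2 HF eps He.
  destruct (hd_lipschitz _ _ _ _ H1) as [d1 [P1 K1]]. destruct (hd_lipschitz _ _ _ _ H2) as [d2 [P2 K2]].
  set (L := (Cmod a1 + Cmod b1 + 1) + (Cmod a2 + Cmod b2 + 1)).
  set (m := Cmod a + Cmod b + 1).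
  assert (PL : 0 < L).
  { unfold L. pose proof (Cmod_ge_0 a1). pose proof (Cmod_ge_0 b1). pose proof (Cmod_ge_0 a2). pose proof (Cmod_ge_0 b2). lra. }
  assert (Pm : 0 < m) by (unfold m; pose proof (Cmod_ge_0 a); pose proof (Cmod_ge_0 b); lra).
  destruct (HF (eps / 2 / L)) as [d3 [P3 K3]]; [repeat apply Rdiv_lt_0_compat; lra|].
  destruct (H1 (eps / 4 / m)) as [d4 [P4 K4]]; [repeat apply Rdiv_lt_0_compat; lra|].
  destruct (H2 (eps / 4 / m)) as [d5 [P5 K5]]; [repeat apply Rdiv_lt_0_compat; lra|].
  assert (P6 : 0 < d3 / L) by (apply Rdiv_lt_0_compat; lra).
  exists (Rmin (Rmin (Rmin d1 d2) (Rmin d4 d5)) (d3 / L)). split; [repeat apply Rmin_glb_lt; auto|].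
  intros h Hh. apply lt_Rmin in Hh. destruct Hh as [Hh A6]. apply lt_Rmin in Hh. destruct Hh as [A12 A45].
  apply lt_Rmin in A12, A45. destruct A12 as [A1 A2]. destruct A45 as [A4 A5]. apply lt_div in A6; auto.
  specialize (K1 h A1). specialize (K2 h A2). specialize (K4 h A4). specialize (K5 h A5).
  set (k := ((G1 (vadd p h) - G1 p)%C, (G2 (vadd p h) - G2 p)%C) : C2).
  assert (Nk : nrm k <= L * nrm h) by (unfold nrm at 1, k, L; simpl; lra).
  assert (Nk3 : nrm k < d3).
  { eapply Rle_lt_trans; [exact Nk|exact A6]. }
  specialize (K3 k Nk3).
  replace (vadd (G1 p, G2 p) k) with ((G1 (vadd p h), G2 (vadd p h)) : C2) in K3
    by (unfold k; c2ring).
  set (u := (G1 (vadd p h) - G1 p - lin a1 b1 h)%C) in *.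
  set (v := (G2 (vadd p h) - G2 p - lin a2 b2 h)%C) in *.
  replace (F (G1 (vadd p h), G2 (vadd p h)) - F (G1 p, G2 p) - lin (a * a1 + b * a2) (a * b1 + b * b2) h)%C
    with ((F (G1 (vadd p h), G2 (vadd p h)) - F (G1 p, G2 p) - lin a b k) + (a * u + b * v))%C
    by (unfold u, v, k, lin; simpl; ring).
  eapply Rle_trans; [apply Cmod_triangle|].
  assert (X1 : eps / 2 / L * nrm k <= eps / 2 * nrm h).
  { eapply Rle_trans; [apply Rmult_le_compat_l; [left; repeat apply Rdiv_lt_0_compat; lra|exact Nk]|].
    right. field. lra. }
  assert (X2 : Cmod (a * u + b * v)%C <= eps / 2 * nrm h).
  { eapply Rle_trans; [apply Cmod_triangle|]. rewrite !Cmod_mult.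
    pose proof (Cmod_ge_0 a). pose proof (Cmod_ge_0 b). pose proof (nrm_ge_0 h).
    assert (Y : 0 <= eps / 4 / m * nrm h) by (apply Rmult_le_pos; [left; repeat apply Rdiv_lt_0_compat; lra|lra]).
    apply Rle_trans with (m * (eps / 4 / m * nrm h) + m * (eps / 4 / m * nrm h)).
    - assert (Cmod a <= m /\ Cmod b <= m) as [M1 M2] by (unfold m; lra).
      apply Rplus_le_compat; apply Rmult_le_compat; auto using Cmod_ge_0.
    - right. field. lra. }
  lra.
Qed.

Lemma hd_plus : forall F G p a b a' b', hd F p a b -> hd G p a' b' ->
  hd (fun q => F q + G q)%C p (a + a')%C (b + b')%C.
Proof.
  intros F G p a b a' b' HF HG.
  eapply hd_ext; [|eapply hd_eq; [| |apply (hd_comp (lin (RtoC 1) (RtoC 1)) F G _ _ _ _ _ _ _ HF HG (hd_lin _ _ _))]].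
  - intros q. unfold lin. simpl. ring.
  - ring.
  - ring.
Qed.

Lemma hd_mult : forall F G p a b a' b', hd F p a b -> hd G p a' b' ->
  hd (fun q => F q * G q)%C p (a * G p + F p * a')%C (b * G p + F p * b')%C.
Proof.
  intros F G p a b a' b' HF HG.
  eapply hd_eq; [| |apply (hd_comp (fun q => fst q * snd q)%C F G _ _ _ _ _ _ _ HF HG (hd_product_map _))];
  simpl; ring.
Qed.

Lemma hd_scal : forall c F p a b, hd F p a b -> hd (fun q => c * F q)%C p (c * a)%C (c * b)%C.
Proof.
  intros c F p a b H. eapply hd_eq; [| |apply (hd_mult (fun _ => c) F _ _ _ _ _ (hd_const c p) H)]; ring.
Qed.

Lemma hd_translate : forall F v p a b, hd F (vadd p v) a b -> hd (fun q => F (vadd q v)) p a b.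
Proof.
  intros F v p a b H eps He. destruct (H eps He) as [d [Hd K]]. exists d. split; auto. intros h Hh.
  replace (vadd (vadd p h) v) with (vadd (vadd p v) h) by c2ring. auto.
Qed.

(** Along complex lines the theory of one variable applies. *)
Lemma hd_slice : forall F p v z a b, hd F (vadd p (vscal z v)) a b ->
  cd (fun w => F (vadd p (vscal w v))) z (lin a b v).
Proof.
  intros F p v z a b H eps He.
  pose proof (nrm_ge_0 v) as Pv.
  destruct (H (eps / (nrm v + 1))) as [d [Hd K]]; [apply Rdiv_lt_0_compat; lra|].
  exists (d / (nrm v + 1)). split; [apply Rdiv_lt_0_compat; lra|]. intros h Hh.
  apply lt_div in Hh; [|lra].
  pose proof (Cmod_ge_0 h) as Ph.
  specialize (K (vscal h v)). rewrite nrm_scal in K. specialize (K ltac:(nra)).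
  replace (vadd (vadd p (vscal z v)) (vscal h v)) with (vadd p (vscal (z + h) v)) in K by c2ring.
  replace (lin a b (vscal h v)) with (lin a b v * h)%C in K by (unfold lin, vscal; simpl; ring).
  eapply Rle_trans; [exact K|].
  replace (eps / (nrm v + 1) * (Cmod h * nrm v)) with (eps * Cmod h * (nrm v / (nrm v + 1))) by (field; lra).
  assert (nrm v / (nrm v + 1) <= 1) by (apply div_le; lra).
  assert (0 <= eps * Cmod h) by nra. nra.
Qed.

(** [taylor2_bound] on the complex lines through [q].  The constants depend on [F] only through its
    bound, which makes the estimate uniform over families of functions. *)
Lemma taylor2 : forall F (a b : C2 -> C) q rho B, 0 < rho ->
  (forall x, nrm (vsub x q) <= 4 * rho -> hd F x (a x) (b x) /\ Cmod (F x) <= B) ->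
  (forall v, nrm v <= rho -> Cmod (lin (a q) (b q) v) <= 2 * B) /\
  forall h, nrm h <= rho -> Cmod (F (vadd q h) - F q - lin (a q) (b q) h)%C <= 4 * B * (nrm h / rho) ^ 2.
Proof.
  intros F a b q rho B Hr H.
  assert (T : forall v, nrm v <= rho ->
     let f := fun w => F (vadd q (vscal w v)) in
     let f' := fun w => lin (a (vadd q (vscal w v))) (b (vadd q (vscal w v))) v in
     (forall z, Cmod z <= 3 -> Cmod (f' z) <= 2 * B) /\
     (forall h, Cmod h <= 1 -> Cmod (f h - f (RtoC 0) - f' (RtoC 0) * h)%C <= 4 * B * Cmod h ^ 2)).
  { intros v Hv f f'.
    assert (In : forall z, Cmod z <= 4 -> nrm (vsub (vadd q (vscal z v)) q) <= 4 * rho).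
    { intros z Hz. rewrite vsub_add, nrm_scal. pose proof (Cmod_ge_0 z). pose proof (nrm_ge_0 v). nra. }
    apply taylor2_bound.
    - intros z Hz. apply hd_slice, H, In, Hz.
    - intros z Hz. apply H, In, Hz. }
  assert (Z : forall v, vadd q (vscal (RtoC 0) v) = q) by (intros v; c2ring).
  split.
  - intros v Hv. destruct (T v Hv) as [T1 _]. specialize (T1 (RtoC 0)). cbv zeta in T1. rewrite Z in T1.
    apply T1. rewrite Cmod_0. lra.
  - intros h Hh. destruct (Req_dec (nrm h) 0) as [E|E].
    { apply nrm_eq_0 in E. subst h. rewrite vadd_0. unfold lin, origin. simpl.
      match goal with |- Cmod ?X <= _ => replace X with (RtoC 0) by ring end.
      rewrite Cmod_0. destruct (H q) as [_ B0].
      { rewrite vsub_diag, nrm_origin. lra. }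
      pose proof (Cmod_ge_0 (F q)). apply Rmult_le_pos; [lra|]. apply pow2_ge_0. }
    assert (P : 0 < nrm h) by (pose proof (nrm_ge_0 h); lra).
    set (s := nrm h / rho). assert (Ps : 0 < s) by (apply Rdiv_lt_0_compat; lra).
    assert (S1 : s <= 1) by (apply div_le; lra).
    assert (Ns : RtoC s <> RtoC 0) by (intros Q; apply RtoC_inj in Q; lra).
    set (v := vscal (/ RtoC s) h).
    assert (Nv : nrm v = rho).
    { unfold v. rewrite nrm_scal, Cmod_inv, Cmod_RtoC_pos by (auto; lra). unfold s. field. lra. }
    destruct (T v (Req_le _ _ Nv)) as [_ T2]. specialize (T2 (RtoC s)). cbv zeta in T2.
    rewrite Z in T2. rewrite (Cmod_RtoC_pos s) in T2 by lra. specialize (T2 S1).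
    replace (vscal (RtoC s) v) with h in T2.
    2:{ unfold v. apply C2_eq; unfold vscal; simpl; field; auto. }
    replace (lin (a q) (b q) v * RtoC s)%C with (lin (a q) (b q) h) in T2.
    2:{ unfold v, lin, vscal. simpl. field. auto. }
    exact T2.
Qed.

Definition hd_near (F : C2 -> C) (a b : C2 -> C) (p : C2) : Prop :=
  exists r, 0 < r /\ forall x, nrm (vsub x p) < r -> hd F x (a x) (b x).

Lemma hd_near_bounded : forall F a b p, hd_near F a b p -> exists rho B, 0 < rho /\ 0 < B /\
  forall x, nrm (vsub x p) <= 8 * rho -> hd F x (a x) (b x) /\ Cmod (F x) <= B.
Proof.
  intros F a b p [r [Hr H]].
  assert (Hp : hd F p (a p) (b p)).
  { apply H. rewrite vsub_diag, nrm_origin. exact Hr. }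
  destruct (hd_cont _ _ _ _ Hp 1 Rlt_0_1) as [d [Hd K]].
  exists (Rmin r d / 16), (Cmod (F p) + 1).
  assert (0 < Rmin r d) by now apply Rmin_glb_lt.
  pose proof (Rmin_l r d). pose proof (Rmin_r r d). pose proof (Cmod_ge_0 (F p)).
  repeat split; try lra.
  - apply H. lra.
  - replace (F x) with ((F x - F p) + F p)%C by ring. eapply Rle_trans; [apply Cmod_triangle|].
    specialize (K x ltac:(lra)). lra.
Qed.

(** Directional derivatives of a holomorphic function are holomorphic: the difference quotients
    along [v] are holomorphic and uniformly bounded, so they satisfy one and the same second-order
    Taylor bound at [p], with bounded differentials; by compactness the bound survives in the limit. *)
Lemma hd_directional : forall F a b p v rho B, 0 < rho -> nrm v = rho ->
  (forall x, nrm (vsub x p) <= 8 * rho -> hd F x (a x) (b x) /\ Cmod (F x) <= B) ->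
  exists al be, hd (fun q => lin (a q) (b q) v) p al be.
Proof.
  intros F a b p v rho B Pr Nv H.
  assert (PB : 0 <= B).
  { destruct (H p) as [_ K]; [rewrite vsub_diag, nrm_origin; lra|]. pose proof (Cmod_ge_0 (F p)). lra. }
  set (s := fun n => RtoC (/ (INR n + 1))).
  assert (Ps : forall n, 0 < / (INR n + 1) <= 1).
  { intros n. pose proof (pos_INR n). split; [apply Rinv_0_lt_compat; lra|].
    rewrite <- Rinv_1. apply Rinv_le_contravar; lra. }
  assert (Ms : forall n, Cmod (s n) = / (INR n + 1)) by (intros n; apply Cmod_RtoC_pos; specialize (Ps n); lra).
  assert (Ns : forall n, s n <> RtoC 0) by (intros n; apply Cmod_gt_0; rewrite Ms; apply Ps).
  set (Q := fun n x => ((F (vadd x (vscal (s n) v)) - F x) / s n)%C).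
  set (D := fun x => lin (a x) (b x) v).
  assert (Hv : forall n, nrm (vscal (s n) v) <= rho).
  { intros n. rewrite nrm_scal, Ms, Nv. specialize (Ps n). nra. }
  assert (Conv : forall n x, nrm (vsub x p) <= 4 * rho -> Cmod (D x) <= 2 * B /\ Cmod (Q n x - D x)%C <= 4 * B * / (INR n + 1)).
  { intros n x Hx. destruct (taylor2 F a b x rho B Pr) as [T1 T2].
    { intros y Hy. apply H. pose proof (nrm_chain y x p). lra. }
    split; [apply T1; lra|]. specialize (T2 _ (Hv n)). rewrite nrm_scal, Nv, Ms in T2.
    replace (Q n x - D x)%C with ((F (vadd x (vscal (s n) v)) - F x - lin (a x) (b x) (vscal (s n) v)) / s n)%C
      by (unfold Q, D, lin, vscal; simpl; field; apply Ns).
    rewrite Cmod_div, Ms by apply Ns. apply div_le; [apply Ps|]. eapply Rle_trans; [exact T2|].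
    specialize (Ps n). right. field. pose proof (pos_INR n). lra. }
  assert (Quot : forall n x, nrm (vsub x p) <= 4 * rho ->
    hd (Q n) x ((a (vadd x (vscal (s n) v)) - a x) / s n)%C ((b (vadd x (vscal (s n) v)) - b x) / s n)%C /\
    Cmod (Q n x) <= 6 * B).
  { intros n x Hx. split.
    - apply (hd_ext (fun y => / s n * (F (vadd y (vscal (s n) v)) + - RtoC 1 * F y))%C).
      { intros y. unfold Q. field. apply Ns. }
      eapply hd_eq; [| |apply hd_scal, hd_plus; [apply hd_translate|apply hd_scal]; apply H].
      + field. apply Ns.
      + field. apply Ns.
      + pose proof (nrm_chain (vadd x (vscal (s n) v)) x p) as K. rewrite vsub_add in K. specialize (Hv n). lra.
      + lra.
    - destruct (Conv n x Hx) as [C1 C2']. replace (Q n x) with ((Q n x - D x) + D x)%C by ring.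
      eapply Rle_trans; [apply Cmod_triangle|]. specialize (Ps n). nra. }
  pose proof (fun n => taylor2 (Q n) _ _ p rho (6 * B) Pr (Quot n)) as T. cbv beta in T.
  (* the partial derivatives of the difference quotients at [p] *)
  set (A := fun n => (((a (vadd p (vscal (s n) v)) - a p) / s n)%C, ((b (vadd p (vscal (s n) v)) - b p) / s n)%C) : C2).
  destruct (bolzano A (24 * B / rho)) as [phi [[al be] [E L]]].
  { intros n. destruct (T n) as [T1 _]. unfold nrm, A. cbn [fst snd].
    pose proof (T1 (RtoC rho, RtoC 0)) as X. pose proof (T1 (RtoC 0, RtoC rho)) as Y. unfold lin, nrm in X, Y. cbn [fst snd] in X, Y.
    rewrite Cmult_0_r, Cplus_0_r, Cmod_mult, Cmod_0, (Cmod_RtoC_pos rho) in X by lra.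
    rewrite Cmult_0_r, Cplus_0_l, Cmod_mult, Cmod_0, (Cmod_RtoC_pos rho) in Y by lra.
    apply Rmult_le_reg_r with rho; auto. replace (24 * B / rho * rho) with (24 * B) by (field; lra).
    specialize (X ltac:(lra)). specialize (Y ltac:(lra)). lra. }
  exists al, be.
  assert (Main : forall h, nrm h <= rho -> Cmod (D (vadd p h) - D p - lin al be h)%C <= 24 * B * (nrm h / rho) ^ 2).
  { intros h Hh. apply Rle_plus_epsilon. intros eps He. pose proof (nrm_ge_0 h) as Ph.
    destruct (L (eps / 2 / (rho + 1))) as [N1 K1]; [repeat apply Rdiv_lt_0_compat; lra|].
    destruct (inv_succ_lt (eps / 2 / (8 * B + 1))) as [N2 K2]; [repeat apply Rdiv_lt_0_compat; lra|].
    set (n := Nat.max N1 N2). specialize (K1 n ltac:(lia)). specialize (K2 (phi n) ltac:(specialize (E n); lia)).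
    apply lt_div in K1, K2; [|lra..].
    destruct (Conv (phi n) (vadd p h)) as [_ X1]; [rewrite vsub_add; lra|].
    destruct (Conv (phi n) p) as [_ X2]; [rewrite vsub_diag, nrm_origin; lra|].
    destruct (T (phi n)) as [_ X3]. specialize (X3 h Hh).
    pose proof (Cmod_lin (fst (A (phi n)) - al)%C (snd (A (phi n)) - be)%C h) as X4.
    change (Cmod (fst (A (phi n)) - al)%C + Cmod (snd (A (phi n)) - be)%C) with (nrm (vsub (A (phi n)) (al, be))) in X4.
    change (lin _ _ h) with (lin (fst (A (phi n))) (snd (A (phi n))) h) in X3.
    replace (D (vadd p h) - D p - lin al be h)%C with ((Q (phi n) (vadd p h) - Q (phi n) p - lin (fst (A (phi n))) (snd (A (phi n))) h)
      + (lin (fst (A (phi n)) - al) (snd (A (phi n)) - be) h - ((Q (phi n) (vadd p h) - D (vadd p h)) - (Q (phi n) p - D p))))%C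
      by (unfold lin; ring).
    eapply Rle_trans; [apply Cmod_triangle|]. eapply Rle_trans; [apply Rplus_le_compat_l, Cmod_triangle_sub|].
    pose proof (Cmod_triangle_sub (Q (phi n) (vadd p h) - D (vadd p h)) (Q (phi n) p - D p)).
    pose proof (nrm_ge_0 (vsub (A (phi n)) (al, be))). specialize (Ps (phi n)). nra. }
  intros eps He. set (K := 24 * B / rho ^ 2 + 1).
  assert (Pq : 0 < rho ^ 2) by (apply pow_lt; lra).
  assert (PK : 0 < K) by (unfold K; assert (0 <= 24 * B / rho ^ 2) by (apply Rdiv_le_0_compat; lra); lra).
  exists (Rmin rho (eps / K)). split; [apply Rmin_glb_lt; auto; now apply Rdiv_lt_0_compat|].
  intros h Hh. apply lt_Rmin in Hh. destruct Hh as [h1 h2]. apply lt_div in h2; auto.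
  eapply Rle_trans; [apply Main; lra|].
  replace (24 * B * (nrm h / rho) ^ 2) with ((K - 1) * nrm h ^ 2) by (unfold K; field; lra).
  pose proof (nrm_ge_0 h). nra.
Qed.

Lemma hd_partials : forall F a b p, hd_near F a b p ->
  (exists al be, hd a p al be) /\ (exists al be, hd b p al be).
Proof.
  intros F a b p H. destruct (hd_near_bounded _ _ _ _ H) as [rho [B [Pr [_ K]]]].
  assert (Nr : RtoC rho <> RtoC 0) by (intros Z; apply RtoC_inj in Z; lra).
  split.
  - destruct (hd_directional F a b p (RtoC rho, RtoC 0) rho B Pr) as [al [be Q]]; auto.
    { unfold nrm. simpl. rewrite Cmod_0, Cmod_RtoC_pos by lra. ring. }
    exists (/ RtoC rho * al)%C, (/ RtoC rho * be)%C. eapply hd_ext; [|exact (hd_scal _ _ _ _ _ Q)].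
    intros q. unfold lin. simpl. field. exact Nr.
  - destruct (hd_directional F a b p (RtoC 0, RtoC rho) rho B Pr) as [al [be Q]]; auto.
    { unfold nrm. simpl. rewrite Cmod_0, Cmod_RtoC_pos by lra. ring. }
    exists (/ RtoC rho * al)%C, (/ RtoC rho * be)%C. eapply hd_ext; [|exact (hd_scal _ _ _ _ _ Q)].
    intros q. unfold lin. simpl. field. exact Nr.
Qed.

(** * Minima of continuous functions *)

Definition contR (F : C2 -> R) (p : C2) : Prop := forall eps, 0 < eps -> exists d, 0 < d /\
  forall q, nrm (vsub q p) < d -> Rabs (F q - F p) < eps.

Lemma contR_tends : forall F p u, contR F p -> tends u p -> forall eps, 0 < eps ->
  exists N, forall n, (N <= n)%nat -> Rabs (F (u n) - F p) < eps.
Proof.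
  intros F p u HF Hu eps He. destruct (HF eps He) as [d [Hd K]]. destruct (Hu d Hd) as [N HN].
  exists N. intros n Hn. apply K, HN, Hn.
Qed.

Definition seq_closed (K : C2 -> Prop) : Prop :=
  forall u l, (forall n, K (u n)) -> tends u l -> K l.

(** The same compactness argument serves twice: an unbounded sequence of values and a minimising
    sequence both have a limit point in [K]. *)
Lemma minimum_attained : forall (K : C2 -> Prop) F B, seq_closed K -> (forall p, K p -> nrm p <= B) ->
  (exists p, K p) -> (forall p, K p -> contR F p) ->
  exists p, K p /\ forall q, K q -> F p <= F q.
Proof.
  intros K F B Cl Bd [p0 Hp0] Ct.
  assert (Lower : exists m, forall q, K q -> m <= F q).
  { apply NNPP. intros N.
    assert (S : forall n : nat, exists q, K q /\ F q < - INR n).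
    { intros n. apply NNPP. intros N'. apply N. exists (- INR n). intros q Hq.
      apply Rnot_lt_le. intros h. apply N'. exists q. auto. }
    destruct (choice_function _ _ _ S) as [u Hu].
    destruct (bolzano u B) as [phi [l [E L]]]; [intros n; apply Bd, Hu|].
    assert (Kl : K l) by (apply (Cl _ l (fun n => proj1 (Hu (phi n)))); exact L).
    destruct (contR_tends F l _ (Ct l Kl) L 1 Rlt_0_1) as [N1 HN1].
    destruct (INR_unbounded (1 - F l)) as [N2 HN2].
    set (n := Nat.max N1 N2). specialize (HN1 n ltac:(lia)).
    destruct (Hu (phi n)) as [_ h]. specialize (E n).
    assert (INR N2 <= INR (phi n)) by (apply le_INR; lia).
    apply Rabs_lt_between in HN1. lra. }
  destruct Lower as [m0 Hm0].
  destruct (completeness (fun y => exists q, K q /\ y = - F q)) as [s [S1 S2]].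
  - exists (- m0). intros y [q [Hq ->]]. specialize (Hm0 q Hq). lra.
  - exists (- F p0), p0. auto.
  - assert (S : forall n : nat, exists q, K q /\ F q < - s + / (INR n + 1)).
    { intros n. apply NNPP. intros N.
      assert (P : 0 < / (INR n + 1)) by (apply Rinv_0_lt_compat; pose proof (pos_INR n); lra).
      assert (s <= s - / (INR n + 1)); [|lra].
      apply S2. intros y [q [Hq ->]]. apply Rnot_lt_le. intros h. apply N. exists q. split; auto. lra. }
    destruct (choice_function _ _ _ S) as [u Hu].
    destruct (bolzano u B) as [phi [l [E L]]]; [intros n; apply Bd, Hu|].
    assert (Kl : K l) by (apply (Cl _ l (fun n => proj1 (Hu (phi n)))); exact L).
    exists l. split; auto. intros q Hq.
    assert (A : - F q <= s) by (apply S1; exists q; auto).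
    apply Rnot_lt_le. intros h.
    set (e := (F l - F q) / 2). assert (Pe : 0 < e) by (unfold e; lra).
    destruct (contR_tends F l _ (Ct l Kl) L e Pe) as [N1 HN1].
    destruct (inv_succ_lt e Pe) as [N2 HN2].
    set (n := Nat.max N1 N2). specialize (HN1 n ltac:(lia)).
    destruct (Hu (phi n)) as [_ h1]. specialize (E n). specialize (HN2 (phi n) ltac:(lia)).
    apply Rabs_lt_between in HN1. unfold e in *. lra.
Qed.

(** * Lagrange multipliers *)

(** The Euclidean scalar product of R^4. *)
Definition ip (u v : C2) : R :=
  fst (fst u) * fst (fst v) + snd (fst u) * snd (fst v) +
  (fst (snd u) * fst (snd v) + snd (snd u) * snd (snd v)).

Lemma ip_bound : forall u v, Rabs (ip u v) <= nrm u * nrm v.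
Proof.
  intros [a b] [c d].
  assert (E : ip (a, b) (c, d) = fst (Cconj a * c)%C + fst (Cconj b * d)%C) by (unfold ip; simpl; ring).
  rewrite E. unfold nrm.
  eapply Rle_trans; [apply Rabs_triang|].
  pose proof (Rabs_Re_le (Cconj a * c)%C) as H1. pose proof (Rabs_Re_le (Cconj b * d)%C) as H2.
  rewrite Cmod_mult, Cmod_conj in H1, H2. simpl.
  pose proof (Cmod_ge_0 a). pose proof (Cmod_ge_0 b). pose proof (Cmod_ge_0 c). pose proof (Cmod_ge_0 d).
  simpl in *. nra.
Qed.

Lemma nrm_sqr_ip : forall v, nrm v ^ 2 <= 2 * ip v v.
Proof.
  intros [a b]. unfold nrm. simpl fst. simpl snd.
  assert (E : ip (a, b) (a, b) = Cmod a ^ 2 + Cmod b ^ 2) by (rewrite !Cmod_sqr; unfold ip; simpl; ring).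
  rewrite E. pose proof (pow2_ge_0 (Cmod a - Cmod b)). nra.
Qed.

(** Real differentiability, [G] being the gradient with respect to [ip]. *)
Definition rd (F : C2 -> R) (p G : C2) : Prop :=
  forall eps, 0 < eps -> exists d, 0 < d /\
    forall h, nrm h < d -> Rabs (F (vadd p h) - F p - ip G h) <= eps * nrm h.

Lemma rd_lipschitz : forall F p G, rd F p G -> exists d, 0 < d /\
  forall h, nrm h < d -> Rabs (F (vadd p h) - F p) <= (nrm G + 1) * nrm h.
Proof.
  intros F p G H. destruct (H 1 Rlt_0_1) as [d [Hd K]]. exists d. split; auto.
  intros h Hh. specialize (K h Hh). pose proof (ip_bound G h).
  replace (F (vadd p h) - F p) with ((F (vadd p h) - F p - ip G h) + ip G h) by ring.
  eapply Rle_trans; [apply Rabs_triang|]. lra.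
Qed.

Lemma rd_cont : forall F p G, rd F p G -> contR F p.
Proof.
  intros F p G H eps He. destruct (rd_lipschitz _ _ _ H) as [d [Hd K]].
  set (L := nrm G + 1) in *. assert (PL : 0 < L) by (unfold L; pose proof (nrm_ge_0 G); lra).
  assert (0 < eps / L) by (apply Rdiv_lt_0_compat; lra).
  exists (Rmin d (eps / L)). split; [now apply Rmin_glb_lt|].
  intros q Hq. apply lt_Rmin in Hq. destruct Hq as [h1 h2]. specialize (K _ h1). rewrite vadd_sub in K.
  eapply Rle_lt_trans; [exact K|]. now apply lt_div in h2.
Qed.

Lemma rd_eq : forall F p G G', G = G' -> rd F p G -> rd F p G'.
Proof. intros; subst; auto. Qed.

Lemma rd_ext : forall F F' p G, (forall q, F q = F' q) -> rd F p G -> rd F' p G.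
Proof.
  intros F F' p G E H eps He. destruct (H eps He) as [d [Hd K]]. exists d. split; auto.
  intros h Hh. rewrite <- !E. auto.
Qed.

Lemma rd_plus : forall F F' p G G', rd F p G -> rd F' p G' -> rd (fun q => F q + F' q) p (vadd G G').
Proof.
  intros F F' p G G' H H' eps He.
  destruct (H (eps / 2)) as [d [Hd K]]; [lra|]. destruct (H' (eps / 2)) as [d' [Hd' K']]; [lra|].
  exists (Rmin d d'). split; [now apply Rmin_glb_lt|]. intros h Hh.
  specialize (K h (Rlt_le_trans _ _ _ Hh (Rmin_l _ _))). specialize (K' h (Rlt_le_trans _ _ _ Hh (Rmin_r _ _))).
  replace (F (vadd p h) + F' (vadd p h) - (F p + F' p) - ip (vadd G G') h)
    with ((F (vadd p h) - F p - ip G h) + (F' (vadd p h) - F' p - ip G' h)) by (unfold ip; simpl; ring).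
  eapply Rle_trans; [apply Rabs_triang|]. lra.
Qed.

Lemma rd_scal : forall c F p G, rd F p G -> rd (fun q => c * F q) p (vscal (RtoC c) G).
Proof.
  intros c F p G H eps He. pose proof (Rabs_pos c).
  destruct (H (eps / (Rabs c + 1))) as [d [Hd K]]; [apply Rdiv_lt_0_compat; lra|]. exists d. split; auto.
  intros h Hh. specialize (K h Hh).
  replace (c * F (vadd p h) - c * F p - ip (vscal (RtoC c) G) h)
    with (c * (F (vadd p h) - F p - ip G h)) by (unfold ip; simpl; ring).
  rewrite Rabs_mult.
  apply Rle_trans with ((Rabs c + 1) * (eps / (Rabs c + 1) * nrm h)).
  - apply Rmult_le_compat; auto using Rabs_pos. lra.
  - right. field. lra.
Qed.

Lemma rd_const : forall c p, rd (fun _ => c) p origin.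
Proof.
  intros c p eps He. exists 1. split; [lra|]. intros h _.
  replace (c - c - ip origin h) with 0 by (unfold ip, origin; simpl; ring).
  rewrite Rabs_R0. pose proof (nrm_ge_0 h). nra.
Qed.

Lemma rd_ip : forall G p, rd (fun q => ip G q) p G.
Proof.
  intros G p eps He. exists 1. split; [lra|]. intros h _.
  replace (ip G (vadd p h) - ip G p - ip G h) with 0 by (unfold ip; simpl; ring).
  rewrite Rabs_R0. pose proof (nrm_ge_0 h). nra.
Qed.

Lemma rd_mult : forall F F' p G G', rd F p G -> rd F' p G' ->
  rd (fun q => F q * F' q) p (vadd (vscal (RtoC (F' p)) G) (vscal (RtoC (F p)) G')).
Proof.
  intros F F' p G G' H H' eps He.
  destruct (rd_lipschitz _ _ _ H) as [d1 [Hd1 K1]]. destruct (rd_lipschitz _ _ _ H') as [d2 [Hd2 K2]].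
  set (A := nrm G + 1) in *. set (A' := nrm G' + 1) in *. set (m := Rabs (F p) + Rabs (F' p) + 1).
  pose proof (Rabs_pos (F p)). pose proof (Rabs_pos (F' p)).
  assert (P : 0 < A /\ 0 < A' /\ 0 < m) by (unfold A, A', m; pose proof (nrm_ge_0 G); pose proof (nrm_ge_0 G'); lra).
  destruct P as [PA [PA' Pm]].
  assert (Pe : 0 < eps / 4 / m) by (repeat apply Rdiv_lt_0_compat; lra).
  destruct (H _ Pe) as [d3 [Hd3 K3]]. destruct (H' _ Pe) as [d4 [Hd4 K4]].
  assert (P5 : 0 < eps / 2 / (A * A')) by (apply Rdiv_lt_0_compat; nra).
  exists (Rmin (Rmin (Rmin d1 d2) (Rmin d3 d4)) (eps / 2 / (A * A'))). split; [repeat apply Rmin_glb_lt; auto|].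
  intros h Hh. apply lt_Rmin in Hh. destruct Hh as [Hh A5]. apply lt_Rmin in Hh. destruct Hh as [A12 A34].
  apply lt_Rmin in A12, A34. apply lt_div in A5; [|nra].
  specialize (K1 h (proj1 A12)). specialize (K2 h (proj2 A12)). specialize (K3 h (proj1 A34)). specialize (K4 h (proj2 A34)).
  set (D := F (vadd p h) - F p) in *. set (D' := F' (vadd p h) - F' p) in *.
  match goal with |- Rabs ?X <= _ => replace X with (F' p * (D - ip G h) + F p * (D' - ip G' h) + D * D') by (unfold D, D', ip; simpl; ring) end.
  pose proof (nrm_ge_0 h) as Ph. pose proof (Rabs_pos D). pose proof (Rabs_pos D').
  pose proof (Rabs_pos (D - ip G h)). pose proof (Rabs_pos (D' - ip G' h)).
  eapply Rle_trans; [apply Rabs_triang|]. eapply Rle_trans; [apply Rplus_le_compat_r, Rabs_triang|]. rewrite !Rabs_mult.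
  assert (E : m * (eps / 4 / m * nrm h) = eps / 4 * nrm h) by (field; lra).
  assert (X1 : Rabs (F' p) * Rabs (D - ip G h) <= eps / 4 * nrm h) by (rewrite <- E; apply Rmult_le_compat; auto; unfold m; lra).
  assert (X2 : Rabs (F p) * Rabs (D' - ip G' h) <= eps / 4 * nrm h) by (rewrite <- E; apply Rmult_le_compat; auto; unfold m; lra).
  assert (X3 : Rabs D * Rabs D' <= (A * nrm h) * (A' * nrm h)) by (apply Rmult_le_compat; auto).
  assert ((A * nrm h) * (A' * nrm h) <= eps / 2 * nrm h) by nra. lra.
Qed.

(** The gradient is a conjugate because [Re (c * h)] is the scalar product of [h] with the conjugate
    of [c]. *)
Lemma rd_re : forall k F p a b, hd F p a b -> rd (fun q => fst (k * F q)%C) p (Cconj (k * a)%C, Cconj (k * b)%C).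
Proof.
  intros k F p a b H eps He. pose proof (Cmod_ge_0 k).
  destruct (H (eps / (Cmod k + 1))) as [d [Hd K]]; [apply Rdiv_lt_0_compat; lra|]. exists d. split; auto.
  intros h Hh. specialize (K h Hh).
  match goal with |- Rabs ?X <= _ => replace X with (fst (k * (F (vadd p h) - F p - lin a b h))%C) by (unfold ip, lin; simpl; ring) end.
  eapply Rle_trans; [apply Rabs_Re_le|]. rewrite Cmod_mult.
  apply Rle_trans with ((Cmod k + 1) * (eps / (Cmod k + 1) * nrm h)).
  - apply Rmult_le_compat; auto using Cmod_ge_0. lra.
  - right. field. lra.
Qed.

Lemma rd_sqdist : forall p x, rd (fun q => ip (vsub q p) (vsub q p)) x (vscal (RtoC 2) (vsub x p)).
Proof.
  intros p x eps He. exists eps. split; auto. intros h Hh.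
  replace (ip (vsub (vadd x h) p) (vsub (vadd x h) p) - ip (vsub x p) (vsub x p) - ip (vscal (RtoC 2) (vsub x p)) h)
    with (ip h h) by (unfold ip; simpl; ring).
  eapply Rle_trans; [apply ip_bound|]. pose proof (nrm_ge_0 h). nra.
Qed.

Lemma rd_interior_minimum : forall F p G, rd F p G ->
  (exists d, 0 < d /\ forall h, nrm h < d -> F p <= F (vadd p h)) -> G = origin.
Proof.
  intros F p G H [d [Hd Hm]].
  destruct (Req_dec (nrm G) 0) as [E|E]; [now apply nrm_eq_0|exfalso].
  assert (P : 0 < nrm G) by (pose proof (nrm_ge_0 G); lra).
  destruct (H (nrm G / 4)) as [d' [Hd' K]]; [lra|].
  set (t := Rmin d d' / (2 * nrm G)).
  assert (Pd : 0 < Rmin d d') by now apply Rmin_glb_lt.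
  assert (Pt : 0 < t) by (apply Rdiv_lt_0_compat; lra).
  set (h := vscal (RtoC (- t)) G).
  assert (Nh : nrm h = Rmin d d' / 2).
  { unfold h. rewrite nrm_scal, Cmod_R, Rabs_Ropp, Rabs_pos_eq by lra. unfold t. field. lra. }
  pose proof (Rmin_l d d'). pose proof (Rmin_r d d').
  specialize (K h ltac:(lra)). specialize (Hm h ltac:(lra)).
  assert (E1 : ip G h = - t * ip G G) by (unfold h, ip; simpl; ring).
  assert (E2 : nrm h = t * nrm G) by (unfold h; rewrite nrm_scal, Cmod_R, Rabs_Ropp, Rabs_pos_eq; lra).
  rewrite E1, E2 in K. apply Rabs_le_between in K. pose proof (nrm_sqr_ip G) as Q. nra.
Qed.

(** Linear dependence of three vectors of R^4, hence with real coefficients. *)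
Definition dep3 (u v w : C2) : Prop :=
  exists a b c : R, ~ (a = 0 /\ b = 0 /\ c = 0) /\
    vadd (vadd (vscal (RtoC a) u) (vscal (RtoC b) v)) (vscal (RtoC c) w) = origin.

Lemma tends_vadd : forall u v k l, tends u k -> tends v l -> tends (fun n => vadd (u n) (v n)) (vadd k l).
Proof.
  intros u v k l Hu Hv eps He. destruct (Hu (eps / 2)) as [N1 K1]; [lra|]. destruct (Hv (eps / 2)) as [N2 K2]; [lra|].
  exists (Nat.max N1 N2). intros n Hn. specialize (K1 n ltac:(lia)). specialize (K2 n ltac:(lia)).
  replace (vsub (vadd (u n) (v n)) (vadd k l)) with (vadd (vsub (u n) k) (vsub (v n) l)) by c2ring.
  eapply Rle_lt_trans; [apply nrm_add|]. lra.
Qed.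

Lemma tends_scal : forall (s : nat -> C) u k l,
  (forall eps, 0 < eps -> exists N, forall n, (N <= n)%nat -> Cmod (s n - k)%C < eps) -> tends u l ->
  tends (fun n => vscal (s n) (u n)) (vscal k l).
Proof.
  intros s u k l Hs Hu eps He.
  pose proof (nrm_ge_0 l) as Pl. pose proof (Cmod_ge_0 k) as Pk.
  destruct (Hu (Rmin 1 (eps / 2 / (Cmod k + 1)))) as [N1 K1].
  { apply Rmin_glb_lt; [lra|]. repeat apply Rdiv_lt_0_compat; lra. }
  destruct (Hs (eps / 2 / (nrm l + 1))) as [N2 K2]; [repeat apply Rdiv_lt_0_compat; lra|].
  exists (Nat.max N1 N2). intros n Hn. specialize (K1 n ltac:(lia)). specialize (K2 n ltac:(lia)).
  pose proof (Rmin_l 1 (eps / 2 / (Cmod k + 1))). pose proof (Rmin_r 1 (eps / 2 / (Cmod k + 1))).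
  replace (vsub (vscal (s n) (u n)) (vscal k l)) with (vadd (vscal (s n - k)%C (u n)) (vscal k (vsub (u n) l))) by c2ring.
  eapply Rle_lt_trans; [apply nrm_add|]. rewrite !nrm_scal.
  assert (Un : nrm (u n) <= nrm l + 1).
  { replace (u n) with (vadd l (vsub (u n) l)) by apply vadd_sub. eapply Rle_trans; [apply nrm_add|]. lra. }
  pose proof (Cmod_ge_0 (s n - k)%C). pose proof (nrm_ge_0 (vsub (u n) l)). pose proof (nrm_ge_0 (u n)).
  assert (X1 : Cmod (s n - k)%C * nrm (u n) < eps / 2).
  { apply Rle_lt_trans with (Cmod (s n - k)%C * (nrm l + 1)); [apply Rmult_le_compat_l; auto|].
    apply Rmult_lt_compat_r with (r := nrm l + 1) in K2; [|lra].
    replace (eps / 2 / (nrm l + 1) * (nrm l + 1)) with (eps / 2) in K2 by (field; lra). exact K2. }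
  assert (X2 : Cmod k * nrm (vsub (u n) l) <= eps / 2).
  { apply Rle_trans with ((Cmod k + 1) * (eps / 2 / (Cmod k + 1))); [apply Rmult_le_compat; lra|].
    right. field. lra. }
  lra.
Qed.

Lemma tends_unique : forall u k l, tends u k -> tends u l -> k = l.
Proof.
  intros u k l Hk Hl. assert (E : vsub k l = origin).
  { apply nrm_eq_0. destruct (Rle_lt_or_eq_dec _ _ (nrm_ge_0 (vsub k l))) as [P|P]; auto. exfalso.
    destruct (Hk (nrm (vsub k l) / 2)) as [N1 K1]; [lra|]. destruct (Hl (nrm (vsub k l) / 2)) as [N2 K2]; [lra|].
    specialize (K1 (Nat.max N1 N2) ltac:(lia)). specialize (K2 (Nat.max N1 N2) ltac:(lia)).
    pose proof (nrm_chain k (u (Nat.max N1 N2)) l). rewrite nrm_sub_sym in K1. lra. }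
  replace k with (vadd l (vsub k l)) by apply vadd_sub. rewrite E. apply vadd_0.
Qed.

Lemma tends_const : forall l, tends (fun _ => l) l.
Proof.
  intros l eps He. exists 0%nat. intros n _. now rewrite vsub_diag, nrm_origin.
Qed.

(** With normalised coefficients a subsequence of them has a nonzero limit. *)
Lemma dep3_closed : forall u v w u0 v0 w0, tends u u0 -> tends v v0 -> tends w w0 ->
  (forall n, dep3 (u n) (v n) (w n)) -> dep3 u0 v0 w0.
Proof.
  intros u v w u0 v0 w0 Hu Hv Hw H.
  assert (S : forall n, exists q : C2, Rabs (fst (fst q)) + Rabs (snd (fst q)) + Rabs (fst (snd q)) = 1 /\ snd (snd q) = 0 /\
    vadd (vadd (vscal (RtoC (fst (fst q))) (u n)) (vscal (RtoC (snd (fst q))) (v n))) (vscal (RtoC (fst (snd q))) (w n)) = origin).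
  { intros n. destruct (H n) as [a [b [c [N E]]]].
    set (s := Rabs a + Rabs b + Rabs c).
    assert (P : 0 < s).
    { unfold s. pose proof (Rabs_pos a). pose proof (Rabs_pos b). pose proof (Rabs_pos c).
      destruct (Req_dec a 0) as [Ea|Ea]; [|apply Rabs_pos_lt in Ea; lra].
      destruct (Req_dec b 0) as [Eb|Eb]; [|apply Rabs_pos_lt in Eb; lra].
      destruct (Req_dec c 0) as [Ec|Ec]; [exfalso; auto|apply Rabs_pos_lt in Ec; lra]. }
    exists ((a / s, b / s), (c / s, 0)). simpl. split; [|split; auto].
    - unfold Rdiv. rewrite !Rabs_mult, Rabs_inv, (Rabs_pos_eq s) by lra.
      replace (Rabs a * / s + Rabs b * / s + Rabs c * / s) with (s * / s) by (unfold s at 1; ring).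
      field. lra.
    - transitivity (vscal (RtoC (/ s)) (vadd (vadd (vscal (RtoC a) (u n)) (vscal (RtoC b) (v n))) (vscal (RtoC c) (w n)))).
      + unfold Rdiv. rewrite !RtoC_mult. c2ring.
      + rewrite E. c2ring. }
  destruct (choice_function _ _ _ S) as [q Hq].
  destruct (bolzano q 1) as [phi [l [E L]]].
  { intros n. destruct (Hq n) as [h1 [h2 _]]. unfold nrm.
    pose proof (Cmod_le_ReIm (fst (q n))). pose proof (Cmod_le_ReIm (snd (q n))) as Q.
    rewrite h2, Rabs_R0 in Q. lra. }
  assert (Comp : forall eps, 0 < eps -> exists N, forall n, (N <= n)%nat ->
     Rabs (fst (fst (q (phi n))) - fst (fst l)) < eps /\ Rabs (snd (fst (q (phi n))) - snd (fst l)) < eps /\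
     Rabs (fst (snd (q (phi n))) - fst (snd l)) < eps).
  { intros eps He. destruct (L eps He) as [N HN]. exists N. intros n Hn. specialize (HN n Hn).
    pose proof (Cmod_fst_nrm (vsub (q (phi n)) l)) as Q1. pose proof (Cmod_snd_nrm (vsub (q (phi n)) l)) as Q2.
    pose proof (Rabs_Re_le (fst (vsub (q (phi n)) l))) as Q3. pose proof (Rabs_Im_le (fst (vsub (q (phi n)) l))) as Q4.
    pose proof (Rabs_Re_le (snd (vsub (q (phi n)) l))) as Q5. simpl in *. unfold Rminus. lra. }
  exists (fst (fst l)), (snd (fst l)), (fst (snd l)). split.
  - intros [Z1 [Z2 Z3]]. destruct (Comp (/ 3)) as [N HN]; [lra|]. destruct (HN N (le_n _)) as [C1 [C2 C3]].
    rewrite Z1, Z2, Z3, !Rminus_0_r in *. destruct (Hq (phi N)) as [h _]. lra.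
  - apply (tends_unique (fun n => vadd (vadd (vscal (RtoC (fst (fst (q (phi n))))) (u (phi n))) (vscal (RtoC (snd (fst (q (phi n))))) (v (phi n))))
       (vscal (RtoC (fst (snd (q (phi n))))) (w (phi n))))).
    + repeat apply tends_vadd; apply tends_scal;
        try (apply (tends_extraction _ _ phi); [assumption|exact E]);
        intros eps He; destruct (Comp eps He) as [N HN]; exists N; intros n Hn;
        destruct (HN n Hn) as [C1 [C2 C3]]; rewrite <- RtoC_minus, Cmod_R; assumption.
    + intros eps He. exists 0%nat. intros n _. destruct (Hq (phi n)) as [_ [_ h]]. rewrite h.
      now rewrite vsub_diag, nrm_origin.
Qed.

Definition cont_vec (G : C2 -> C2) (p : C2) : Prop := forall eps, 0 < eps -> exists d, 0 < d /\
  forall q, nrm (vsub q p) < d -> nrm (vsub (G q) (G p)) < eps.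

Lemma cont_vec_tends : forall G p u, cont_vec G p -> tends u p -> tends (fun n => G (u n)) (G p).
Proof.
  intros G p u HG Hu eps He. destruct (HG eps He) as [d [Hd K]]. destruct (Hu d Hd) as [N HN].
  exists N. intros n Hn. apply K, HN, Hn.
Qed.

(** In [lagrange_multipliers] the multiplier rule is obtained at points close to [p] and passes to
    the limit by the continuity of [G] at [p]. *)
Definition c1_at (F : C2 -> R) (G : C2 -> C2) (p : C2) : Prop :=
  (exists d, 0 < d /\ forall q, nrm (vsub q p) < d -> rd F q (G q)) /\ cont_vec G p.

Definition local_min_on (M : C2 -> Prop) (F : C2 -> R) (p : C2) : Prop :=
  exists d, 0 < d /\ forall q, M q -> nrm (vsub q p) < d -> F p <= F q.

(** McShane's penalty argument: if [F] is minimal at [p] subject to [f = g = 0], the function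
    [F + |x - p|^2 + K (f^2 + g^2)] has, for [K] large, an unconstrained minimum close to [p],
    where its gradient vanishes; the multipliers then pass to the limit. *)
Lemma lagrange_multipliers : forall F f g GF Gf Gg p,
  c1_at F GF p -> c1_at f Gf p -> c1_at g Gg p -> f p = 0 -> g p = 0 ->
  local_min_on (fun q => f q = 0 /\ g q = 0) F p -> dep3 (GF p) (Gf p) (Gg p).
Proof.
  intros F f g GF Gf Gg p [[d1 [Hd1 RF]] CF] [[d2 [Hd2 Rf]] Cf] [[d3 [Hd3 Rg]] Cg] f0 g0 [d4 [Hd4 Hmin]].
  set (d0 := Rmin (Rmin d1 d2) (Rmin d3 d4)).
  assert (D : 0 < d0 /\ d0 <= d1 /\ d0 <= d2 /\ d0 <= d3 /\ d0 <= d4).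
  { split; [repeat apply Rmin_glb_lt; auto|].
    pose proof (Rmin_l (Rmin d1 d2) (Rmin d3 d4)). pose proof (Rmin_r (Rmin d1 d2) (Rmin d3 d4)).
    pose proof (Rmin_l d1 d2). pose proof (Rmin_r d1 d2). pose proof (Rmin_l d3 d4). pose proof (Rmin_r d3 d4).
    unfold d0. lra. }
  destruct D as [D0 [D1 [D2 [D3 D4]]]]. clearbody d0.
  set (pen := fun K q => F q + (ip (vsub q p) (vsub q p) + K * (f q * f q + g q * g q))).
  set (gpen := fun K x => vadd (GF x) (vadd (vscal (RtoC 2) (vsub x p))
     (vscal (RtoC K) (vadd (vadd (vscal (RtoC (f x)) (Gf x)) (vscal (RtoC (f x)) (Gf x))) (vadd (vscal (RtoC (g x)) (Gg x)) (vscal (RtoC (g x)) (Gg x))))))).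
  assert (Rpen : forall K x, nrm (vsub x p) < d0 -> rd (pen K) x (gpen K x)).
  { intros K x Hx. apply rd_plus; [apply RF; lra|]. apply rd_plus; [apply rd_sqdist|].
    apply rd_scal, rd_plus; apply rd_mult; first [apply Rf|apply Rg]; lra. }
  assert (Zp : vsub p p = origin) by c2ring.
  assert (pen_p : forall K, pen K p = F p).
  { intros K. unfold pen. rewrite Zp, f0, g0. unfold ip, origin. simpl. ring. }
  assert (Near : forall eta, 0 < eta < d0 -> exists x, nrm (vsub x p) < eta /\
     dep3 (vadd (GF x) (vscal (RtoC 2) (vsub x p))) (Gf x) (Gg x)).
  { intros eta Heta.
    (* otherwise points of the sphere violating this would cluster at a zero of [f] and [g], where
       the term [|x - p|^2] contradicts minimality *)
    assert (SphereK : exists K, 0 <= K /\ forall x, nrm (vsub x p) = eta -> F p < pen K x).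
    { apply NNPP. intros N.
      assert (S : forall n : nat, exists x, nrm (vsub x p) = eta /\ pen (INR n) x <= F p).
      { intros n. apply NNPP. intros N'. apply N. exists (INR n). split; [apply pos_INR|].
        intros x Hx. apply Rnot_le_lt. intros h. apply N'. exists x. auto. }
      destruct (choice_function _ _ _ S) as [u Hu].
      destruct (bolzano u (nrm p + eta)) as [phi [l [E L]]].
      { intros n. replace (u n) with (vadd p (vsub (u n) p)) by apply vadd_sub.
        eapply Rle_trans; [apply nrm_add|]. destruct (Hu n) as [h _]. lra. }
      assert (Hl : nrm (vsub l p) = eta).
      { apply Rle_antisym; apply Rnot_lt_le; intros h.
        - destruct (L (nrm (vsub l p) - eta)) as [N1 K1]; [lra|]. specialize (K1 N1 (le_n _)).
          pose proof (nrm_chain l (u (phi N1)) p). rewrite (nrm_sub_sym l (u (phi N1))) in H. destruct (Hu (phi N1)) as [h1 _]. lra.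
        - destruct (L (eta - nrm (vsub l p))) as [N1 K1]; [lra|]. specialize (K1 N1 (le_n _)).
          pose proof (nrm_chain (u (phi N1)) l p). destruct (Hu (phi N1)) as [h1 _]. lra. }
      pose proof (rd_cont _ _ _ (RF l ltac:(lra))) as cF.
      pose proof (rd_cont _ _ _ (rd_plus _ _ _ _ _ (rd_mult _ _ _ _ _ (Rf l ltac:(lra)) (Rf l ltac:(lra))) (rd_mult _ _ _ _ _ (Rg l ltac:(lra)) (Rg l ltac:(lra))))) as cq.
      pose proof (rd_cont _ _ _ (rd_sqdist p l)) as cd.
      set (Q := fun x => f x * f x + g x * g x) in *.
      assert (Ql : Q l = 0).
      { apply NNPP. intros NQ.
        assert (PQ : 0 < Q l).
        { assert (0 <= Q l) by (unfold Q; pose proof (Rle_0_sqr (f l)); pose proof (Rle_0_sqr (g l)); unfold Rsqr in *; lra). lra. }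
        destruct (contR_tends _ _ _ cq L (Q l / 2)) as [N1 K1]; [lra|].
        destruct (contR_tends _ _ _ cF L 1 Rlt_0_1) as [N2 K2].
        destruct (INR_unbounded ((F p - F l + 1) / (Q l / 2))) as [N3 K3].
        set (n := Nat.max N1 (Nat.max N2 N3)).
        specialize (K1 n ltac:(lia)). specialize (K2 n ltac:(lia)). specialize (E n).
        destruct (Hu (phi n)) as [_ h]. unfold pen in h.
        assert (I3 : INR N3 <= INR (phi n)) by (apply le_INR; lia).
        pose proof (nrm_sqr_ip (vsub (u (phi n)) p)) as I4. pose proof (pow2_ge_0 (nrm (vsub (u (phi n)) p))).
        apply Rabs_lt_between in K1. apply Rabs_lt_between in K2.
        change (f (u (phi n)) * f (u (phi n)) + g (u (phi n)) * g (u (phi n))) with (Q (u (phi n))) in h.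
        apply Rmult_gt_compat_r with (r := Q l / 2) in K3; [|lra].
        replace ((F p - F l + 1) / (Q l / 2) * (Q l / 2)) with (F p - F l + 1) in K3 by (field; lra).
        pose proof (pos_INR N3). nra. }
      assert (Zf : f l = 0 /\ g l = 0).
      { unfold Q in Ql. pose proof (Rle_0_sqr (f l)). pose proof (Rle_0_sqr (g l)). unfold Rsqr in *.
        split; apply Rsqr_0_uniq; unfold Rsqr; lra. }
      assert (Fl : F p <= F l) by (apply Hmin; auto; lra).
      assert (Il : 0 < ip (vsub l p) (vsub l p)) by (pose proof (nrm_sqr_ip (vsub l p)); rewrite Hl in *; nra).
      set (e := ip (vsub l p) (vsub l p) / 3). assert (Pe : 0 < e) by (unfold e; lra).
      destruct (contR_tends _ _ _ cF L e Pe) as [N1 K1]. destruct (contR_tends _ _ _ cd L e Pe) as [N2 K2].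
      set (n := Nat.max N1 N2). specialize (K1 n ltac:(lia)). specialize (K2 n ltac:(lia)).
      destruct (Hu (phi n)) as [_ h]. unfold pen in h.
      change (f (u (phi n)) * f (u (phi n)) + g (u (phi n)) * g (u (phi n))) with (Q (u (phi n))) in h.
      assert (0 <= Q (u (phi n))) by (unfold Q; pose proof (Rle_0_sqr (f (u (phi n)))); pose proof (Rle_0_sqr (g (u (phi n)))); unfold Rsqr in *; lra).
      pose proof (pos_INR (phi n)). apply Rabs_lt_between in K1. apply Rabs_lt_between in K2. unfold e in *. nra. }
    destruct SphereK as [K [PK HK]].
    destruct (minimum_attained (fun x => nrm (vsub x p) <= eta) (pen K) (nrm p + eta)) as [x [Hx Mx]].
    - intros u l Hu L. apply Rnot_lt_le. intros h.
      destruct (L (nrm (vsub l p) - eta)) as [N1 K1]; [lra|]. specialize (K1 N1 (le_n _)).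
      pose proof (nrm_chain l (u N1) p) as Q. rewrite (nrm_sub_sym l (u N1)) in Q. specialize (Hu N1). lra.
    - intros q Hq. replace q with (vadd p (vsub q p)) by apply vadd_sub. eapply Rle_trans; [apply nrm_add|]. lra.
    - exists p. rewrite Zp, nrm_origin. lra.
    - intros q Hq. eapply rd_cont, Rpen. lra.
    - assert (Hx' : nrm (vsub x p) < eta).
      { destruct (Rle_lt_or_eq_dec _ _ Hx) as [h|h]; auto. exfalso.
        specialize (HK x h). specialize (Mx p). rewrite Zp, nrm_origin, pen_p in Mx. lra. }
      exists x. split; auto.
      assert (Z : gpen K x = origin).
      { apply (rd_interior_minimum (pen K) x); [apply Rpen; lra|].
        exists (eta - nrm (vsub x p)). split; [lra|]. intros h Hh. apply Mx.
        pose proof (nrm_chain (vadd x h) x p) as Q. rewrite vsub_add in Q. lra. }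
      exists 1, (K * (2 * f x)), (K * (2 * g x)). split; [intros [h _]; lra|].
      rewrite <- Z. unfold gpen. rewrite !RtoC_mult. c2ring. }
  assert (S : forall n : nat, exists x, nrm (vsub x p) < Rmin (d0 / 2) (/ (INR n + 1)) /\
     dep3 (vadd (GF x) (vscal (RtoC 2) (vsub x p))) (Gf x) (Gg x)).
  { intros n. assert (0 < / (INR n + 1)) by (apply Rinv_0_lt_compat; pose proof (pos_INR n); lra).
    apply Near. split; [apply Rmin_glb_lt; lra|]. eapply Rle_lt_trans; [apply Rmin_l|lra]. }
  destruct (choice_function _ _ _ S) as [x Hx].
  assert (Tx : tends x p).
  { intros eps He. destruct (inv_succ_lt eps He) as [N HN]. exists N. intros n Hn. destruct (Hx n) as [h _].
    specialize (HN n Hn). pose proof (Rmin_r (d0 / 2) (/ (INR n + 1))). lra. }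
  apply (dep3_closed (fun n => vadd (GF (x n)) (vscal (RtoC 2) (vsub (x n) p))) (fun n => Gf (x n)) (fun n => Gg (x n))).
  - replace (GF p) with (vadd (GF p) (vscal (RtoC 2) origin)) by c2ring.
    apply tends_vadd; [now apply cont_vec_tends|]. apply tends_scal.
    + intros eps He. exists 0%nat. intros n _. replace (RtoC 2 - RtoC 2)%C with (RtoC 0) by ring. now rewrite Cmod_0.
    + intros eps He. destruct (Tx eps He) as [N HN]. exists N. intros n Hn.
      replace (vsub (vsub (x n) p) origin) with (vsub (x n) p) by c2ring. auto.
  - now apply cont_vec_tends.
  - now apply cont_vec_tends.
  - intros n. apply Hx.
Qed.

(** Two homogeneous linear equations in three unknowns; the vector product solves them unless it
    vanishes. *)
Lemma orthogonal_to_two : forall s1 s2 s3 t1 t2 t3 : R, exists a b c : R, ~ (a = 0 /\ b = 0 /\ c = 0) /\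
  a * s1 + b * s2 + c * s3 = 0 /\ a * t1 + b * t2 + c * t3 = 0.
Proof.
  intros s1 s2 s3 t1 t2 t3.
  set (x := s2 * t3 - s3 * t2). set (y := s3 * t1 - s1 * t3). set (z := s1 * t2 - s2 * t1).
  destruct (excluded_middle_informative (x = 0 /\ y = 0 /\ z = 0)) as [[Hx [Hy Hz]]|N].
  2:{ exists x, y, z. split; auto. unfold x, y, z. split; ring. }
  unfold x, y, z in *.
  destruct (Req_dec s1 0) as [E1|E1]; [destruct (Req_dec s2 0) as [E2|E2]; [destruct (Req_dec s3 0) as [E3|E3]|]|].
  - subst. destruct (Req_dec t1 0) as [F1|F1].
    + exists 1, 0, 0. split; [intros [h _]; lra|]. subst. split; ring.
    + exists (- t2), t1, 0. split; [intros [_ [h _]]; auto|]. split; ring.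
  - subst. exists 1, 0, 0. split; [intros [h _]; lra|]. split; [ring|].
    assert (s3 * t1 = 0) by lra. apply Rmult_integral in H. destruct H; [contradiction|]. subst. ring.
  - subst. exists s2, (- 0), 0. split; [intros [h _]; auto|]. split; [ring|]. nra.
  - exists s2, (- s1), 0. split; [intros [_ [h _]]; lra|]. split; [ring|]. lra.
Qed.

(** The only property of a smooth surface that the argument uses.  In particular functions that are
    constant on [M] are eligible at every point; on a tangency locus, the equation of the sphere
    and the real part of any multiple of the tangency equation are of this kind. *)
Definition rigid (M : C2 -> Prop) : Prop :=
  forall p F1 F2 F3 G1 G2 G3, M p ->
    c1_at F1 G1 p -> c1_at F2 G2 p -> c1_at F3 G3 p ->
    local_min_on M F1 p -> local_min_on M F2 p -> local_min_on M F3 p ->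
    dep3 (G1 p) (G2 p) (G3 p).

(** By the multiplier rule each of the three gradients lies in the plane spanned by those of the
    two equations. *)
Lemma rigid_of_equations : forall M,
  (forall p, M p -> exists f g Gf Gg, c1_at f Gf p /\ c1_at g Gg p /\
     (exists d, 0 < d /\ forall q, nrm (vsub q p) < d -> (M q <-> f q = 0 /\ g q = 0)) /\
     (forall a b : R, vadd (vscal (RtoC a) (Gf p)) (vscal (RtoC b) (Gg p)) = origin -> a = 0 /\ b = 0)) ->
  rigid M.
Proof.
  intros M HM p F1 F2 F3 G1 G2 G3 Mp C1 C2' C3 L1 L2 L3.
  destruct (HM p Mp) as [f [g [Gf [Gg [Cf [Cg [[d [Hd Eq]] Ind]]]]]]].
  assert (Z : f p = 0 /\ g p = 0).
  { apply Eq; auto. now rewrite vsub_diag, nrm_origin. }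
  assert (Span : forall F G, c1_at F G p -> local_min_on M F p -> exists s t : R,
     G p = vadd (vscal (RtoC s) (Gf p)) (vscal (RtoC t) (Gg p))).
  { intros F G CF [d' [Hd' Lm]].
    destruct (lagrange_multipliers F f g G Gf Gg p CF Cf Cg (proj1 Z) (proj2 Z)) as [a [b [c [N E]]]].
    - exists (Rmin d d'). split; [now apply Rmin_glb_lt|]. intros q Hq Hn. apply Lm.
      + apply Eq; auto. eapply Rlt_le_trans; [exact Hn|apply Rmin_l].
      + eapply Rlt_le_trans; [exact Hn|apply Rmin_r].
    - assert (Na : a <> 0).
      { intros ->. destruct (Ind b c) as [-> ->]; [|auto]. rewrite <- E. c2ring. }
      exists (- (b / a)), (- (c / a)).
      assert (Na' : RtoC a <> RtoC 0) by (intros h; apply RtoC_inj in h; auto).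
      transitivity (vadd (G p) (vscal (- / RtoC a)%C (vadd (vadd (vscal (RtoC a) (G p)) (vscal (RtoC b) (Gf p))) (vscal (RtoC c) (Gg p))))).
      + rewrite E. c2ring.
      + rewrite !RtoC_opp, !RtoC_div by auto. apply C2_eq; unfold vadd, vscal; simpl; field; auto. }
  destruct (Span _ _ C1 L1) as [s1 [t1 E1]]. destruct (Span _ _ C2' L2) as [s2 [t2 E2]]. destruct (Span _ _ C3 L3) as [s3 [t3 E3]].
  destruct (orthogonal_to_two s1 s2 s3 t1 t2 t3) as [a [b [c [N [X Y]]]]].
  exists a, b, c. split; auto. rewrite E1, E2, E3.
  transitivity (vadd (vscal (RtoC (a * s1 + b * s2 + c * s3)) (Gf p)) (vscal (RtoC (a * t1 + b * t2 + c * t3)) (Gg p))).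
  - rewrite !RtoC_plus, !RtoC_mult. c2ring.
  - rewrite X, Y. c2ring.
Qed.

(** * Two-by-two matrices *)

Record mat : Type := Mat { m11 : C; m12 : C; m21 : C; m22 : C }.

Definition mv (m : mat) (q : C2) : C2 := (lin (m11 m) (m12 m) q, lin (m21 m) (m22 m) q).

Definition adj (m : mat) : mat :=
  Mat (Cconj (m11 m)) (Cconj (m21 m)) (Cconj (m12 m)) (Cconj (m22 m)).

Definition mdet (m : mat) : C := (m11 m * m22 m - m12 m * m21 m)%C.

Definition mmul (m n : mat) : mat :=
  Mat (m11 m * m11 n + m12 m * m21 n)%C (m11 m * m12 n + m12 m * m22 n)%C
      (m21 m * m11 n + m22 m * m21 n)%C (m21 m * m12 n + m22 m * m22 n)%C.

Definition mscal (c : C) (m : mat) : mat := Mat (c * m11 m)%C (c * m12 m)%C (c * m21 m)%C (c * m22 m)%C.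

(** Invertibility from both sides is part of the definition, so that either composite can be
    cancelled without a dimension count. *)
Definition munitary (m : mat) : Prop :=
  (forall q, mv m (mv (adj m) q) = q) /\ (forall q, mv (adj m) (mv m q) = q).

Lemma mv_mmul : forall m n q, mv (mmul m n) q = mv m (mv n q).
Proof. intros m n q. apply C2_eq; unfold mv, mmul, lin; simpl; ring. Qed.

Lemma adj_adj : forall m, adj (adj m) = m.
Proof. intros [a b c d]. unfold adj. simpl. now rewrite !Cconj_conj. Qed.

Lemma adj_mmul : forall m n, adj (mmul m n) = mmul (adj n) (adj m).
Proof.
  intros m n. unfold adj, mmul. simpl. f_equal; rewrite Cplus_conj, !Cmult_conj; ring.
Qed.

Lemma munitary_mmul : forall m n, munitary m -> munitary n -> munitary (mmul m n).
Proof.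
  intros m n [M1 M2] [N1 N2]. split; intros q; rewrite adj_mmul, !mv_mmul.
  - now rewrite N1, M1.
  - now rewrite M2, N2.
Qed.

Lemma munitary_adj : forall m, munitary m -> munitary (adj m).
Proof. intros m [M1 M2]. split; intros q; rewrite adj_adj; auto. Qed.

Lemma hermitian_adj : forall m u v, hermitian (mv m u) v = hermitian u (mv (adj m) v).
Proof.
  intros m u v. unfold hermitian, mv, adj, lin. simpl.
  rewrite !Cplus_conj, !Cmult_conj, !Cconj_conj. ring.
Qed.

Lemma hermitian_unitary : forall m u v, munitary m -> hermitian (mv m u) (mv m v) = hermitian u v.
Proof. intros m u v [_ M]. now rewrite hermitian_adj, M. Qed.

Definition sqn (q : C2) : R := Cmod (fst q) ^ 2 + Cmod (snd q) ^ 2.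

Lemma hermitian_self : forall q, hermitian q q = RtoC (sqn q).
Proof. intros q. unfold hermitian, sqn. rewrite <- !Cmod2_conj, !RtoC_plus, !RtoC_pow. reflexivity. Qed.

Lemma sqn_unitary : forall m q, munitary m -> sqn (mv m q) = sqn q.
Proof.
  intros m q M. apply RtoC_inj. rewrite <- !hermitian_self. now apply hermitian_unitary.
Qed.

Lemma ip_hermitian : forall u v, ip u v = fst (hermitian v u).
Proof. intros u v. unfold ip, hermitian. simpl. ring. Qed.

Lemma ip_self : forall q, ip q q = sqn q.
Proof. intros q. rewrite ip_hermitian, hermitian_self. reflexivity. Qed.

Lemma nrm_sqr_le : forall q, nrm q ^ 2 <= 2 * sqn q.
Proof. intros q. rewrite <- ip_self. apply nrm_sqr_ip. Qed.

Lemma sqn_le_nrm : forall q, sqn q <= nrm q ^ 2.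
Proof. intros q. unfold sqn, nrm. pose proof (Cmod_ge_0 (fst q)). pose proof (Cmod_ge_0 (snd q)). nra. Qed.

Lemma nrm_le_2 : forall q r, 0 <= r -> sqn q = r ^ 2 -> nrm q <= 2 * r.
Proof. intros q r Hr E. pose proof (nrm_sqr_le q). pose proof (nrm_ge_0 q). nra. Qed.

Lemma sqn_scal : forall c q, sqn (vscal c q) = Cmod c ^ 2 * sqn q.
Proof. intros c q. unfold sqn, vscal. simpl. rewrite !Cmod_mult. ring. Qed.

Lemma nrm_unitary : forall m q, munitary m -> nrm (mv m q) <= 2 * nrm q.
Proof.
  intros m q M. pose proof (nrm_sqr_le (mv m q)) as H. rewrite sqn_unitary in H by auto.
  pose proof (sqn_le_nrm q). pose proof (nrm_ge_0 q). pose proof (nrm_ge_0 (mv m q)). nra.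
Qed.

Lemma mv_vadd : forall m p q, mv m (vadd p q) = vadd (mv m p) (mv m q).
Proof. intros. apply C2_eq; unfold mv, lin, vadd; simpl; ring. Qed.

Lemma mv_vsub : forall m p q, mv m (vsub p q) = vsub (mv m p) (mv m q).
Proof. intros. apply C2_eq; unfold mv, lin, vsub; simpl; ring. Qed.

Lemma mv_vscal : forall m c q, mv m (vscal c q) = vscal c (mv m q).
Proof. intros. apply C2_eq; unfold mv, lin, vscal; simpl; ring. Qed.

Lemma mv_origin : forall m, mv m origin = origin.
Proof. intros. apply C2_eq; unfold mv, lin, origin; simpl; ring. Qed.

Lemma mv_bound : forall m, exists K, 0 < K /\ forall q, nrm (mv m q) <= K * nrm q.
Proof.
  intros m. exists (Cmod (m11 m) + Cmod (m12 m) + (Cmod (m21 m) + Cmod (m22 m)) + 1).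
  pose proof (Cmod_ge_0 (m11 m)). pose proof (Cmod_ge_0 (m12 m)).
  pose proof (Cmod_ge_0 (m21 m)). pose proof (Cmod_ge_0 (m22 m)).
  split; [lra|]. intros q. unfold nrm at 1, mv. simpl.
  pose proof (Cmod_lin (m11 m) (m12 m) q). pose proof (Cmod_lin (m21 m) (m22 m) q).
  pose proof (nrm_ge_0 q). nra.
Qed.

Lemma tends_mv : forall m u l, tends u l -> tends (fun n => mv m (u n)) (mv m l).
Proof.
  intros m u l H eps He. destruct (mv_bound m) as [K [PK HK]].
  destruct (H (eps / K)) as [N HN]; [now apply Rdiv_lt_0_compat|]. exists N. intros n Hn.
  rewrite <- mv_vsub. eapply Rle_lt_trans; [apply HK|]. specialize (HN n Hn).
  apply Rmult_lt_compat_l with (r := K) in HN; auto. replace (K * (eps / K)) with eps in HN by (field; lra). exact HN.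
Qed.

Definition ctends (s : nat -> C) (l : C) : Prop :=
  forall eps, 0 < eps -> exists N, forall n, (N <= n)%nat -> Cmod (s n - l)%C < eps.

Lemma ctends_unique : forall s k l, ctends s k -> ctends s l -> k = l.
Proof.
  intros s k l Hk Hl. apply Ceq_minus. apply Cmod_lt_of_all. intros eps He.
  destruct (Hk (eps / 2)) as [N1 K1]; [lra|]. destruct (Hl (eps / 2)) as [N2 K2]; [lra|].
  specialize (K1 (Nat.max N1 N2) ltac:(lia)). specialize (K2 (Nat.max N1 N2) ltac:(lia)).
  pose proof (Cmod_chain k (s (Nat.max N1 N2)) l). rewrite Cmod_sub_sym in K1. lra.
Qed.

Lemma ctends_const : forall l, ctends (fun _ => l) l.
Proof.
  intros l eps He. exists 0%nat. intros n _. replace (l - l)%C with (RtoC 0) by ring. now rewrite Cmod_0.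
Qed.

Lemma ctends_fst : forall u l, tends u l -> ctends (fun n => fst (u n)) (fst l).
Proof.
  intros u l H eps He. destruct (H eps He) as [N HN]. exists N. intros n Hn. specialize (HN n Hn).
  pose proof (Cmod_fst_nrm (vsub (u n) l)) as Q. simpl in Q. lra.
Qed.

Lemma ctends_snd : forall u l, tends u l -> ctends (fun n => snd (u n)) (snd l).
Proof.
  intros u l H eps He. destruct (H eps He) as [N HN]. exists N. intros n Hn. specialize (HN n Hn).
  pose proof (Cmod_snd_nrm (vsub (u n) l)) as Q. simpl in Q. lra.
Qed.

Lemma tends_pair : forall u l, ctends (fun n => fst (u n)) (fst l) -> ctends (fun n => snd (u n)) (snd l) -> tends u l.
Proof.
  intros u l H1 H2 eps He. destruct (H1 (eps / 2)) as [N1 K1]; [lra|]. destruct (H2 (eps / 2)) as [N2 K2]; [lra|].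
  exists (Nat.max N1 N2). intros n Hn. specialize (K1 n ltac:(lia)). specialize (K2 n ltac:(lia)).
  unfold nrm, vsub. simpl. lra.
Qed.

Lemma ctends_plus : forall s t k l, ctends s k -> ctends t l -> ctends (fun n => s n + t n)%C (k + l)%C.
Proof.
  intros s t k l Hs Ht eps He. destruct (Hs (eps / 2)) as [N1 K1]; [lra|]. destruct (Ht (eps / 2)) as [N2 K2]; [lra|].
  exists (Nat.max N1 N2). intros n Hn. specialize (K1 n ltac:(lia)). specialize (K2 n ltac:(lia)).
  replace (s n + t n - (k + l))%C with ((s n - k) + (t n - l))%C by ring.
  eapply Rle_lt_trans; [apply Cmod_triangle|]. lra.
Qed.

Lemma ctends_mult : forall s t k l, ctends s k -> ctends t l -> ctends (fun n => s n * t n)%C (k * l)%C.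
Proof.
  intros s t k l Hs Ht.
  assert (T : tends (fun n => vscal (s n) (t n, RtoC 0)) (vscal k (l, RtoC 0))).
  { apply tends_scal; auto. apply tends_pair; simpl; [exact Ht|apply ctends_const]. }
  apply ctends_fst in T. exact T.
Qed.

Lemma ctends_conj : forall s k, ctends s k -> ctends (fun n => Cconj (s n)) (Cconj k).
Proof.
  intros s k H eps He. destruct (H eps He) as [N HN]. exists N. intros n Hn.
  rewrite <- Cminus_conj, Cmod_conj. auto.
Qed.

Lemma ctends_hermitian : forall u v k l, tends u k -> tends v l ->
  ctends (fun n => hermitian (u n) (v n)) (hermitian k l).
Proof.
  intros u v k l Hu Hv. unfold hermitian. apply ctends_plus; apply ctends_mult.
  - now apply ctends_fst.
  - now apply ctends_conj, ctends_fst.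
  - now apply ctends_snd.
  - now apply ctends_conj, ctends_snd.
Qed.

(** * Tangency with small spheres, and its limit under rescaling *)

Definition vfield (a b : C2 -> C) (q : C2) : C2 := (a q, b q).

(** The tangency locus in coordinates: on a sphere the field has to be Hermitian orthogonal to the
    position vector, as [tangency_locus_tang] will show. *)
Definition tang (a b : C2 -> C) (rho : R) (q : C2) : Prop :=
  sqn q = rho ^ 2 /\ hermitian (vfield a b q) q = RtoC 0.

Definition hol (F : C2 -> C) (R0 : R) : Prop := forall q, nrm q < R0 -> exists a b, hd F q a b.

(** The situation of the theorem in a fixed Euclidean chart: a vector field with invertible
    linear part [L] whose tangency loci with spheres of radii [r j] tending to 0 are surfaces. *)
Definition tangency_surfaces (a b : C2 -> C) (L : mat) (r : nat -> R) : Prop :=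
  (exists R0, 0 < R0 /\ hol a R0 /\ hol b R0) /\
  a origin = RtoC 0 /\ b origin = RtoC 0 /\
  hd a origin (m11 L) (m12 L) /\ hd b origin (m21 L) (m22 L) /\ mdet L <> RtoC 0 /\
  (forall j, 0 < r j) /\ (forall eps, 0 < eps -> exists N, forall j, (N <= j)%nat -> r j < eps) /\
  (forall j, exists q, tang a b (r j) q) /\ (forall j, rigid (tang a b (r j))).

Lemma hol_partials : forall F R0, hol F R0 -> exists al be : C2 -> C,
  (forall q, nrm q < R0 -> hd F q (al q) (be q)) /\
  (forall q, nrm q < R0 -> cont2 al q /\ cont2 be q).
Proof.
  intros F R0 H.
  assert (S : forall q, exists c : C * C, nrm q < R0 -> hd F q (fst c) (snd c)).
  { intros q. destruct (Rlt_dec (nrm q) R0) as [h|h].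
    - destruct (H q h) as [a [b K]]. exists (a, b). auto.
    - exists (RtoC 0, RtoC 0). intros h'. contradiction. }
  destruct (choice_function _ _ _ S) as [c Hc].
  exists (fun q => fst (c q)), (fun q => snd (c q)). split; auto.
  intros q Hq. destruct (hd_partials F (fun q => fst (c q)) (fun q => snd (c q)) q) as [[a1 [a2 K1]] [b1 [b2 K2]]].
  - exists (R0 - nrm q). split; [lra|]. intros x Hx. apply Hc.
    replace x with (vadd q (vsub x q)) by apply vadd_sub. eapply Rle_lt_trans; [apply nrm_add|]. lra.
  - split; eapply hd_cont; eassumption.
Qed.

(** The gradient of [Re (k * hermitian (Y q) q)], where [D] is the complex derivative of [Y]. *)
Definition tgrad (k : C) (y : C2) (D : mat) (q : C2) : C2 :=
  vadd (vscal k y) (vscal (Cconj k) (mv (adj D) q)).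

(** A sum of products of real parts of holomorphic functions, by
    [Re (a * conj z) = Re a * Re z + Re (- i a) * Re (- i z)]. *)
Lemma rd_tangency : forall k a b q D, hd a q (m11 D) (m12 D) -> hd b q (m21 D) (m22 D) ->
  rd (fun x => fst (k * hermitian (vfield a b x) x)%C) q (tgrad k (vfield a b q) D q).
Proof.
  intros k a b q D Ha Hb.
  pose proof (rd_plus _ _ _ _ _
    (rd_plus _ _ _ _ _ (rd_mult _ _ _ _ _ (rd_re k _ _ _ _ Ha) (rd_re (RtoC 1) _ _ _ _ (hd_fst q)))
       (rd_mult _ _ _ _ _ (rd_re (- Ci * k) _ _ _ _ Ha) (rd_re (- Ci) _ _ _ _ (hd_fst q))))
    (rd_plus _ _ _ _ _ (rd_mult _ _ _ _ _ (rd_re k _ _ _ _ Hb) (rd_re (RtoC 1) _ _ _ _ (hd_snd q)))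
       (rd_mult _ _ _ _ _ (rd_re (- Ci * k) _ _ _ _ Hb) (rd_re (- Ci) _ _ _ _ (hd_snd q))))) as K.
  eapply rd_ext; [|eapply rd_eq; [|exact K]].
  - intros x. unfold hermitian, vfield. simpl. ring.
  - unfold tgrad, mv, adj, lin, vfield, vadd, vscal.
    apply C2_eq; apply injective_projections; simpl; ring.
Qed.

(** Sequential criterion for [cont_vec], which turns continuity into the calculus of limits. *)
Lemma cont_vec_seq : forall G p, (forall u, tends u p -> tends (fun n => G (u n)) (G p)) -> cont_vec G p.
Proof.
  intros G p H eps He. apply NNPP. intros N.
  assert (S : forall n : nat, exists q, nrm (vsub q p) < / (INR n + 1) /\ eps <= nrm (vsub (G q) (G p))).
  { intros n. apply NNPP. intros N'. apply N. exists (/ (INR n + 1)).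
    split; [apply Rinv_0_lt_compat; pose proof (pos_INR n); lra|]. intros q Hq. apply Rnot_le_lt. intros h.
    apply N'. exists q. auto. }
  destruct (choice_function _ _ _ S) as [u Hu].
  destruct (H u) with (eps := eps) as [M HM]; auto.
  - intros e Hee. destruct (inv_succ_lt e Hee) as [M HM]. exists M. intros n Hn. destruct (Hu n) as [h _].
    specialize (HM n Hn). lra.
  - specialize (HM M (le_n _)). destruct (Hu M) as [_ h]. lra.
Qed.

Lemma cont2_tends : forall F p u, cont2 F p -> tends u p -> ctends (fun n => F (u n)) (F p).
Proof.
  intros F p u HF Hu eps He. destruct (HF eps He) as [d [Hd K]]. destruct (Hu d Hd) as [N HN].
  exists N. intros n Hn. apply K, HN, Hn.
Qed.

Lemma tends_mv_var : forall (m : nat -> mat) M u l, ctends (fun n => m11 (m n)) (m11 M) -> ctends (fun n => m12 (m n)) (m12 M) ->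
  ctends (fun n => m21 (m n)) (m21 M) -> ctends (fun n => m22 (m n)) (m22 M) -> tends u l ->
  tends (fun n => mv (m n) (u n)) (mv M l).
Proof.
  intros m M u l H11 H12 H21 H22 Hu.
  apply tends_pair; unfold mv, lin; simpl; apply ctends_plus; apply ctends_mult; auto using ctends_fst, ctends_snd.
Qed.

Lemma tends_tgrad : forall k y (D : nat -> mat) q y0 D0 q0, tends y y0 -> tends q q0 ->
  ctends (fun n => m11 (D n)) (m11 D0) -> ctends (fun n => m12 (D n)) (m12 D0) ->
  ctends (fun n => m21 (D n)) (m21 D0) -> ctends (fun n => m22 (D n)) (m22 D0) ->
  tends (fun n => tgrad k (y n) (D n) (q n)) (tgrad k y0 D0 q0).
Proof.
  intros k y D q y0 D0 q0 Hy Hq H11 H12 H21 H22. unfold tgrad.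
  apply tends_vadd; (apply tends_scal; [exact (ctends_const _)|]); auto.
  apply (tends_mv_var (fun n => adj (D n)) (adj D0) q q0); simpl; auto using ctends_conj.
Qed.

Lemma c1_tangency : forall k a b az aw bz bw R0 p, nrm p < R0 ->
  (forall q, nrm q < R0 -> hd a q (az q) (aw q)) -> (forall q, nrm q < R0 -> cont2 az q /\ cont2 aw q) ->
  (forall q, nrm q < R0 -> hd b q (bz q) (bw q)) -> (forall q, nrm q < R0 -> cont2 bz q /\ cont2 bw q) ->
  c1_at (fun x => fst (k * hermitian (vfield a b x) x)%C)
    (fun q => tgrad k (vfield a b q) (Mat (az q) (aw q) (bz q) (bw q)) q) p.
Proof.
  intros k a b az aw bz bw R0 p Hp Ha Ca Hb Cb. split.
  - exists (R0 - nrm p). split; [lra|]. intros q Hq.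
    assert (nrm q < R0).
    { replace q with (vadd p (vsub q p)) by apply vadd_sub. eapply Rle_lt_trans; [apply nrm_add|]. lra. }
    apply rd_tangency; simpl; auto.
  - apply cont_vec_seq. intros u Hu. destruct (Ca p Hp) as [c1 c2]. destruct (Cb p Hp) as [c3 c4].
    apply (tends_tgrad k (fun n => vfield a b (u n)) (fun n => Mat (az (u n)) (aw (u n)) (bz (u n)) (bw (u n))) u
      (vfield a b p) (Mat (az p) (aw p) (bz p) (bw p)) p); simpl; auto using cont2_tends.
    apply tends_pair; unfold vfield; simpl; apply cont2_tends; auto; eapply hd_cont; eauto.
Qed.

Lemma hd_unique : forall F p c d c' d', hd F p c d -> hd F p c' d' -> c = c' /\ d = d'.
Proof.
  intros F p c d c' d' K K'.
  assert (Q : forall v, nrm v = 1 -> lin c d v = lin c' d' v).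
  { intros v Nv. apply Ceq_minus. apply Cmod_lt_of_all. intros eps He.
    destruct (K (eps / 2)) as [d1 [Hd1 K1]]; [lra|]. destruct (K' (eps / 2)) as [d2 [Hd2 K2]]; [lra|].
    set (t := Rmin d1 d2 / 2). assert (Pt : 0 < Rmin d1 d2) by now apply Rmin_glb_lt.
    pose proof (Rmin_l d1 d2). pose proof (Rmin_r d1 d2).
    assert (Nt : nrm (vscal (RtoC t) v) = t) by (rewrite nrm_scal, Nv, Cmod_RtoC_pos; unfold t; lra).
    specialize (K1 (vscal (RtoC t) v)). specialize (K2 (vscal (RtoC t) v)). rewrite Nt in K1, K2.
    specialize (K1 ltac:(unfold t; lra)). specialize (K2 ltac:(unfold t; lra)).
    apply Rmult_le_reg_l with t; [unfold t; lra|].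
    replace (t * Cmod (lin c d v - lin c' d' v)%C) with (Cmod (RtoC t * (lin c d v - lin c' d' v))%C)
      by (rewrite Cmod_mult, Cmod_RtoC_pos; unfold t; lra).
    match type of K1 with Cmod ?X <= _ => match type of K2 with Cmod ?Y <= _ =>
      replace (RtoC t * (lin c d v - lin c' d' v))%C with (Y - X)%C by (unfold lin, vscal; simpl; ring) end end.
    eapply Rle_trans; [apply Cmod_triangle_sub|]. lra. }
  split.
  - specialize (Q (RtoC 1, RtoC 0)). unfold lin, nrm in Q. simpl in Q. rewrite Cmod_0, Cmod_1 in Q.
    specialize (Q ltac:(ring)). rewrite !Cmult_1_r, !Cmult_0_r, !Cplus_0_r in Q. exact Q.
  - specialize (Q (RtoC 0, RtoC 1)). unfold lin, nrm in Q. simpl in Q. rewrite Cmod_0, Cmod_1 in Q.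
    specialize (Q ltac:(ring)). rewrite !Cmult_1_r, !Cmult_0_r, !Cplus_0_l in Q. exact Q.
Qed.

Lemma c1_sqnorm : forall p, c1_at (fun q => ip q q) (fun q => vscal (RtoC 2) q) p.
Proof.
  intros p. split.
  - exists 1. split; [lra|]. intros q _.
    apply (rd_ext (fun q => ip (vsub q origin) (vsub q origin))).
    + intros x. replace (vsub x origin) with x by c2ring. reflexivity.
    + eapply rd_eq; [|apply rd_sqdist]. c2ring.
  - apply cont_vec_seq. intros u Hu. apply tends_scal; [exact (ctends_const _)|exact Hu].
Qed.

Lemma dep3_rescale : forall s1 s2 s3 u v w, s1 <> 0 -> s2 <> 0 -> s3 <> 0 -> dep3 u v w ->
  dep3 (vscal (RtoC s1) u) (vscal (RtoC s2) v) (vscal (RtoC s3) w).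
Proof.
  intros s1 s2 s3 u v w H1 H2 H3 [a [b [c [N E]]]].
  exists (a / s1), (b / s2), (c / s3). split.
  - intros [Z1 [Z2 Z3]]. apply N.
    repeat split; [replace a with (a / s1 * s1) by (field; auto); rewrite Z1; ring
      |replace b with (b / s2 * s2) by (field; auto); rewrite Z2; ring
      |replace c with (c / s3 * s3) by (field; auto); rewrite Z3; ring].
  - rewrite <- E.
    assert (R1 : forall x s y, s <> 0 -> vscal (RtoC (x / s)) (vscal (RtoC s) y) = vscal (RtoC x) y).
    { intros x s y Hs. transitivity (vscal (RtoC (x / s * s)) y).
      - rewrite RtoC_mult. c2ring.
      - f_equal. f_equal. field. auto. }
    now rewrite !R1.
Qed.

Section Rescaling.

Variables (a b : C2 -> C) (L : mat) (r : nat -> R).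
Hypothesis H : tangency_surfaces a b L r.

Lemma radius_pos : forall j, 0 < r j.
Proof. apply H. Qed.

Lemma radius_to_0 : forall k, extraction k -> forall eps, 0 < eps -> exists N, forall n, (N <= n)%nat -> r (k n) < eps.
Proof.
  intros k Hk eps He. destruct H as [_ [_ [_ [_ [_ [_ [_ [Hr _]]]]]]]]. destruct (Hr eps He) as [N HN].
  exists N. intros n Hn. apply HN. specialize (Hk n). lia.
Qed.

(** The surfaces themselves need not converge after rescaling; everything is read off from the
    points [q] at which their rescalings cluster. *)
Definition cluster_seq (k : nat -> nat) (p : nat -> C2) (q : C2) : Prop :=
  extraction k /\ (forall n, tang a b (r (k n)) (p n)) /\ tends (fun n => vscal (RtoC (/ r (k n))) (p n)) q.

Definition cluster (q : C2) : Prop := exists k p, cluster_seq k p q.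

Lemma sqn_rescaled : forall (k : nat -> nat) (p : nat -> C2), (forall n, tang a b (r (k n)) (p n)) -> forall n,
  sqn (vscal (RtoC (/ r (k n))) (p n)) = 1.
Proof.
  intros k p Hp n. destruct (Hp n) as [E _]. pose proof (radius_pos (k n)) as P.
  rewrite sqn_scal, E, Cmod_RtoC_pos by (left; now apply Rinv_0_lt_compat). field. lra.
Qed.

Lemma cluster_extract : forall (k : nat -> nat) (p : nat -> C2), extraction k -> (forall n, tang a b (r (k n)) (p n)) ->
  exists phi q, extraction phi /\ cluster_seq (fun n => k (phi n)) (fun n => p (phi n)) q.
Proof.
  intros k p Hk Hp.
  destruct (bolzano (fun n => vscal (RtoC (/ r (k n))) (p n)) (2 * 1)) as [phi [q [E T]]].
  { intros n. apply nrm_le_2; [lra|]. rewrite (sqn_rescaled k p Hp). ring. }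
  exists phi, q. split; auto. split; [now apply extraction_comp|]. split; auto.
Qed.

Lemma cluster_exists : exists q, cluster q.
Proof.
  destruct H as [_ [_ [_ [_ [_ [_ [_ [_ [Hn _]]]]]]]]].
  destruct (choice_function _ _ _ Hn) as [p Hp].
  destruct (cluster_extract (fun n => n) p) as [phi [q [_ K]]].
  - intros n. lia.
  - exact Hp.
  - exists q, (fun n => phi n), (fun n => p (phi n)). exact K.
Qed.

Lemma cluster_seq_to_0 : forall k p q, cluster_seq k p q -> tends p origin.
Proof.
  intros k p q [Hk [Hp _]] eps He. destruct (radius_to_0 k Hk (eps / 2)) as [N HN]; [lra|].
  exists N. intros n Hn. specialize (HN n Hn). destruct (Hp n) as [E _].
  replace (vsub (p n) origin) with (p n) by c2ring. pose proof (radius_pos (k n)).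
  eapply Rle_lt_trans; [apply (nrm_le_2 _ (r (k n))); auto; lra|lra].
Qed.

(** The deviation of the field from its linear part is small compared with the radius. *)
Lemma field_rescaled : forall k p q, cluster_seq k p q ->
  tends (fun n => vscal (RtoC (/ r (k n))) (vfield a b (p n))) (mv L q).
Proof.
  intros k p q Hc. pose proof (cluster_seq_to_0 _ _ _ Hc) as T0. destruct Hc as [Hk [Hp T]].
  destruct H as [_ [a0 [b0 [Ha [Hb _]]]]].
  assert (S : forall F c d, F origin = RtoC 0 -> hd F origin c d ->
     ctends (fun n => RtoC (/ r (k n)) * F (p n))%C (lin c d q)).
  { intros F c d F0 HF.
    assert (A : ctends (fun n => RtoC (/ r (k n)) * (F (p n) - lin c d (p n)))%C (RtoC 0)).
    { intros eps He. destruct (HF (eps / 4)) as [de [Hde K]]; [lra|]. destruct (T0 de Hde) as [N HN].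
      exists N. intros n Hn. specialize (HN n Hn). specialize (K _ HN). rewrite vadd_sub, F0 in K.
      replace (vsub (p n) origin) with (p n) in K by c2ring.
      replace (F (p n) - RtoC 0 - lin c d (p n))%C with (F (p n) - lin c d (p n))%C in K by ring.
      replace (RtoC (/ r (k n)) * (F (p n) - lin c d (p n)) - RtoC 0)%C with (RtoC (/ r (k n)) * (F (p n) - lin c d (p n)))%C by ring.
      pose proof (radius_pos (k n)) as P. pose proof (Rinv_0_lt_compat _ P).
      rewrite Cmod_mult, Cmod_RtoC_pos by lra. destruct (Hp n) as [E _].
      pose proof (nrm_le_2 _ _ (Rlt_le _ _ P) E) as B.
      apply Rle_lt_trans with (/ r (k n) * (eps / 4 * (2 * r (k n)))).
      - apply Rmult_le_compat_l; [lra|]. nra.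
      - replace (/ r (k n) * (eps / 4 * (2 * r (k n)))) with (eps / 2) by (field; lra). lra. }
    assert (B : ctends (fun n => lin c d (vscal (RtoC (/ r (k n))) (p n))) (lin c d q)).
    { unfold lin. apply ctends_plus; apply ctends_mult; auto using ctends_const.
      - exact (ctends_fst _ _ T).
      - exact (ctends_snd _ _ T). }
    pose proof (ctends_plus _ _ _ _ A B) as K. rewrite Cplus_0_l in K.
    intros eps He. destruct (K eps He) as [N HN]. exists N. intros n Hn. specialize (HN n Hn).
    match type of HN with Cmod ?X < _ => match goal with |- Cmod ?Y < _ => replace Y with X end end; auto.
    unfold lin, vscal. simpl. ring. }
  apply tends_pair; unfold vscal, vfield, mv; simpl; auto.
Qed.

Lemma cluster_unit : forall q, cluster q -> sqn q = 1.
Proof.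
  intros q [k [p [Hk [Hp T]]]]. apply RtoC_inj. rewrite <- hermitian_self.
  apply (ctends_unique (fun n => hermitian (vscal (RtoC (/ r (k n))) (p n)) (vscal (RtoC (/ r (k n))) (p n)))).
  - now apply ctends_hermitian.
  - intros eps He. exists 0%nat. intros n _. rewrite hermitian_self, (sqn_rescaled k p Hp).
    replace (RtoC 1 - RtoC 1)%C with (RtoC 0) by ring. now rewrite Cmod_0.
Qed.

Lemma cluster_tangent : forall q, cluster q -> hermitian (mv L q) q = RtoC 0.
Proof.
  intros q [k [p Hc]]. pose proof (field_rescaled _ _ _ Hc) as T1. destruct Hc as [Hk [Hp T]].
  apply (ctends_unique (fun n => hermitian (vscal (RtoC (/ r (k n))) (vfield a b (p n))) (vscal (RtoC (/ r (k n))) (p n)))).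
  - now apply ctends_hermitian.
  - intros eps He. exists 0%nat. intros n _. destruct (Hp n) as [_ E].
    match goal with |- Cmod ?X < _ => replace X with (RtoC 0); [now rewrite Cmod_0|] end.
    transitivity (RtoC (/ r (k n)) * RtoC (/ r (k n)) * hermitian (vfield a b (p n)) (p n))%C.
    + rewrite E. ring.
    + assert (Cr : Cconj (RtoC (/ r (k n))) = RtoC (/ r (k n))) by (unfold Cconj, RtoC; simpl; f_equal; ring).
      unfold hermitian, vscal. simpl. rewrite !Cmult_conj, Cr. ring.
Qed.

(** The gradients of the real and imaginary parts of the tangency equation, divided by the
    radius, converge to those of its quadratic model. *)
Lemma tangency_gradient : exists (G : C -> C2 -> C2) R0, 0 < R0 /\
  (forall ka p, nrm p < R0 -> c1_at (fun x => fst (ka * hermitian (vfield a b x) x)%C) (G ka) p) /\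
  (forall ka k p q, cluster_seq k p q ->
     tends (fun n => vscal (RtoC (/ r (k n))) (G ka (p n))) (tgrad ka (mv L q) L q)).
Proof.
  pose proof H as [[R0 [PR [hA hB]]] [a0 [b0 [Ha [Hb _]]]]].
  destruct (hol_partials a R0 hA) as [az [aw [Da Ca]]]. destruct (hol_partials b R0 hB) as [bz [bw [Db Cb]]].
  assert (O0 : nrm origin < R0) by (rewrite nrm_origin; exact PR).
  destruct (hd_unique a _ _ _ _ _ (Da origin O0) Ha) as [E11 E12].
  destruct (hd_unique b _ _ _ _ _ (Db origin O0) Hb) as [E21 E22].
  destruct (Ca origin O0) as [c1 c2]. destruct (Cb origin O0) as [c3 c4].
  exists (fun ka q => tgrad ka (vfield a b q) (Mat (az q) (aw q) (bz q) (bw q)) q), R0.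
  split; auto. split.
  - intros ka p Hp. apply (c1_tangency ka a b az aw bz bw R0); auto.
  - intros ka k p q Hc.
    pose proof (cluster_seq_to_0 _ _ _ Hc) as T0. pose proof (field_rescaled _ _ _ Hc) as T1.
    destruct Hc as [Hk [Hp T]].
    set (D := fun n => Mat (az (p n)) (aw (p n)) (bz (p n)) (bw (p n))).
    assert (T2 : tends (fun n => tgrad ka (vscal (RtoC (/ r (k n))) (vfield a b (p n))) (D n) (vscal (RtoC (/ r (k n))) (p n))) (tgrad ka (mv L q) L q)).
    { apply tends_tgrad; auto; unfold D; simpl.
      - rewrite <- E11. now apply cont2_tends.
      - rewrite <- E12. now apply cont2_tends.
      - rewrite <- E21. now apply cont2_tends.
      - rewrite <- E22. now apply cont2_tends. }
    intros eps He. destruct (T2 eps He) as [N HN]. exists N. intros n Hn. specialize (HN n Hn).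
    match type of HN with nrm (vsub ?X _) < _ => match goal with |- nrm (vsub ?Y _) < _ => replace Y with X end end; auto.
    unfold tgrad. rewrite mv_vscal. c2ring.
Qed.

(** Rigidity of the loci gives dependent gradients at the points [p n], and dependence passes to the
    limit: [q] and [tgrad ka (mv L q) L q] are the limit gradients of the sphere and of the real
    part of [ka] times the tangency equation. *)
Lemma dependence_at_cluster : forall k p q ka F G (s : nat -> R) g, cluster_seq k p q ->
  (exists R0, 0 < R0 /\ forall x, nrm x < R0 -> c1_at F G x) ->
  (forall n, local_min_on (tang a b (r (k n))) F (p n)) ->
  (forall n, s n <> 0) -> tends (fun n => vscal (RtoC (s n)) (G (p n))) g ->
  dep3 q (tgrad ka (mv L q) L q) g.
Proof.
  intros k p q ka F G s g Hc [R1 [PR1 CF]] MF Hs Tg.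
  destruct tangency_gradient as [GT [R0 [PR0 [CT TT]]]].
  pose proof (cluster_seq_to_0 _ _ _ Hc) as T0. specialize (TT ka _ _ _ Hc).
  pose proof Hc as [Hk [Hp T]].
  destruct (T0 (Rmin R0 R1)) as [N0 HN0]; [now apply Rmin_glb_lt|].
  set (sh := fun n => (n + N0)%nat). assert (Hsh : extraction sh) by (intros n; unfold sh; lia).
  apply (dep3_closed _ _ _ _ _ _ (tends_extraction _ _ sh T Hsh) (tends_extraction _ _ sh TT Hsh) (tends_extraction _ _ sh Tg Hsh)).
  intros n. set (m := sh n). pose proof (radius_pos (k m)) as P. pose proof (Rinv_0_lt_compat _ P) as P'.
  assert (Hpm : nrm (p m) < Rmin R0 R1).
  { replace (p m) with (vsub (p m) origin) by c2ring. apply HN0. unfold m, sh. lia. }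
  pose proof (Rmin_l R0 R1). pose proof (Rmin_r R0 R1).
  replace (vscal (RtoC (/ r (k m))) (p m)) with (vscal (RtoC (/ r (k m) / 2)) (vscal (RtoC 2) (p m))).
  2:{ transitivity (vscal (RtoC (/ r (k m) / 2 * 2)) (p m)); [rewrite RtoC_mult; c2ring|]. f_equal. f_equal. field. lra. }
  apply dep3_rescale; auto; try lra.
  destruct H as [_ [_ [_ [_ [_ [_ [_ [_ [_ Hrig]]]]]]]]].
  apply (Hrig (k m) (p m) (fun q => ip q q) (fun x => fst (ka * hermitian (vfield a b x) x)%C) F
    (fun q => vscal (RtoC 2) q) (GT ka) G); auto.
  - apply c1_sqnorm.
  - apply CT. lra.
  - apply CF. lra.
  - exists 1. split; [lra|]. intros x Hx _. rewrite !ip_self. destruct Hx as [E _]. destruct (Hp m) as [E' _]. lra.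
  - exists 1. split; [lra|]. intros x Hx _. destruct Hx as [_ E]. destruct (Hp m) as [_ E']. rewrite E, E'. lra.
Qed.

(** Minimisers supply the third function, besides the two equations of the locus, to which rigidity
    is applied. *)
Lemma minimisers : forall F k, extraction k -> (forall q, contR F q) -> exists sigma p, extraction sigma /\
  forall n, tang a b (r (k (sigma n))) (p n) /\ forall q, tang a b (r (k (sigma n))) q -> F (p n) <= F q.
Proof.
  intros F k Hk HF.
  destruct H as [[R0 [PR [hA hB]]] [a0 [b0 [Ha [Hb [_ [Hr [_ [Hne _]]]]]]]]].
  destruct (radius_to_0 k Hk (R0 / 2)) as [N HN]; [lra|].
  assert (S : forall n : nat, exists p, tang a b (r (k (n + N)%nat)) p /\ forall q, tang a b (r (k (n + N)%nat)) q -> F p <= F q).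
  { intros n. set (rho := r (k (n + N)%nat)).
    assert (Prho : 0 < rho) by apply Hr.
    assert (Hrho : rho < R0 / 2) by (apply HN; lia).
    apply (minimum_attained (tang a b rho) F (2 * rho)); [|intros q [E _]; apply nrm_le_2; auto; lra|apply Hne|auto].
    - intros u l Hu T.
      assert (El : sqn l = rho ^ 2).
      { apply RtoC_inj. rewrite <- hermitian_self. apply (ctends_unique (fun n => hermitian (u n) (u n))).
        - now apply ctends_hermitian.
        - intros eps He. exists 0%nat. intros m _. destruct (Hu m) as [E _]. rewrite hermitian_self, E.
          match goal with |- Cmod ?X < _ => replace X with (RtoC 0) by ring end. now rewrite Cmod_0. }
      split; auto.
      assert (Nl : nrm l < R0) by (pose proof (nrm_le_2 l rho); lra).
      destruct (hA l Nl) as [c1 [d1 K1]]. destruct (hB l Nl) as [c2 [d2 K2]].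
      apply (ctends_unique (fun n => hermitian (vfield a b (u n)) (u n))).
      + apply ctends_hermitian; auto. apply tends_pair; unfold vfield; simpl; apply cont2_tends; auto; eapply hd_cont; eauto.
      + intros eps He. exists 0%nat. intros m _. destruct (Hu m) as [_ E]. rewrite E.
        match goal with |- Cmod ?X < _ => replace X with (RtoC 0) by ring end. now rewrite Cmod_0. }
  destruct (choice_function _ _ _ S) as [p Hp]. exists (fun n => (n + N)%nat), p. split; [intros n; lia|exact Hp].
Qed.

End Rescaling.

(** * Unitary normalisation of the linear part *)

Lemma hd_mv : forall F M p al be, hd F (mv M p) al be ->
  hd (fun q => F (mv M q)) p (al * m11 M + be * m21 M)%C (al * m12 M + be * m22 M)%C.
Proof.
  intros F M p al be K.
  exact (hd_comp F (lin (m11 M) (m12 M)) (lin (m21 M) (m22 M)) p al be _ _ _ _ (hd_lin _ _ _) (hd_lin _ _ _) K).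
Qed.

Lemma rd_mv : forall F M p G, rd F (mv M p) G -> rd (fun q => F (mv M q)) p (mv (adj M) G).
Proof.
  intros F M p G K eps He. destruct (mv_bound M) as [B [PB HB]].
  destruct (K (eps / B)) as [d [Hd K1]]; [now apply Rdiv_lt_0_compat|].
  exists (d / B). split; [now apply Rdiv_lt_0_compat|]. intros h Hh.
  apply Rmult_lt_compat_l with (r := B) in Hh; auto. replace (B * (d / B)) with d in Hh by (field; lra).
  specialize (HB h). specialize (K1 (mv M h) ltac:(lra)).
  rewrite mv_vadd. replace (ip (mv (adj M) G) h) with (ip G (mv M h)) by (rewrite !ip_hermitian; now rewrite hermitian_adj).
  eapply Rle_trans; [exact K1|].
  apply Rle_trans with (eps / B * (B * nrm h)).
  - apply Rmult_le_compat_l; auto. left. now apply Rdiv_lt_0_compat.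
  - right. field. lra.
Qed.

Lemma mv_continuous : forall M p eps, 0 < eps -> exists d, 0 < d /\ forall q, nrm (vsub q p) < d -> nrm (vsub (mv M q) (mv M p)) < eps.
Proof.
  intros M p eps He. destruct (mv_bound M) as [B [PB HB]].
  exists (eps / B). split; [now apply Rdiv_lt_0_compat|]. intros q Hq. rewrite <- mv_vsub.
  eapply Rle_lt_trans; [apply HB|]. apply Rmult_lt_compat_l with (r := B) in Hq; auto.
  replace (B * (eps / B)) with eps in Hq by (field; lra). exact Hq.
Qed.

Lemma c1_mv : forall F G M p, c1_at F G (mv M p) -> c1_at (fun q => F (mv M q)) (fun q => mv (adj M) (G (mv M q))) p.
Proof.
  intros F G M p [[d [Hd K]] C]. split.
  - destruct (mv_continuous M p d Hd) as [d' [Hd' K']]. exists d'. split; auto. intros q Hq. apply rd_mv. auto.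
  - apply cont_vec_seq. intros u Hu. apply tends_mv. apply (cont_vec_tends G (mv M p)); auto. now apply tends_mv.
Qed.

Lemma dep3_mv : forall M u v w, dep3 u v w -> dep3 (mv M u) (mv M v) (mv M w).
Proof.
  intros M u v w [a [b [c [N E]]]]. exists a, b, c. split; auto.
  rewrite <- !mv_vscal, <- !mv_vadd, E. apply mv_origin.
Qed.

Lemma rigid_unitary : forall B M, munitary B -> rigid M -> rigid (fun q => M (mv (adj B) q)).
Proof.
  intros B M [U1 U2] HM p F1 F2 F3 G1 G2 G3 Mp C1 C2' C3 L1 L2 L3.
  assert (E : mv B (mv (adj B) p) = p) by apply U1.
  assert (HC : forall F G, c1_at F G p -> c1_at (fun q => F (mv B q)) (fun q => mv (adj B) (G (mv B q))) (mv (adj B) p)).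
  { intros F G K. apply c1_mv. now rewrite E. }
  assert (HL : forall F, local_min_on (fun q => M (mv (adj B) q)) F p -> local_min_on M (fun q => F (mv B q)) (mv (adj B) p)).
  { intros F [d [Hd K]]. destruct (mv_continuous B (mv (adj B) p) d Hd) as [d' [Hd' K']].
    exists d'. split; auto. intros q Mq Hq. rewrite E. apply K.
    - now rewrite U2.
    - rewrite <- E. auto. }
  pose proof (HM (mv (adj B) p) _ _ _ _ _ _ Mp (HC _ _ C1) (HC _ _ C2') (HC _ _ C3) (HL _ L1) (HL _ L2) (HL _ L3)) as D.
  cbv beta in D. rewrite E in D. apply (dep3_mv B) in D. now rewrite !U1 in D.
Qed.

(** The foliation is the same, read in coordinates rotated by [B]; the factor [k] only changes the
    field that generates it. *)
Definition conjugate_fields (a b a' b' : C2 -> C) (B : mat) (k : C) : Prop :=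
  munitary B /\ k <> RtoC 0 /\
  forall q, vfield a' b' q = vscal k (mv B (vfield a b (mv (adj B) q))).

Lemma conjugate_trans : forall a b a' b' a'' b'' B k B' k',
  conjugate_fields a b a' b' B k -> conjugate_fields a' b' a'' b'' B' k' ->
  conjugate_fields a b a'' b'' (mmul B' B) (k' * k)%C.
Proof.
  intros a b a' b' a'' b'' B k B' k' [U [N E]] [U' [N' E']].
  split; [now apply munitary_mmul|]. split; [now apply Cmult_neq_0|].
  intros q. rewrite E', E, adj_mmul, !mv_mmul, mv_vscal. c2ring.
Qed.

Lemma tang_conjugate : forall a b a' b' B k rho q, conjugate_fields a b a' b' B k ->
  (tang a' b' rho q <-> tang a b rho (mv (adj B) q)).
Proof.
  intros a b a' b' B k rho q [U [N E]]. unfold tang.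
  rewrite (sqn_unitary (adj B)) by now apply munitary_adj. rewrite E.
  assert (X : hermitian (vscal k (mv B (vfield a b (mv (adj B) q)))) q =
    (k * hermitian (vfield a b (mv (adj B) q)) (mv (adj B) q))%C).
  { rewrite <- mv_vscal, hermitian_adj. unfold hermitian, vscal. simpl. ring. }
  rewrite X. split; intros [S T]; split; auto.
  - destruct (Ceq_dec (hermitian (vfield a b (mv (adj B) q)) (mv (adj B) q)) (RtoC 0)) as [h|h]; auto.
    exfalso. exact (Cmult_neq_0 _ _ N h T).
  - rewrite T. ring.
Qed.

Lemma mdet_mmul : forall m n, mdet (mmul m n) = (mdet m * mdet n)%C.
Proof. intros m n. unfold mdet, mmul. simpl. ring. Qed.

Lemma unitary_det : forall B, munitary B -> mdet B <> RtoC 0.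
Proof.
  intros B [U _] Z.
  assert (E : mdet (mmul B (adj B)) = RtoC 1).
  { assert (X1 := U (RtoC 1, RtoC 0)). assert (X2 := U (RtoC 0, RtoC 1)).
    rewrite <- mv_mmul in X1, X2. set (m := mmul B (adj B)) in *. clearbody m. unfold mv, lin in X1, X2. simpl in X1, X2.
    injection X1 as Y1 Y2. injection X2 as Y3 Y4. unfold mdet.
    assert (A : m11 m = RtoC 1 /\ m21 m = RtoC 0 /\ m12 m = RtoC 0 /\ m22 m = RtoC 1).
    { repeat split.
      - transitivity (m11 m * 1 + m12 m * 0)%C; [ring|]. apply injective_projections; assumption.
      - transitivity (m21 m * 1 + m22 m * 0)%C; [ring|]. apply injective_projections; assumption.
      - transitivity (m11 m * 0 + m12 m * 1)%C; [ring|]. apply injective_projections; assumption.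
      - transitivity (m21 m * 0 + m22 m * 1)%C; [ring|]. apply injective_projections; assumption. }
    destruct A as [-> [-> [-> ->]]]. ring. }
  rewrite mdet_mmul, Z in E. apply C1_nz. rewrite <- E. ring.
Qed.

Lemma tangency_surfaces_conjugate : forall a b L r B k, tangency_surfaces a b L r -> munitary B -> k <> RtoC 0 ->
  exists a' b', conjugate_fields a b a' b' B k /\
    tangency_surfaces a' b' (mscal k (mmul B (mmul L (adj B)))) r.
Proof.
  intros a b L r B k HT U N.
  set (a' := fun q => (k * lin (m11 B) (m12 B) (vfield a b (mv (adj B) q)))%C).
  set (b' := fun q => (k * lin (m21 B) (m22 B) (vfield a b (mv (adj B) q)))%C).
  assert (Cj : conjugate_fields a b a' b' B k) by (split; [|split]; auto).
  exists a', b'. split; auto.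
  destruct HT as [[R0 [PR [hA hB]]] [a0 [b0 [Ha [Hb [Hd [Hr1 [Hr2 [Hn Hg]]]]]]]]].
  assert (Comb : forall x y p a1 a2 b1 b2, hd a (mv (adj B) p) a1 a2 -> hd b (mv (adj B) p) b1 b2 ->
    hd (fun q => k * lin x y (vfield a b (mv (adj B) q)))%C p
      (k * (x * (a1 * m11 (adj B) + a2 * m21 (adj B)) + y * (b1 * m11 (adj B) + b2 * m21 (adj B))))%C
      (k * (x * (a1 * m12 (adj B) + a2 * m22 (adj B)) + y * (b1 * m12 (adj B) + b2 * m22 (adj B))))%C).
  { intros x y p a1 a2 b1 b2 K1 K2. unfold lin, vfield. cbn [fst snd].
    apply hd_scal, hd_plus; apply hd_scal; apply hd_mv; assumption. }
  assert (Hol : forall x y, hol (fun q => k * lin x y (vfield a b (mv (adj B) q)))%C (R0 / 2)).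
  { intros x y q Hq. pose proof (nrm_unitary (adj B) q (munitary_adj _ U)) as Q.
    destruct (hA (mv (adj B) q)) as [a1 [a2 K1]]; [lra|]. destruct (hB (mv (adj B) q)) as [b1 [b2 K2]]; [lra|].
    do 2 eexists. apply Comb; eassumption. }
  assert (Z : mv (adj B) origin = origin) by apply mv_origin.
  rewrite <- Z in Ha, Hb.
  unfold tangency_surfaces.
  split; [exists (R0 / 2); split; [lra|split; apply Hol]|].
  split; [unfold a', lin, vfield; rewrite Z; simpl; rewrite a0, b0; ring|].
  split; [unfold b', lin, vfield; rewrite Z; simpl; rewrite a0, b0; ring|].
  split; [eapply hd_eq; [| |exact (Comb (m11 B) (m12 B) origin _ _ _ _ Ha Hb)]; simpl; ring|].
  split; [eapply hd_eq; [| |exact (Comb (m21 B) (m22 B) origin _ _ _ _ Ha Hb)]; simpl; ring|].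
  split.
  { replace (mdet (mscal k (mmul B (mmul L (adj B))))) with (k * k * (mdet B * (mdet L * mdet (adj B))))%C.
    - repeat apply Cmult_neq_0; auto; apply unitary_det; auto. now apply munitary_adj.
    - unfold mdet, mscal, mmul. simpl. ring. }
  split; auto. split; auto. split.
  - intros j. destruct (Hn j) as [q Hq]. exists (mv B q). apply (tang_conjugate a b a' b' B k); auto.
    destruct U as [_ U2]. now rewrite U2.
  - intros j. pose proof (rigid_unitary B _ U (Hg j)) as R. intros p F1 F2 F3 G1 G2 G3 Mp C1 C2' C3 L1 L2 L3.
    apply (R p F1 F2 F3 G1 G2 G3); auto.
    + now apply (tang_conjugate a b a' b' B k).
    + destruct L1 as [d [Hd' K]]. exists d. split; auto. intros q Hq. apply K. now apply (tang_conjugate a b a' b' B k).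
    + destruct L2 as [d [Hd' K]]. exists d. split; auto. intros q Hq. apply K. now apply (tang_conjugate a b a' b' B k).
    + destruct L3 as [d [Hd' K]]. exists d. split; auto. intros q Hq. apply K. now apply (tang_conjugate a b a' b' B k).
Qed.

Lemma cluster_conjugate : forall a b a' b' B k r q, conjugate_fields a b a' b' B k ->
  cluster a b r q -> cluster a' b' r (mv B q).
Proof.
  intros a b a' b' B k r q Cj [ks [p [Hk [Hp T]]]]. exists ks, (fun n => mv B (p n)).
  split; auto. split.
  - intros n. apply (tang_conjugate a b a' b' B k); auto. destruct Cj as [[_ U] _]. rewrite U. apply Hp.
  - apply (tends_mv B) in T. intros eps He. destruct (T eps He) as [N HN]. exists N. intros n Hn.
    rewrite <- mv_vscal. auto.
Qed.

Definition e1 : C2 := (RtoC 1, RtoC 0).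

Ltac c2field := apply C2_eq; unfold mv, lin, adj, vadd, vscal, vsub, origin; simpl.

Lemma conj_of_real : forall x : R, Cconj (RtoC x) = RtoC x.
Proof. intros x. unfold Cconj, RtoC. simpl. f_equal. ring. Qed.

Lemma mul_conj : forall z, (z * Cconj z)%C = RtoC (Cmod z ^ 2).
Proof. intros z. rewrite RtoC_pow. symmetry. rewrite <- RtoC_pow. apply Cmod2_conj. Qed.

Lemma rotate_to_e1 : forall q, sqn q = 1 -> exists B, munitary B /\ mv B q = e1.
Proof.
  intros [x y] Hq. unfold sqn in Hq. simpl fst in Hq. simpl snd in Hq.
  assert (E : (x * Cconj x + y * Cconj y)%C = RtoC 1).
  { rewrite !mul_conj, <- RtoC_plus. now f_equal. }
  exists (Mat (Cconj x) (Cconj y) (- y)%C x). split; [split|].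
  - intros [z w]. c2field; rewrite ?Copp_conj, ?Cconj_conj.
    + transitivity ((x * Cconj x + y * Cconj y) * z)%C; [ring|rewrite E; ring].
    + transitivity ((x * Cconj x + y * Cconj y) * w)%C; [ring|rewrite E; ring].
  - intros [z w]. c2field; rewrite ?Copp_conj, ?Cconj_conj.
    + transitivity ((x * Cconj x + y * Cconj y) * z)%C; [ring|rewrite E; ring].
    + transitivity ((x * Cconj x + y * Cconj y) * w)%C; [ring|rewrite E; ring].
  - unfold e1. c2field; [rewrite <- E|]; ring.
Qed.

(** The argument of [1 + z] is half that of [z]. *)
Lemma unimodular_sqrt : forall z, Cmod z = 1 -> exists u, Cmod u = 1 /\ (u * u)%C = z.
Proof.
  intros z Hz. destruct (Ceq_dec (1 + z)%C (RtoC 0)) as [E|E].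
  - exists Ci. split; [apply Cmod_Ci|]. transitivity (- (1))%C.
    + apply injective_projections; simpl; ring.
    + transitivity (z - (1 + z))%C; [ring|rewrite E; ring].
  - pose proof (proj1 (Cmod_gt_0 _) E) as P. set (m := Cmod (1 + z)%C) in *.
    assert (Nm : RtoC m <> RtoC 0) by (intros h; apply RtoC_inj in h; lra).
    exists ((1 + z) / RtoC m)%C. split.
    + rewrite Cmod_div, Cmod_RtoC_pos by (auto; lra). fold m. field. lra.
    + assert (Zz : (z * Cconj z)%C = RtoC 1) by (rewrite mul_conj, Hz; f_equal; ring).
      assert (Em : (RtoC m * RtoC m)%C = ((1 + z) * (1 + Cconj z))%C).
      { rewrite <- RtoC_mult. replace (m * m) with (m ^ 2) by ring. unfold m. rewrite <- mul_conj, Cplus_conj, (conj_of_real 1). reflexivity. }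
      assert (Nc : (1 + Cconj z)%C <> RtoC 0).
      { intros h. rewrite h in Em. apply (Cmult_neq_0 _ _ Nm Nm). rewrite Em. ring. }
      transitivity ((1 + z) * (1 + z) / (RtoC m * RtoC m))%C; [field; auto|]. rewrite Em.
      transitivity ((1 + z) / (1 + Cconj z))%C; [field; auto|].
      assert (Q : (1 + z)%C = (z * (1 + Cconj z))%C) by (transitivity (z + z * Cconj z)%C; [rewrite Zz|]; ring).
      rewrite Q. field. auto.
Qed.

(** If the off-diagonal entries had different moduli, [Re h], [Im h] and [|q|^2] would have
    independent gradients: the locus would be a curve near the cluster point. *)
Lemma cluster_e1_linear_part : forall a b L r, tangency_surfaces a b L r -> cluster a b r e1 ->
  m11 L = RtoC 0 /\ Cmod (m12 L) = Cmod (m21 L).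
Proof.
  intros a b L r HT Hc.
  assert (E11 : m11 L = RtoC 0).
  { pose proof (cluster_tangent a b L r HT e1 Hc) as E. rewrite <- E.
    unfold hermitian, mv, lin, e1. simpl. rewrite (conj_of_real 1), (conj_of_real 0). ring. }
  split; auto.
  destruct Hc as [k [p Hc]].
  destruct (tangency_gradient a b L r HT) as [G [R0 [PR [CG TG]]]].
  assert (D : dep3 e1 (tgrad (RtoC 1) (mv L e1) L e1) (tgrad (- Ci)%C (mv L e1) L e1)).
  { (* [Re (- i h) = Im h] *)
    apply (dependence_at_cluster a b L r HT k p e1 (RtoC 1) (fun x => fst (- Ci * hermitian (vfield a b x) x)%C) (G (- Ci)%C) (fun n => / r (k n))); auto.
    - exists R0. auto.
    - intros n. exists 1. split; [lra|]. intros x [_ Ex] _. destruct Hc as [_ [Hp _]]. destruct (Hp n) as [_ Ep]. rewrite Ex, Ep. lra.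
    - intros n. apply Rinv_neq_0_compat. pose proof (radius_pos a b L r HT (k n)). lra. }
  destruct D as [x [y [z [Nxyz E]]]].
  assert (E1 := f_equal fst E). assert (E2 := f_equal snd E). clear E.
  unfold tgrad, mv, lin, adj, vadd, vscal, e1, origin in E1, E2. simpl in E1, E2. rewrite E11 in E1.
  assert (K0 := conj_of_real 0). assert (K1 := conj_of_real 1). rewrite K1 in E1, E2. rewrite Copp_conj in E1, E2. rewrite K0 in E1.
  assert (Cci : Cconj Ci = (- Ci)%C) by (apply injective_projections; simpl; ring).
  rewrite Cci in E1, E2.
  assert (X0 : RtoC x = RtoC 0) by (rewrite <- E1; ring). apply RtoC_inj in X0.
  set (w := (RtoC y - Ci * RtoC z)%C).
  assert (E3 : (w * m21 L + Cconj w * Cconj (m12 L))%C = RtoC 0).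
  { unfold w. rewrite Cminus_conj, Cmult_conj, !conj_of_real, Cci. rewrite <- E2. ring. }
  assert (Nw : w <> RtoC 0).
  { intros h. apply Nxyz. assert (h1 := f_equal fst h). assert (h2 := f_equal snd h). unfold w in h1, h2. simpl in h1, h2.
    repeat split; lra. }
  assert (E4 : (w * m21 L)%C = (- (Cconj w * Cconj (m12 L)))%C).
  { transitivity ((w * m21 L + Cconj w * Cconj (m12 L)) - Cconj w * Cconj (m12 L))%C; [ring|rewrite E3; ring]. }
  apply (f_equal Cmod) in E4. rewrite Cmod_opp, !Cmod_mult, !Cmod_conj in E4.
  apply Rmult_eq_reg_l with (Cmod w); [auto|]. apply Cmod_gt_0 in Nw. lra.
Qed.

(** Rotating the second axis by [u] multiplies the off-diagonal entries by [u] and its conjugate;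
    having equal moduli they can be made equal, and then divided out of the field. *)
Lemma normalise_off_diagonal : forall a b L r, tangency_surfaces a b L r -> cluster a b r e1 ->
  exists a' b' B k d, conjugate_fields a b a' b' B k /\ tangency_surfaces a' b' (Mat (RtoC 0) (RtoC 1) (RtoC 1) d) r.
Proof.
  intros a b L r HT Hc. destruct (cluster_e1_linear_part a b L r HT Hc) as [E11 Em].
  assert (Hd : mdet L <> RtoC 0) by apply HT.
  assert (N12 : m12 L <> RtoC 0).
  { intros h. apply Hd. unfold mdet. rewrite E11, h. ring. }
  assert (N21 : m21 L <> RtoC 0).
  { intros h. apply Hd. unfold mdet. rewrite E11, h. ring. }
  assert (P : 0 < Cmod (m12 L)) by now apply Cmod_gt_0.
  destruct (unimodular_sqrt (m12 L / m21 L)%C) as [u [U1 U2]].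
  { rewrite Cmod_div by auto. rewrite <- Em. field. lra. }
  assert (Nu : u <> RtoC 0) by (apply Cmod_gt_0; lra).
  assert (Uc : (u * Cconj u)%C = RtoC 1) by (rewrite mul_conj, U1; f_equal; ring).
  set (B := Mat (RtoC 1) (RtoC 0) (RtoC 0) u).
  assert (UB : munitary B).
  { split; intros [z w]; unfold B; c2field; rewrite ?(conj_of_real 0), ?(conj_of_real 1); try ring.
    - transitivity ((u * Cconj u) * w)%C; [ring|rewrite Uc; ring].
    - transitivity ((u * Cconj u) * w)%C; [ring|rewrite Uc; ring]. }
  set (be := (u * m21 L)%C).
  assert (Nb : be <> RtoC 0) by now apply Cmult_neq_0.
  assert (Eb : (m12 L * Cconj u)%C = be).
  { unfold be. transitivity ((m12 L / m21 L) * m21 L * Cconj u)%C; [field; auto|]. rewrite <- U2.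
    transitivity (u * m21 L * (u * Cconj u))%C; [ring|rewrite Uc; ring]. }
  assert (Nk : (/ be)%C <> RtoC 0).
  { intros h. apply C1_nz. rewrite <- (Cinv_r be Nb), h. ring. }
  destruct (tangency_surfaces_conjugate a b L r B (/ be)%C HT UB Nk) as [a' [b' [Cj T]]].
  exists a', b', B, (/ be)%C, (m22 L / be)%C. split; auto.
  replace (Mat (RtoC 0) (RtoC 1) (RtoC 1) (m22 L / be)%C) with (mscal (/ be) (mmul B (mmul L (adj B)))); auto.
  unfold mscal, mmul, adj, B. simpl. rewrite !(conj_of_real 0), !(conj_of_real 1), E11. f_equal.
  - ring.
  - transitivity (/ be * (m12 L * Cconj u))%C; [ring|]. rewrite Eb. field. auto.
  - transitivity (/ be * (u * m21 L))%C; [ring|]. fold be. field. auto.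
  - transitivity (m22 L * / be * (u * Cconj u))%C; [ring|rewrite Uc; unfold Cdiv; ring].
Qed.

(** [Im (conj z * w)], which near the circle [w = 0] measures one of the two directions
    transverse to that circle in the sphere. *)
Definition twist (q : C2) : R := fst (fst q) * snd (snd q) - snd (fst q) * fst (snd q).
Definition twist_grad (q : C2) : C2 := ((- Ci * snd q)%C, (Ci * fst q)%C).

Lemma c1_twist : forall p, c1_at twist twist_grad p.
Proof.
  intros p. split.
  - exists 1. split; [lra|]. intros q _ eps He. exists eps. split; auto. intros h Hh.
    replace (twist (vadd q h) - twist q - ip (twist_grad q) h) with (fst (fst h) * snd (snd h) - snd (fst h) * fst (snd h))
      by (unfold twist, twist_grad, ip; simpl; ring).
    replace (fst (fst h) * snd (snd h) - snd (fst h) * fst (snd h)) with (snd (Cconj (fst h) * snd h)%C) by (simpl; ring).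
    eapply Rle_trans; [apply Rabs_Im_le|]. rewrite Cmod_mult, Cmod_conj.
    pose proof (Cmod_fst_nrm h). pose proof (Cmod_snd_nrm h). pose proof (Cmod_ge_0 (fst h)). pose proof (Cmod_ge_0 (snd h)). nra.
  - apply cont_vec_seq. intros u Hu. apply tends_pair; simpl; apply ctends_mult; try exact (ctends_const _);
    auto using ctends_fst, ctends_snd.
Qed.

(** When [d] is not real the rescaled loci shrink to the circle [w = 0].  At a minimum of
    [twist] on such a locus the three gradients would be independent. *)
Lemma second_diagonal_entry_real : forall a b d r,
  tangency_surfaces a b (Mat (RtoC 0) (RtoC 1) (RtoC 1) d) r -> snd d = 0.
Proof.
  intros a b d r HT. destruct (Req_dec (snd d) 0) as [E|Nd]; auto. exfalso.
  assert (Ct : forall q, contR twist q).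
  { intros q. destruct (c1_twist q) as [[e [He K]] _]. eapply rd_cont. apply K.
    now rewrite vsub_diag, nrm_origin. }
  destruct (minimisers a b _ r HT twist (fun n => n) (fun n => le_n n) Ct) as [sg [p [Hs Hp]]].
  destruct (cluster_extract a b _ r HT sg p Hs (fun n => proj1 (Hp n))) as [phi [q [Hphi Hc]]].
  assert (Cl : cluster a b r q) by (eexists; eexists; exact Hc).
  pose proof (cluster_unit a b _ r HT q Cl) as Uq.
  pose proof (cluster_tangent a b _ r HT q Cl) as Tq.
  destruct q as [z w].
  assert (W0 : w = RtoC 0).
  { assert (S := f_equal snd Tq). unfold hermitian, mv, lin in S. simpl in S.
    assert (S2 : snd d * (fst w ^ 2 + snd w ^ 2) = 0) by (rewrite <- S; ring).
    apply Rmult_integral in S2. destruct S2 as [S2|S2]; [contradiction|].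
    apply Cmod_eq_0. pose proof (Cmod_sqr w). pose proof (Cmod_ge_0 w). nra. }
  subst w.
  assert (Uz : Cmod z = 1).
  { unfold sqn in Uq. simpl fst in Uq. simpl snd in Uq. rewrite Cmod_0 in Uq. pose proof (Cmod_ge_0 z). nra. }
  assert (Nz : z <> RtoC 0) by (apply Cmod_gt_0; lra).
  assert (D : dep3 (z, RtoC 0) (tgrad (RtoC 1) (mv (Mat (RtoC 0) (RtoC 1) (RtoC 1) d) (z, RtoC 0)) (Mat (RtoC 0) (RtoC 1) (RtoC 1) d) (z, RtoC 0))
     (twist_grad (z, RtoC 0))).
  { apply (dependence_at_cluster a b _ r HT _ _ _ (RtoC 1) twist twist_grad (fun n => / r (sg (phi n))) _ Hc).
    - exists 1. split; [lra|]. intros x _. apply c1_twist.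
    - intros n. exists 1. split; [lra|]. intros x Hx _. apply Hp. exact Hx.
    - intros n. apply Rinv_neq_0_compat. pose proof (radius_pos a b _ r HT (sg (phi n))). lra.
    - destruct Hc as [_ [_ T]].
      assert (T2 : tends (fun n => twist_grad (vscal (RtoC (/ r (sg (phi n)))) (p (phi n)))) (twist_grad (z, RtoC 0)))
        by (apply (cont_vec_tends _ _ _ (proj2 (c1_twist (z, RtoC 0))) T)).
      intros eps He. destruct (T2 eps He) as [N HN]. exists N. intros n Hn. specialize (HN n Hn).
      match type of HN with nrm (vsub ?X _) < _ => match goal with |- nrm (vsub ?Y _) < _ => replace Y with X end end; auto.
      unfold twist_grad. c2ring. }
  destruct D as [x [y [t [Nxyt E]]]].
  assert (E1 := f_equal fst E). assert (E2 := f_equal snd E). clear E.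
  assert (K0 := conj_of_real 0). assert (K1 := conj_of_real 1).
  unfold tgrad, twist_grad, mv, lin, adj, vadd, vscal, origin in E1, E2.
  cbn [fst snd m11 m12 m21 m22] in E1, E2. rewrite K0, K1 in E1. rewrite K1 in E2.
  assert (X : (RtoC x * z)%C = RtoC 0) by (rewrite <- E1; ring).
  assert (Y : ((RtoC (2 * y) + RtoC t * Ci) * z)%C = RtoC 0).
  { rewrite <- E2. rewrite RtoC_mult. replace (RtoC 2) with (1 + 1)%C by (apply injective_projections; simpl; ring). ring. }
  apply Nxyt.
  assert (x0 : x = 0).
  { apply RtoC_inj. destruct (Ceq_dec (RtoC x) (RtoC 0)) as [h|h]; auto. exfalso. exact (Cmult_neq_0 _ _ h Nz X). }
  assert (y0 : (RtoC (2 * y) + RtoC t * Ci)%C = RtoC 0).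
  { destruct (Ceq_dec (RtoC (2 * y) + RtoC t * Ci)%C (RtoC 0)) as [h|h]; auto. exfalso. exact (Cmult_neq_0 _ _ h Nz Y). }
  assert (F1 := f_equal fst y0). assert (F2 := f_equal snd y0). simpl in F1, F2. repeat split; lra.
Qed.

(** Once [d] is real the linear part is a real symmetric matrix of determinant -1, hence has a
    positive and a negative eigenvalue and orthogonal eigenvectors. *)
Lemma diagonalise : forall a b d r, tangency_surfaces a b (Mat (RtoC 0) (RtoC 1) (RtoC 1) d) r ->
  exists a' b' B l, conjugate_fields a b a' b' B (RtoC 1) /\ 0 < l /\
    tangency_surfaces a' b' (Mat (RtoC l) (RtoC 0) (RtoC 0) (RtoC (- / l))) r.
Proof.
  intros a b d r HT. pose proof (second_diagonal_entry_real a b d r HT) as Ed.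
  set (dr := fst d). assert (Edr : d = RtoC dr) by (apply injective_projections; simpl; auto).
  (* l is the positive eigenvalue, with eigenvector (1, l); the other one is - / l *)
  set (l := (dr + sqrt (dr ^ 2 + 4)) / 2).
  assert (Sq : sqrt (dr ^ 2 + 4) ^ 2 = dr ^ 2 + 4) by (rewrite pow2_sqrt; [reflexivity|nra]).
  assert (Ps : 0 < sqrt (dr ^ 2 + 4)) by (apply sqrt_lt_R0; nra).
  assert (Pl : 0 < l) by (unfold l; nra).
  assert (El : l ^ 2 = 1 + dr * l) by (unfold l; nra).
  set (c := / sqrt (1 + l ^ 2)).
  assert (Pq : 0 < sqrt (1 + l ^ 2)) by (apply sqrt_lt_R0; nra).
  assert (Ec : c ^ 2 * (1 + l ^ 2) = 1).
  { unfold c. rewrite <- (pow2_sqrt (1 + l ^ 2)) at 2 by nra. field. lra. }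
  set (B := Mat (RtoC c) (RtoC (c * l)) (RtoC (c * l)) (RtoC (- c))).
  assert (AB : adj B = B) by (unfold adj, B; simpl; now rewrite !conj_of_real).
  assert (BB : forall q, mv B (mv B q) = q).
  { intros q. c2field.
    - transitivity (RtoC (c ^ 2 * (1 + l ^ 2)) * fst q)%C; [|rewrite Ec; ring].
      apply injective_projections; simpl; ring.
    - transitivity (RtoC (c ^ 2 * (1 + l ^ 2)) * snd q)%C; [|rewrite Ec; ring].
      apply injective_projections; simpl; ring. }
  assert (UB : munitary B) by (split; intros q; rewrite AB; apply BB).
  destruct (tangency_surfaces_conjugate a b _ r B (RtoC 1) HT UB C1_nz) as [a' [b' [Cj T]]].
  exists a', b', B, l. split; auto. split; auto.
  match type of T with tangency_surfaces _ _ ?M _ => replace (Mat (RtoC l) (RtoC 0) (RtoC 0) (RtoC (- / l))) with M end; auto.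
  rewrite AB, Edr. unfold mscal, mmul, B. simpl.
  assert (Eil : / l = l - dr) by (apply Rmult_eq_reg_l with l; [rewrite Rinv_r by lra; nra|lra]).
  assert (Q : forall x y : R, x = y -> RtoC x = RtoC y) by (intros; now f_equal).
  f_equal.
  - transitivity (RtoC (c ^ 2 * (2 * l + dr * l ^ 2))).
    + apply injective_projections; simpl; ring.
    + apply Q. transitivity (c ^ 2 * (1 + l ^ 2) * l); [|rewrite Ec; ring].
      replace (2 * l + dr * l ^ 2) with (l * (1 + (1 + dr * l))) by ring. rewrite <- El. ring.
  - transitivity (RtoC (c ^ 2 * (l ^ 2 - (1 + dr * l)))).
    + apply injective_projections; simpl; ring.
    + apply Q. rewrite <- El. ring.
  - transitivity (RtoC (c ^ 2 * (l ^ 2 - (1 + dr * l)))).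
    + apply injective_projections; simpl; ring.
    + apply Q. rewrite <- El. ring.
  - transitivity (RtoC (c ^ 2 * (dr - 2 * l))).
    + apply injective_projections; simpl; ring.
    + apply Q. rewrite Eil. transitivity (c ^ 2 * (1 + l ^ 2) * (dr - l)); [|rewrite Ec; ring].
      replace (1 + l ^ 2) with (2 + dr * l) by lra. rewrite !Rmult_assoc. f_equal.
      replace ((2 + dr * l) * (dr - l)) with (2 * dr + dr * dr * l - 2 * l - dr * l ^ 2) by ring. rewrite El. ring.
Qed.

Lemma normal_form : forall a b L r, tangency_surfaces a b L r ->
  exists a' b' B k l, conjugate_fields a b a' b' B k /\ 0 < l /\
    tangency_surfaces a' b' (Mat (RtoC l) (RtoC 0) (RtoC 0) (RtoC (- / l))) r.
Proof.
  intros a b L r HT.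
  destruct (cluster_exists a b L r HT) as [q Hq].
  destruct (rotate_to_e1 q (cluster_unit a b L r HT q Hq)) as [B1 [U1 E1]].
  destruct (tangency_surfaces_conjugate a b L r B1 (RtoC 1) HT U1 C1_nz) as [a1 [b1 [C1 T1]]].
  pose proof (cluster_conjugate _ _ _ _ _ _ _ _ C1 Hq) as Q1. rewrite E1 in Q1.
  destruct (normalise_off_diagonal a1 b1 _ r T1 Q1) as [a2 [b2 [B2 [k2 [d [C2' T2]]]]]].
  destruct (diagonalise a2 b2 d r T2) as [a3 [b3 [B3 [l [C3 [Pl T3]]]]]].
  exists a3, b3. do 3 eexists. split; [|split; [exact Pl|exact T3]].
  eapply conjugate_trans; [|exact C3]. eapply conjugate_trans; [exact C1|exact C2'].
Qed.

(** * The tangency loci fill the Clifford torus *)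

Definition clifford (lam mu : R) (q : C2) : Prop :=
  Cmod (fst q) ^ 2 = mu / (lam + mu) /\ Cmod (snd q) ^ 2 = lam / (lam + mu).

Definition rot (s t : R) (q : C2) : C2 := ((cis s * fst q)%C, (cis t * snd q)%C).

Lemma cis_0 : cis 0 = RtoC 1.
Proof. unfold cis. rewrite cos_0, sin_0. reflexivity. Qed.

Lemma rot_add : forall s t s' t' q, rot (s + s') (t + t') q = rot s t (rot s' t' q).
Proof. intros. unfold rot. rewrite !cis_add. apply C2_eq; simpl; ring. Qed.

Lemma Re_mul_conj_cis : forall s z, fst (z * Cconj (cis s * z))%C = cos s * Cmod z ^ 2.
Proof. intros s z. rewrite Cmod_sqr. unfold cis. simpl. ring. Qed.

Definition dmat (lam mu : R) : mat := Mat (RtoC lam) (RtoC 0) (RtoC 0) (RtoC (- mu)).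

Lemma ip_tends : forall g u l, tends u l -> forall eps, 0 < eps -> exists N, forall n, (N <= n)%nat -> Rabs (ip g (u n) - ip g l) < eps.
Proof. intros g u l Hu. apply contR_tends; auto. eapply rd_cont, rd_ip. Qed.

Lemma ip_scal : forall g c q, ip g (vscal (RtoC c) q) = c * ip g q.
Proof. intros. unfold ip, vscal. simpl. ring. Qed.

Section Torus.

Variables (a b : C2 -> C) (lam mu : R) (r : nat -> R).
Hypothesis Plam : 0 < lam.
Hypothesis Pmu : 0 < mu.
Hypothesis H : tangency_surfaces a b (dmat lam mu) r.

Lemma cluster_clifford : forall q, cluster a b r q -> clifford lam mu q.
Proof.
  intros [z w] Hq. pose proof (cluster_unit _ _ _ _ H _ Hq) as U. pose proof (cluster_tangent _ _ _ _ H _ Hq) as T.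
  unfold sqn in U. unfold clifford. simpl fst in *. simpl snd in *.
  assert (E : lam * Cmod z ^ 2 - mu * Cmod w ^ 2 = 0).
  { assert (E := f_equal fst T). unfold hermitian, mv, dmat, lin in E. rewrite !Cmod_sqr. simpl in E. rewrite <- E. ring. }
  split; apply Rmult_eq_reg_l with (lam + mu); try lra; field_simplify; nra.
Qed.

(** The torus point [t] near a cluster point is reached by minimising, on the tangency loci, the
    linear function whose minimum over the torus is [t].  In the limit a minimiser is a critical
    point of that function on the torus, that is, [t] up to the signs of its two components;
    being no worse than the given cluster point, it has the right signs. *)
Lemma cluster_small_rotation : forall q s t, cluster a b r q -> Rabs s <= 1 -> Rabs t <= 1 ->
  cluster a b r (rot s t q).
Proof.
  intros q0 s t Hq0 Hs Ht.
  assert (Cos : forall x, Rabs x <= 1 -> 0 < cos x).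
  { intros x Hx. apply Rabs_le_between in Hx. pose proof PI2_1. apply cos_gt_0; lra. }
  destruct (cluster_clifford q0 Hq0) as [A0 B0].
  destruct Hq0 as [k [p0 Hc0]].
  set (al := mu / (lam + mu)) in *. set (be := lam / (lam + mu)) in *.
  assert (Pal : 0 < al) by (apply Rdiv_lt_0_compat; lra).
  assert (Pbe : 0 < be) by (apply Rdiv_lt_0_compat; lra).
  set (g := (vscal (RtoC (- / al)) (cis s * fst q0, RtoC 0)%C)).
  set (g' := (vscal (RtoC (- / be)) (RtoC 0, cis t * snd q0)%C)).
  set (G := vadd g g' : C2).
  assert (IpG : forall x y, ip G (x, y) = - / al * fst (x * Cconj (cis s * fst q0))%C - / be * fst (y * Cconj (cis t * snd q0))%C).
  { intros x y. unfold G, g, g', ip, vadd, vscal. simpl. ring. }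
  destruct Hc0 as [Hk [Hp0 T0]].
  destruct (minimisers a b _ r H (ip G) k Hk (fun q => rd_cont _ _ _ (rd_ip G q))) as [sg [p [Hsg Hp]]].
  destruct (cluster_extract a b _ r H (fun n => k (sg n)) p (extraction_comp _ _ Hk Hsg) (fun n => proj1 (Hp n))) as [phi [q [Hphi Hc]]].
  assert (Cl : cluster a b r q) by (eexists; eexists; exact Hc).
  destruct (cluster_clifford q Cl) as [A B]. fold al be in A, B.
  assert (Cmp : ip G q <= ip G q0).
  { destruct Hc as [_ [_ T]]. apply Rnot_lt_le. intros h.
    set (e := (ip G q - ip G q0) / 2). assert (Pe : 0 < e) by (unfold e; lra).
    destruct (ip_tends G _ _ T e Pe) as [N1 K1].
    destruct (ip_tends G _ _ (tends_extraction _ _ _ (tends_extraction _ _ sg T0 Hsg) Hphi) e Pe) as [N2 K2].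
    set (n := Nat.max N1 N2). specialize (K1 n ltac:(lia)). specialize (K2 n ltac:(lia)).
    cbv beta in K1, K2. rewrite ip_scal in K1, K2.
    destruct (Hp (phi n)) as [_ M]. specialize (M _ (Hp0 (sg (phi n)))).
    pose proof (radius_pos a b _ r H (k (sg (phi n)))) as P. apply Rinv_0_lt_compat in P.
    assert (/ r (k (sg (phi n))) * ip G (p (phi n)) <= / r (k (sg (phi n))) * ip G (p0 (sg (phi n)))) by (apply Rmult_le_compat_l; lra).
    apply Rabs_lt_between in K1. apply Rabs_lt_between in K2. unfold e in *. lra. }
  assert (D : dep3 q (tgrad (RtoC 1) (mv (dmat lam mu) q) (dmat lam mu) q) G).
  { apply (dependence_at_cluster a b _ r H _ _ _ (RtoC 1) (ip G) (fun _ => G) (fun _ => 1) _ Hc).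
    - exists 1. split; [lra|]. intros x _. split; [exists 1; split; [lra|intros; apply rd_ip]|].
      apply cont_vec_seq. intros u _. apply tends_const.
    - intros n. exists 1. split; [lra|]. intros x Hx _. apply Hp. exact Hx.
    - intros n. lra.
    - intros eps He. exists 0%nat. intros n _. replace (vscal (RtoC 1) G) with G by c2ring. now rewrite vsub_diag, nrm_origin. }
  destruct q as [z w]. destruct q0 as [z0 w0]. cbn [fst snd] in g, g', IpG, A, B, A0, B0.
  assert (Nzw : z <> RtoC 0 /\ w <> RtoC 0 /\ z0 <> RtoC 0 /\ w0 <> RtoC 0).
  { repeat split; intros h; subst; rewrite ?Cmod_0 in *; simpl in *; lra. }
  destruct Nzw as [Nz [Nw [Nz0 Nw0]]].
  destruct D as [x [y [c [Nxyc E]]]].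
  assert (E1 := f_equal fst E). assert (E2 := f_equal snd E). clear E.
  unfold tgrad, G, g, g', mv, dmat, lin, adj, vadd, vscal, origin in E1, E2. cbn [fst snd m11 m12 m21 m22] in E1, E2.
  rewrite !conj_of_real in E1, E2.
  set (v1 := (cis s * z0)%C) in *. set (v2 := (cis t * w0)%C) in *.
  assert (F1 : (RtoC (x + 2 * lam * y) * z)%C = (RtoC (c * / al) * v1)%C).
  { apply Ceq_minus. rewrite <- E1. apply injective_projections; simpl; ring. }
  assert (F2 : (RtoC (x - 2 * mu * y) * w)%C = (RtoC (c * / be) * v2)%C).
  { apply Ceq_minus. rewrite <- E2. apply injective_projections; simpl; ring. }
  assert (Nc : c <> 0).
  { intros ->. rewrite Rmult_0_l, Cmult_0_l in F1, F2.
    assert (x + 2 * lam * y = 0).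
    { apply RtoC_inj. destruct (Ceq_dec (RtoC (x + 2 * lam * y)) (RtoC 0)) as [h|h]; auto. exfalso. exact (Cmult_neq_0 _ _ h Nz F1). }
    assert (x - 2 * mu * y = 0).
    { apply RtoC_inj. destruct (Ceq_dec (RtoC (x - 2 * mu * y)) (RtoC 0)) as [h|h]; auto. exfalso. exact (Cmult_neq_0 _ _ h Nw F2). }
    assert ((lam + mu) * y = 0) by lra. apply Rmult_integral in H2. apply Nxyc. destruct H2; [lra|]. subst. repeat split; lra. }
  (* each component of the minimiser is, up to sign, that of the target *)
  assert (Sign : forall (m d X : R) (u v : C), c <> 0 -> d <> 0 -> 0 < X -> Cmod u ^ 2 = X -> Cmod v ^ 2 = X ->
     (RtoC m * u)%C = (RtoC (c * d) * v)%C -> v = u \/ v = (- u)%C).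
  { intros m d X u v hc hd hX hu hv hE.
    assert (Ncd : c * d <> 0) by now apply Rmult_integral_contrapositive_currified.
    assert (NC : RtoC (c * d) <> RtoC 0) by (intros h; apply RtoC_inj in h; auto).
    set (k1 := m / (c * d)).
    assert (Ev : v = (RtoC k1 * u)%C).
    { unfold k1. rewrite RtoC_div by auto. transitivity (RtoC (c * d) * v / RtoC (c * d))%C; [field; auto|]. rewrite <- hE. field. auto. }
    assert (Q : k1 ^ 2 * X = X).
    { rewrite <- hv at 2. rewrite Ev, Cmod_mult, Cmod_R, Rpow_mult_distr, hu. rewrite <- (Rabs_pos_eq (k1 ^ 2)) by apply pow2_ge_0.
      now rewrite RPow_abs. }
    assert (Q2 : (k1 - 1) * (k1 + 1) = 0).
    { apply Rmult_eq_reg_r with X; [|lra]. replace ((k1 - 1) * (k1 + 1) * X) with (k1 ^ 2 * X - X) by ring. lra. }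
    rewrite Ev. apply Rmult_integral in Q2. destruct Q2 as [Q2|Q2].
    - left. replace k1 with 1 by lra. ring.
    - right. replace k1 with (-1) by lra. apply injective_projections; simpl; ring. }
  assert (V1 : Cmod v1 ^ 2 = al) by (unfold v1; rewrite Cmod_mult, Cmod_cis, Rmult_1_l; exact A0).
  assert (V2 : Cmod v2 ^ 2 = be) by (unfold v2; rewrite Cmod_mult, Cmod_cis, Rmult_1_l; exact B0).
  assert (ia : / al <> 0) by (apply Rinv_neq_0_compat; lra).
  assert (ib : / be <> 0) by (apply Rinv_neq_0_compat; lra).
  rewrite !IpG in Cmp.
  replace (fst (z0 * Cconj v1)%C) with (cos s * al) in Cmp by (unfold v1; rewrite Re_mul_conj_cis, A0; reflexivity).
  replace (fst (w0 * Cconj v2)%C) with (cos t * be) in Cmp by (unfold v2; rewrite Re_mul_conj_cis, B0; reflexivity).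
  assert (Self : forall u X, Cmod u ^ 2 = X -> fst (u * Cconj u)%C = X /\ fst (u * Cconj (- u))%C = - X).
  { intros u X <-. rewrite Cmod_sqr. split; simpl; ring. }
  destruct (Self z al A) as [S1 S1']. destruct (Self w be B) as [S2 S2'].
  replace (- / al * (cos s * al) - / be * (cos t * be)) with (- (cos s + cos t)) in Cmp by (field; lra).
  pose proof (Cos s Hs). pose proof (Cos t Ht).
  destruct (Sign _ _ al z v1 Nc ia Pal A V1 F1) as [G1|G1]; destruct (Sign _ _ be w v2 Nc ib Pbe B V2 F2) as [G2|G2].
  - replace (rot s t (z0, w0)) with ((z, w) : C2) by (apply C2_eq; [exact (eq_sym G1)|exact (eq_sym G2)]). exact Cl.
  - exfalso. rewrite G1, G2, S2', S1 in Cmp. replace (- / al * al - / be * - be) with 0 in Cmp by (field; lra). lra.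
  - exfalso. rewrite G1, G2, S2, S1' in Cmp. replace (- / al * - al - / be * be) with 0 in Cmp by (field; lra). lra.
  - exfalso. rewrite G1, G2, S2', S1' in Cmp. replace (- / al * - al - / be * - be) with 2 in Cmp by (field; lra). lra.
Qed.

(** Every rotation is a composite of small ones. *)
Lemma cluster_rotation : forall q s t, cluster a b r q -> cluster a b r (rot s t q).
Proof.
  assert (N : forall n q s t, cluster a b r q -> Rabs s <= INR n -> Rabs t <= INR n -> cluster a b r (rot s t q)).
  { induction n; intros q s t Hq Hs Ht.
    - apply cluster_small_rotation; auto; simpl in *; lra.
    - assert (P : 0 < INR n + 1) by (pose proof (pos_INR n); lra). rewrite S_INR in Hs, Ht.
      replace s with (s / (INR n + 1) + s * (INR n / (INR n + 1))) by (field; lra).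
      replace t with (t / (INR n + 1) + t * (INR n / (INR n + 1))) by (field; lra).
      rewrite rot_add.
      assert (B1 : forall x, Rabs x <= INR n + 1 -> Rabs (x / (INR n + 1)) <= 1).
      { intros x Hx. unfold Rdiv. rewrite Rabs_mult, Rabs_inv, (Rabs_pos_eq (INR n + 1)) by lra.
        apply Rmult_le_reg_r with (1 := P). rewrite Rmult_assoc, Rinv_l; lra. }
      assert (B2 : forall x, Rabs x <= INR n + 1 -> Rabs (x * (INR n / (INR n + 1))) <= INR n).
      { intros x Hx. replace (x * (INR n / (INR n + 1))) with (x / (INR n + 1) * INR n) by (field; lra).
        rewrite Rabs_mult, (Rabs_pos_eq (INR n)) by apply pos_INR. specialize (B1 x Hx). pose proof (pos_INR n). nra. }
      apply cluster_small_rotation; auto. }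
  intros q s t Hq. destruct (INR_unbounded (Rabs s + Rabs t)) as [n Hn].
  pose proof (Rabs_pos s). pose proof (Rabs_pos t). apply (N n); auto; lra.
Qed.

Lemma polar_form : forall u v : C, Cmod u = Cmod v -> u <> RtoC 0 -> exists s, v = (cis s * u)%C.
Proof.
  intros u v E Nu. pose proof (proj1 (Cmod_gt_0 u) Nu) as P.
  set (w := (v / u)%C).
  assert (W : fst w ^ 2 + snd w ^ 2 = 1).
  { rewrite <- Cmod_sqr. unfold w. rewrite Cmod_div, E by auto. rewrite E in P. field. lra. }
  assert (Ev : v = (w * u)%C) by (unfold w; field; auto).
  assert (Bw : -1 <= fst w <= 1) by nra.
  assert (Sn : sin (acos (fst w)) = Rabs (snd w)).
  { rewrite sin_acos by auto. replace (1 - Rsqr (fst w)) with (Rsqr (snd w)) by (unfold Rsqr; lra). apply sqrt_Rsqr_abs. }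
  destruct (Rle_dec 0 (snd w)) as [h|h].
  - exists (acos (fst w)). rewrite Ev. f_equal. unfold cis. rewrite cos_acos, Sn, Rabs_pos_eq by auto. now destruct w.
  - exists (- acos (fst w)). rewrite Ev. f_equal. unfold cis. rewrite cos_neg, sin_neg, cos_acos, Sn, Rabs_left by (auto; lra).
    rewrite Ropp_involutive. now destruct w.
Qed.

Lemma clifford_cluster : forall q, clifford lam mu q -> cluster a b r q.
Proof.
  intros q [A B]. destruct (cluster_exists a b _ r H) as [q0 Hq0].
  destruct (cluster_clifford q0 Hq0) as [A0 B0].
  assert (Pal : 0 < mu / (lam + mu)) by (apply Rdiv_lt_0_compat; lra).
  assert (Pbe : 0 < lam / (lam + mu)) by (apply Rdiv_lt_0_compat; lra).
  assert (Sq : forall x y : C, Cmod x ^ 2 = Cmod y ^ 2 -> Cmod x = Cmod y).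
  { intros x y h. pose proof (Cmod_ge_0 x). pose proof (Cmod_ge_0 y). nra. }
  destruct (polar_form (fst q0) (fst q)) as [s Es].
  { apply Sq. lra. }
  { intros h. rewrite h, Cmod_0 in A0. simpl in A0. lra. }
  destruct (polar_form (snd q0) (snd q)) as [t Et].
  { apply Sq. lra. }
  { intros h. rewrite h, Cmod_0 in B0. simpl in B0. lra. }
  replace q with (rot s t q0) by (apply C2_eq; simpl; auto). now apply cluster_rotation.
Qed.

End Torus.

(** * Holomorphic functions vanishing to high order *)

(** Two orders of vanishing are kept in reserve: they make the quotient differentiable at the origin
    without a removable singularity theorem. *)
Lemma cd_divide_power : forall f n r0 M, 0 < r0 -> (forall z, Cmod z <= r0 -> exists l, cd f z l) ->
  (forall z, Cmod z <= r0 -> Cmod (f z) <= M * Cmod z ^ (n + 2)) ->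
  exists k, (forall z, Cmod z <= r0 -> exists l, cd k z l) /\ cd k (RtoC 0) (RtoC 0) /\
    (forall z, Cmod z <= r0 -> Cmod (k z) <= M * Cmod z ^ 2) /\ (forall z, Cmod z <= r0 -> f z = (k z * z ^ n)%C).
Proof.
  intros f n r0 M Hr Hf HM.
  set (k := fun z => if Ceq_dec z (RtoC 0) then RtoC 0 else (f z / z ^ n)%C).
  assert (k0 : k (RtoC 0) = RtoC 0) by (unfold k; destruct (Ceq_dec (RtoC 0) (RtoC 0)); congruence).
  assert (k1 : forall z, z <> RtoC 0 -> k z = (f z / z ^ n)%C) by (intros z Nz; unfold k; destruct (Ceq_dec z (RtoC 0)); congruence).
  assert (PM : 0 <= M).
  { specialize (HM (RtoC r0)). rewrite Cmod_RtoC_pos in HM by lra. specialize (HM (Rle_refl _)).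
    pose proof (Cmod_ge_0 (f (RtoC r0))). assert (0 < r0 ^ (n + 2)) by now apply pow_lt. nra. }
  assert (Bd : forall z, Cmod z <= r0 -> Cmod (k z) <= M * Cmod z ^ 2).
  { intros z Hz. destruct (Ceq_dec z (RtoC 0)) as [->|Nz].
    - rewrite k0, Cmod_0. simpl. lra.
    - rewrite k1 by auto. rewrite Cmod_div, Cmod_pow by (now apply Cpow_nz).
      pose proof (proj1 (Cmod_gt_0 z) Nz) as P. assert (Pp : 0 < Cmod z ^ n) by now apply pow_lt.
      apply Rmult_le_reg_r with (1 := Pp). unfold Rdiv. rewrite Rmult_assoc, Rinv_l, Rmult_1_r by lra.
      rewrite Rmult_assoc, <- pow_add, Nat.add_comm. auto. }
  assert (D0 : cd k (RtoC 0) (RtoC 0)).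
  { intros eps He. exists (Rmin r0 (eps / (M + 1))).
    split; [apply Rmin_glb_lt; auto; apply Rdiv_lt_0_compat; lra|]. intros h Hh.
    rewrite Cplus_0_l, k0. replace (k h - RtoC 0 - RtoC 0 * h)%C with (k h) by ring.
    assert (h1 : Cmod h <= r0) by (left; eapply Rlt_le_trans; [exact Hh|apply Rmin_l]).
    assert (h2 : Cmod h < eps / (M + 1)) by (eapply Rlt_le_trans; [exact Hh|apply Rmin_r]).
    eapply Rle_trans; [apply Bd; auto|]. pose proof (Cmod_ge_0 h).
    apply Rmult_lt_compat_l with (r := M + 1) in h2; [|lra]. replace ((M + 1) * (eps / (M + 1))) with eps in h2 by (field; lra).
    nra. }
  exists k. split; [|split; [exact D0|split; [exact Bd|]]].
  - intros z Hz. destruct (Ceq_dec z (RtoC 0)) as [->|Nz]; [now exists (RtoC 0)|].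
    destruct (Hf z Hz) as [l Hl]. destruct (cd_pow n z) as [m Hm].
    destruct (cd_quotient f (fun z => z ^ n)%C z l m Hl Hm (Cpow_nz z n Nz)) as [c Hc].
    exists c. apply (cd_ext_loc (fun w => f w / w ^ n)%C); auto.
    exists (Cmod z). split; [now apply Cmod_gt_0|]. intros h Hh. symmetry. apply k1.
    apply Cmod_gt_0. pose proof (Cmod_lower z h). lra.
  - intros z Hz. destruct (Ceq_dec z (RtoC 0)) as [->|Nz].
    + rewrite k0. assert (f (RtoC 0) = RtoC 0).
      { apply Cmod_eq_0. specialize (HM (RtoC 0)). rewrite Cmod_0 in HM. specialize (HM (Rlt_le _ _ Hr)).
        rewrite pow_ne_zero in HM by lia. pose proof (Cmod_ge_0 (f (RtoC 0))). lra. }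
      rewrite H. ring.
    + rewrite k1 by auto. field. now apply Cpow_nz.
Qed.

(** Schwarz's lemma: the maximum principle for the quotient of [cd_divide_power]. *)
Lemma schwarz : forall f n r0 M B, 0 < r0 -> (forall z, Cmod z <= r0 -> exists l, cd f z l) ->
  (forall z, Cmod z <= r0 -> Cmod (f z) <= M * Cmod z ^ (n + 2)) -> (forall z, Cmod z <= r0 -> Cmod (f z) <= B) ->
  forall z, Cmod z <= r0 -> Cmod (f z) <= B * (Cmod z / r0) ^ n.
Proof.
  intros f n r0 M B Hr Hf HM HB z Hz.
  destruct (cd_divide_power f n r0 M Hr Hf HM) as [k [K1 [_ [_ K4]]]].
  assert (P : 0 < r0 ^ n) by now apply pow_lt.
  assert (Kz : Cmod (k z) <= B / r0 ^ n).
  { apply (maximum_principle k r0); auto. intros w Hw. apply Rmult_le_reg_r with (1 := P).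
    unfold Rdiv. rewrite Rmult_assoc, Rinv_l, Rmult_1_r by lra. rewrite <- Hw, <- Cmod_pow, <- Cmod_mult, <- K4 by lra. apply HB. lra. }
  rewrite K4, Cmod_mult, Cmod_pow by auto. unfold Rdiv. rewrite Rpow_mult_distr, pow_inv.
  replace (B * (Cmod z ^ n * / r0 ^ n)) with (B / r0 ^ n * Cmod z ^ n) by (field; lra).
  apply Rmult_le_compat_r; auto. apply pow_le, Cmod_ge_0.
Qed.

Lemma hd_of_cd : forall k q l, cd k (fst q) l -> hd (fun q => k (fst q)) q l (RtoC 0).
Proof.
  intros k q l Hk eps He. destruct (Hk eps He) as [d [Hd K]]. exists d. split; auto. intros h Hh.
  pose proof (Cmod_fst_nrm h) as Q. specialize (K (fst h) ltac:(lra)). unfold vadd, lin. simpl.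
  replace (l * fst h + RtoC 0 * snd h)%C with (l * fst h)%C by ring. nra.
Qed.

(** One variable is the case of functions of two variables that ignore the second. *)
Lemma cd_derivative : forall k (k' : C -> C) r0, (forall z, Cmod z < r0 -> cd k z (k' z)) ->
  forall z, Cmod z < r0 -> exists l, cd k' z l.
Proof.
  intros k k' r0 Hk z Hz.
  destruct (hd_partials (fun q => k (fst q)) (fun q => k' (fst q)) (fun _ => RtoC 0) (z, RtoC 0)) as [[al [be K]] _].
  - exists (r0 - Cmod z). split; [lra|]. intros x Hx. apply hd_of_cd, Hk.
    pose proof (Cmod_fst_nrm (vsub x (z, RtoC 0))) as Q. simpl in Q.
    replace (fst x) with (z + (fst x - z))%C by ring. pose proof (Cmod_triangle z (fst x - z)%C). lra.
  - exists (lin al be (RtoC 1, RtoC 0)).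
    assert (E : vadd (RtoC 0, RtoC 0) (vscal z (RtoC 1, RtoC 0)) = (z, RtoC 0)) by c2ring.
    rewrite <- E in K. apply hd_slice in K. apply (cd_ext (fun w => k' (fst (vadd (RtoC 0, RtoC 0) (vscal w (RtoC 1, RtoC 0)))))); auto.
    intros w. f_equal. unfold vadd, vscal. simpl. ring.
Qed.

(** The second-order Taylor bound of the derivative is integrated once.  The bound on the remainder
    depends on [k] only through [B], hence is uniform in families. *)
Lemma leading_coefficient2 : forall k B, (forall z, Cmod z < 9 -> exists l, cd k z l) -> cd k (RtoC 0) (RtoC 0) ->
  k (RtoC 0) = RtoC 0 -> (forall z, Cmod z < 9 -> Cmod (k z) <= B) ->
  exists c, forall h, Cmod h <= 1 -> Cmod (k h - c * (h * h))%C <= 8 * B * Cmod h ^ 3.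
Proof.
  intros k B Hk D0 k0 HB.
  assert (S : forall z, exists l, Cmod z < 9 -> cd k z l).
  { intros z. destruct (Rlt_dec (Cmod z) 9) as [h|h]; [destruct (Hk z h) as [l Hl]; exists l; auto|exists (RtoC 0); intros; contradiction]. }
  destruct (choice_function _ _ _ S) as [k' Hk'].
  assert (k'0 : k' (RtoC 0) = RtoC 0).
  { apply Ceq_minus. apply Cmod_lt_of_all. intros eps He.
    pose proof (cd_minus _ _ _ _ _ (Hk' (RtoC 0) ltac:(rewrite Cmod_0; lra)) D0) as Q. destruct (Q eps He) as [d [Hd K]].
    specialize (K (RtoC (d / 2))). rewrite Cmod_RtoC_pos in K by lra. specialize (K ltac:(lra)).
    match type of K with Cmod ?X <= _ => replace X with (- ((k' (RtoC 0) - RtoC 0) * RtoC (d / 2)))%C in K by ring end.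
    rewrite Cmod_opp, Cmod_mult, (Cmod_RtoC_pos (d / 2)) in K by lra. apply Rmult_le_reg_r with (d / 2); lra. }
  assert (Bk' : forall z, Cmod z <= 4 -> Cmod (k' z) <= 2 * B).
  { intros z Hz. destruct (taylor2_bound (fun w => k (z + w)%C) (fun w => k' (z + w)%C) B) as [T _].
    - intros w Hw. apply cd_translate, Hk'. pose proof (Cmod_triangle z w). lra.
    - intros w Hw. apply HB. pose proof (Cmod_triangle z w). lra.
    - specialize (T (RtoC 0)). rewrite Cplus_0_r in T. apply T. rewrite Cmod_0. lra. }
  assert (S2 : forall z, exists l, Cmod z < 9 -> cd k' z l).
  { intros z. destruct (Rlt_dec (Cmod z) 9) as [h|h]; [|exists (RtoC 0); intros; contradiction].
    destruct (cd_derivative k k' 9 Hk' z h) as [l Hl]; exists l; auto. }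
  destruct (choice_function _ _ _ S2) as [k2 Hk2].
  destruct (taylor2_bound k' k2 (2 * B)) as [_ T]; [intros z Hz; apply Hk2; lra|exact Bk'|].
  set (c := k2 (RtoC 0)) in *.
  exists (c / RtoC 2)%C. intros h Hh.
  pose proof (mean_value_inequality (fun z => k z - c / RtoC 2 * (z * z))%C (fun z => k' z - c / RtoC 2 * (RtoC 2 * z))%C
    (RtoC 0) h (8 * B * Cmod h ^ 2)) as MV. cbv beta in MV.
  replace (k (0 + h) - c / RtoC 2 * ((0 + h) * (0 + h)) - (k (RtoC 0) - c / RtoC 2 * (RtoC 0 * RtoC 0)))%C
    with (k h - c / RtoC 2 * (h * h))%C in MV.
  2:{ rewrite k0, Cplus_0_l. ring. }
  replace (8 * B * Cmod h ^ 3) with (8 * B * Cmod h ^ 2 * Cmod h) by ring. apply MV.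
  intros t Ht. rewrite Cplus_0_l.
  assert (Ct : Cmod (RtoC t * h)%C <= Cmod h).
  { rewrite Cmod_mult, Cmod_RtoC_pos by lra. pose proof (Cmod_ge_0 h). nra. }
  split.
  - apply cd_minus; [apply Hk'; lra|]. apply (cd_scal (c / RtoC 2)%C (fun z => z * z)%C), cd_sqr.
  - specialize (T (RtoC t * h)%C ltac:(lra)). rewrite k'0 in T.
    match type of T with Cmod ?X <= _ => match goal with |- Cmod ?Y <= _ => replace Y with X by field end end.
    eapply Rle_trans; [exact T|].
    assert (B0 : 0 <= B) by (eapply Rle_trans; [apply Cmod_ge_0|apply (HB (RtoC 0)); rewrite Cmod_0; lra]).
    pose proof (Cmod_ge_0 (RtoC t * h)%C).
    assert (Cmod (RtoC t * h)%C ^ 2 <= Cmod h ^ 2) by (apply pow_incr; lra). nra.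
Qed.

(** Rescales [leading_coefficient2] from radius 9 to [9 r0]; the constant is [8 * 9 ^ 2]. *)
Lemma leading_coefficient : forall f n M r0, 0 < r0 -> (forall z, Cmod z <= 9 * r0 -> exists l, cd f z l) ->
  (forall z, Cmod z <= 9 * r0 -> Cmod (f z) <= M * Cmod z ^ (n + 2)) ->
  exists c, forall z, Cmod z <= r0 -> Cmod (f z - c * z ^ (n + 2))%C <= 648 * M / r0 * Cmod z ^ (n + 3).
Proof.
  intros f n M r0 Hr Hf HM.
  destruct (cd_divide_power f n (9 * r0) M) as [k [K1 [K2 [K3 K4]]]]; auto; [lra|].
  assert (Nr : RtoC r0 <> RtoC 0) by (intros h; apply RtoC_inj in h; lra).
  assert (Sc : forall z, Cmod (RtoC r0 * z)%C = r0 * Cmod z).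
  { intros z. rewrite Cmod_mult, Cmod_RtoC_pos; lra. }
  assert (k0 : k (RtoC 0) = RtoC 0).
  { apply Cmod_eq_0. specialize (K3 (RtoC 0)). rewrite Cmod_0 in K3. pose proof (Cmod_ge_0 (k (RtoC 0))). lra. }
  assert (PM : 0 <= M).
  { specialize (K3 (RtoC r0)). rewrite Cmod_RtoC_pos in K3 by lra. specialize (K3 ltac:(lra)). pose proof (Cmod_ge_0 (k (RtoC r0))). assert (0 < r0 ^ 2) by nra. apply Rnot_lt_le. intros h. nra. }
  destruct (leading_coefficient2 (fun z => k (RtoC r0 * z)%C) (M * (9 * r0) ^ 2)) as [c Hc].
  - intros z Hz. destruct (K1 (RtoC r0 * z)%C) as [l Hl]; [rewrite Sc; nra|].
    exists (l * (RtoC r0 * RtoC 1))%C. apply (cd_comp k (fun z => RtoC r0 * z)%C); auto. apply (cd_scal _ (fun z => z)), cd_id.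
  - eapply cd_eq; [|apply (cd_comp k (fun z => RtoC r0 * z)%C (RtoC 0) (RtoC r0 * RtoC 1) (RtoC 0))].
    + ring.
    + apply (cd_scal _ (fun z => z)), cd_id.
    + rewrite Cmult_0_r. exact K2.
  - rewrite Cmult_0_r. exact k0.
  - intros z Hz. eapply Rle_trans; [apply K3; rewrite Sc; nra|]. apply Rmult_le_compat_l; auto.
    apply pow_incr. split; [apply Cmod_ge_0|rewrite Sc; nra].
  - exists (c / (RtoC r0 * RtoC r0))%C. intros z Hz.
    specialize (Hc (z / RtoC r0)%C).
    assert (Ez : Cmod (z / RtoC r0)%C = Cmod z / r0) by (rewrite Cmod_div, Cmod_RtoC_pos; auto; lra).
    rewrite Ez in Hc.
    assert (Cmod z / r0 <= 1) by (apply Rmult_le_reg_r with (1 := Hr); unfold Rdiv; rewrite Rmult_assoc, Rinv_l; lra).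
    specialize (Hc ltac:(auto)). replace (RtoC r0 * (z / RtoC r0))%C with z in Hc by (field; auto).
    replace (z / RtoC r0 * (z / RtoC r0))%C with (z * z / (RtoC r0 * RtoC r0))%C in Hc by (field; auto).
    rewrite (K4 z) by lra. rewrite Cpow_add_r.
    replace (k z * z ^ n - c / (RtoC r0 * RtoC r0) * (z ^ n * z ^ 2))%C
      with ((k z - c * (z * z / (RtoC r0 * RtoC r0))) * z ^ n)%C by (simpl; field; auto).
    rewrite Cmod_mult, Cmod_pow.
    replace (648 * M / r0 * Cmod z ^ (n + 3)) with (8 * (M * (9 * r0) ^ 2) * (Cmod z / r0) ^ 3 * Cmod z ^ n).
    + apply Rmult_le_compat_r; auto. apply pow_le, Cmod_ge_0.
    + rewrite pow_add. field. lra.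
Qed.

(** * The deviation from the normal form vanishes *)

Lemma quadratic_remainder : forall F R0 c d, 0 < R0 -> hol F R0 -> F origin = RtoC 0 -> hd F origin c d ->
  exists rho K, 0 < rho < R0 /\ 0 <= K /\ forall h, nrm h <= rho -> Cmod (F h - lin c d h)%C <= K * nrm h ^ 2.
Proof.
  intros F R0 c d PR hF F0 HF.
  destruct (hol_partials F R0 hF) as [al [be [Hd _]]].
  assert (Sub : forall x, vsub x origin = x) by (intros x; c2ring).
  assert (Add : forall x, vadd origin x = x) by (intros x; c2ring).
  destruct (hd_near_bounded F al be origin) as [rho [B [Pr [PB HB]]]].
  { exists R0. split; auto. intros x Hx. rewrite Sub in Hx. auto. }
  destruct (hd_unique F origin _ _ _ _ (Hd origin ltac:(rewrite nrm_origin; lra)) HF) as [E1 E2].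
  destruct (taylor2 F al be origin rho B Pr) as [_ T].
  { intros x Hx. apply HB. lra. }
  exists (Rmin rho (R0 / 2)), (4 * B / rho ^ 2).
  assert (P2 : 0 < rho ^ 2) by nra.
  split; [split; [apply Rmin_glb_lt; lra|eapply Rle_lt_trans; [apply Rmin_r|lra]]|].
  split; [left; apply Rdiv_lt_0_compat; lra|].
  intros h Hh. specialize (T h (Rle_trans _ _ _ Hh (Rmin_l _ _))).
  rewrite Add, F0, E1, E2 in T.
  replace (F h - lin c d h)%C with (F h - RtoC 0 - lin c d h)%C by ring.
  eapply Rle_trans; [exact T|]. right. field. lra.
Qed.

Lemma cis_pow : forall s n, (cis s ^ n)%C = cis (INR n * s).
Proof.
  intros s. induction n.
  - simpl. rewrite Rmult_0_l, cis_0. reflexivity.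
  - rewrite Cpow_S, IHn, <- cis_add, S_INR. f_equal. ring.
Qed.

Lemma cis_half_pi : cis (PI / 2) = Ci.
Proof. unfold cis. now rewrite cos_PI2, sin_PI2. Qed.

(** At a tangency point [|z|^2 a w + |w|^2 b z = 0], so that [a w] and [b z] are real multiples of one
    another, and so are all real combinations of them. *)
Lemma tangency_real_ratio : forall (lam mu : R) (z w A B : C), ~ (z = RtoC 0 /\ w = RtoC 0) ->
  (A * Cconj z + B * Cconj w)%C = RtoC 0 ->
  snd ((RtoC mu * w * A + RtoC lam * z * B) * Cconj (A * w - B * z))%C = 0.
Proof.
  intros lam mu z w A B N E.
  set (X := (A * w)%C). set (Z := (B * z)%C).
  assert (E2 : (RtoC (Cmod z ^ 2) * X + RtoC (Cmod w ^ 2) * Z)%C = RtoC 0).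
  { rewrite <- !mul_conj. unfold X, Z. transitivity ((A * Cconj z + B * Cconj w) * (z * w))%C; [ring|rewrite E; ring]. }
  set (u := Cmod z ^ 2) in *. set (v := Cmod w ^ 2) in *.
  assert (Im0 : snd (X * Cconj Z)%C = 0).
  { assert (E3 : (RtoC u * (X * Cconj Z))%C = (- (RtoC v * RtoC (Cmod Z ^ 2)))%C).
    { rewrite <- mul_conj. transitivity ((RtoC u * X + RtoC v * Z) * Cconj Z - RtoC v * (Z * Cconj Z))%C; [ring|rewrite E2; ring]. }
    assert (E4 : (RtoC v * (Z * Cconj X))%C = (- (RtoC u * RtoC (Cmod X ^ 2)))%C).
    { rewrite <- mul_conj. transitivity ((RtoC u * X + RtoC v * Z) * Cconj X - RtoC u * (X * Cconj X))%C; [ring|rewrite E2; ring]. }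
    assert (F3 := f_equal snd E3). assert (F4 := f_equal snd E4).
    assert (G3 : u * snd (X * Cconj Z)%C = 0) by (simpl in F3; simpl; lra).
    assert (G4 : v * snd (X * Cconj Z)%C = 0) by (simpl in F4; simpl; lra).
    destruct (Ceq_dec z (RtoC 0)) as [hz|hz].
    - assert (hw : w <> RtoC 0) by auto. apply Cmod_gt_0 in hw.
      apply Rmult_integral in G4. destruct G4 as [G4|G4]; auto. unfold v in G4. nra.
    - apply Cmod_gt_0 in hz. apply Rmult_integral in G3. destruct G3 as [G3|G3]; auto. unfold u in G3. nra. }
  replace (RtoC mu * w * A + RtoC lam * z * B)%C with (RtoC mu * X + RtoC lam * Z)%C by (unfold X, Z; ring).
  replace (snd ((RtoC mu * X + RtoC lam * Z) * Cconj (X - Z))%C) with (- (lam + mu) * snd (X * Cconj Z)%C) by (simpl; ring).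
  rewrite Im0. ring.
Qed.

Section Vanishing.

Variables (a b : C2 -> C) (lam mu : R) (r : nat -> R).
Hypothesis Plam : 0 < lam.
Hypothesis Pmu : 0 < mu.
Hypothesis H : tangency_surfaces a b (dmat lam mu) r.

(** The value of the form [mu w dz + lam z dw] on the vector field; it vanishes identically exactly
    when the foliation is in normal form. *)
Definition defect (q : C2) : C := (RtoC mu * snd q * a q + RtoC lam * fst q * b q)%C.

Lemma clifford_nrm : forall t, clifford lam mu t -> nrm t <= 2.
Proof.
  intros t [A B]. replace 2 with (2 * 1) by ring. apply nrm_le_2; [lra|]. unfold sqn. rewrite A, B. field. lra.
Qed.

Lemma clifford_components : forall t, clifford lam mu t -> fst t <> RtoC 0 /\ snd t <> RtoC 0.
Proof.
  intros t [A B].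
  assert (0 < mu / (lam + mu)) by (apply Rdiv_lt_0_compat; lra).
  assert (0 < lam / (lam + mu)) by (apply Rdiv_lt_0_compat; lra).
  split; intros h; rewrite h, Cmod_0 in *; simpl in *; lra.
Qed.

(** Suppose that [defect] vanishes to order [m], with leading coefficient [c v] along [v].  On the
    loci [defect / (a w - b z)] is real, so [c t / (t_1 t_2)] is real for [t] in the torus; being
    homogeneous of degree [m - 2] under the circle action it must vanish when [m > 2]. *)
Lemma leading_term_zero : forall m (c : C2 -> C) K r0, (2 < m)%nat -> 0 < r0 <= 1 -> 0 <= K ->
  (forall v z, nrm v <= 2 -> Cmod z <= r0 -> Cmod (defect (vscal z v) - c v * z ^ m)%C <= K * Cmod z ^ (m + 1)) ->
  (forall t z, clifford lam mu t -> Cmod z <= r0 -> cont2 defect (vscal z t)) ->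
  forall t, clifford lam mu t -> c t = RtoC 0.
Proof.
  intros m c K r0 Hm Hr0 PK Hc Ct.
  assert (Dvd : forall x y M eps, 0 < eps -> Cmod (RtoC (eps ^ m) * (x - y))%C <= eps ^ m * M -> Cmod (x - y)%C <= M).
  { intros x y M eps He Q. assert (P : 0 < eps ^ m) by now apply pow_lt.
    rewrite Cmod_mult, Cmod_RtoC_pos in Q by lra. now apply Rmult_le_reg_l with (eps ^ m). }
  (* both sides are read off from [defect] at the same point [e * cis s * t] *)
  assert (Hom : forall s t, clifford lam mu t -> c (rot s s t) = (cis s ^ m * c t)%C).
  { intros s t Ht. apply Ceq_minus. apply Cmod_lt_of_all. intros eta Heta.
    set (e := Rmin r0 (eta / (2 * K + 1))).
    assert (Pe : 0 < e) by (apply Rmin_glb_lt; [lra|apply Rdiv_lt_0_compat; lra]).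
    assert (e1 : e <= r0) by apply Rmin_l. assert (e2 : e <= eta / (2 * K + 1)) by apply Rmin_r.
    assert (Hr : clifford lam mu (rot s s t)).
    { destruct Ht as [A B]. split; unfold rot; simpl fst; simpl snd; rewrite Cmod_mult, Cmod_cis, Rmult_1_l; auto. }
    pose proof (Hc (rot s s t) (RtoC e) (clifford_nrm _ Hr)) as X1. rewrite Cmod_RtoC_pos in X1 by lra. specialize (X1 e1).
    pose proof (Hc t (RtoC e * cis s)%C (clifford_nrm _ Ht)) as X2. rewrite Cmod_circle in X2 by lra. specialize (X2 e1).
    replace (vscal (RtoC e * cis s) t) with (vscal (RtoC e) (rot s s t)) in X2 by (unfold rot; c2ring).
    rewrite Cpow_mult_l in X2. rewrite <- !RtoC_pow in *.
    eapply Rle_trans; [apply (Dvd _ _ (2 * K * e) e Pe)|].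
    - match type of X1 with Cmod ?P <= _ => match type of X2 with Cmod ?Q <= _ =>
        replace (RtoC (e ^ m) * (c (rot s s t) - cis s ^ m * c t))%C with (Q - P)%C by ring end end.
      eapply Rle_trans; [apply Cmod_triangle_sub|]. rewrite pow_add in X1, X2. lra.
    - apply Rle_trans with ((2 * K + 1) * e); [nra|].
      apply Rmult_le_compat_l with (r := 2 * K + 1) in e2; [|lra].
      replace ((2 * K + 1) * (eta / (2 * K + 1))) with eta in e2 by (field; lra). exact e2. }
  (* at a fixed small radius [e] the continuous function [defect] is close to its leading term *)
  assert (Cc : forall t eta, clifford lam mu t -> 0 < eta -> exists d, 0 < d /\
     forall q, nrm q <= 2 -> nrm (vsub q t) < d -> Cmod (c q - c t)%C <= eta).
  { intros t eta Ht Heta.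
    set (e := Rmin r0 (eta / 2 / (2 * K + 1))).
    assert (Pe : 0 < e) by (apply Rmin_glb_lt; [lra|repeat apply Rdiv_lt_0_compat; lra]).
    assert (e1 : e <= r0) by apply Rmin_l. assert (e2 : e <= eta / 2 / (2 * K + 1)) by apply Rmin_r.
    assert (Pm : 0 < e ^ m) by now apply pow_lt.
    destruct (Ct t (RtoC e) Ht ltac:(rewrite Cmod_RtoC_pos; lra) (e ^ m * (eta / 2))) as [d [Hd Kd]]; [nra|].
    exists d. split; auto. intros q Nq Hq.
    pose proof (Hc q (RtoC e) Nq) as X1. pose proof (Hc t (RtoC e) (clifford_nrm _ Ht)) as X2.
    rewrite Cmod_RtoC_pos in X1, X2 by lra. specialize (X1 e1). specialize (X2 e1). rewrite <- !RtoC_pow in *.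
    specialize (Kd (vscal (RtoC e) q)).
    replace (vsub (vscal (RtoC e) q) (vscal (RtoC e) t)) with (vscal (RtoC e) (vsub q t)) in Kd by c2ring.
    rewrite nrm_scal, Cmod_RtoC_pos in Kd by lra. pose proof (nrm_ge_0 (vsub q t)). specialize (Kd ltac:(nra)).
    apply (Dvd _ _ eta e Pe).
    match type of X1 with Cmod ?P <= _ => match type of X2 with Cmod ?Q <= _ => match type of Kd with Cmod ?W < _ =>
      replace (RtoC (e ^ m) * (c q - c t))%C with ((Q - P) + W)%C by ring end end end.
    eapply Rle_trans; [apply Cmod_triangle|]. eapply Rle_trans; [apply Rplus_le_compat_r, Cmod_triangle_sub|].
    rewrite pow_add in X1, X2.
    apply Rmult_le_compat_l with (r := 2 * K + 1) in e2; [|lra].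
    replace ((2 * K + 1) * (eta / 2 / (2 * K + 1))) with (eta / 2) in e2 by (field; lra).
    assert (e ^ m * ((2 * K + 1) * e) <= e ^ m * (eta / 2)) by (apply Rmult_le_compat_l; lra). nra. }
  (* along tangency points whose rescalings tend to [t], [defect] and [a w - b z] rescale to [c t] and
     to a positive multiple of [t_1 t_2]; their real quotients tend to a real number *)
  assert (Re0 : forall t, clifford lam mu t -> snd (c t * Cconj (fst t * snd t))%C = 0).
  { intros t Ht. destruct (clifford_cluster a b lam mu r Plam Pmu H t Ht) as [k [p Hk]].
    pose proof (field_rescaled a b _ r H k p t Hk) as T1. pose proof Hk as [Ek [Hp T]].
    assert (TD : ctends (fun n => (RtoC (/ r (k n)) * a (p n)) * snd (vscal (RtoC (/ r (k n))) (p n)) -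
       (RtoC (/ r (k n)) * b (p n)) * fst (vscal (RtoC (/ r (k n))) (p n)))%C (RtoC (lam + mu) * (fst t * snd t))%C).
    { pose proof (ctends_mult _ _ _ _ (ctends_fst _ _ T1) (ctends_snd _ _ T)) as Q1.
      pose proof (ctends_mult _ _ _ _ (ctends_mult _ _ _ _ (ctends_const (- (1))%C) (ctends_snd _ _ T1)) (ctends_fst _ _ T)) as Q2.
      pose proof (ctends_plus _ _ _ _ Q1 Q2) as Q.
      replace (RtoC (lam + mu) * (fst t * snd t))%C with (fst (mv (dmat lam mu) t) * snd t + - (1) * snd (mv (dmat lam mu) t) * fst t)%C.
      - intros eps He. destruct (Q eps He) as [N HN]. exists N. intros n Hn. specialize (HN n Hn).
        match type of HN with Cmod ?X < _ => match goal with |- Cmod ?Y < _ => replace Y with X end end; auto.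
        unfold vfield, vscal. simpl. ring.
      - unfold mv, dmat, lin. simpl. rewrite RtoC_plus, RtoC_opp. ring. }
    assert (TE : ctends (fun n => defect (p n) * RtoC (/ r (k n) ^ m))%C (c t)).
    { intros eps He. destruct (Cc t (eps / 3) Ht ltac:(lra)) as [d [Hd Kd]].
      destruct (T d Hd) as [N1 K1].
      destruct (radius_to_0 a b _ r H k Ek (Rmin r0 (eps / 3 / (K + 1)))) as [N2 K2].
      { apply Rmin_glb_lt; [lra|repeat apply Rdiv_lt_0_compat; lra]. }
      exists (Nat.max N1 N2). intros n Hn. specialize (K1 n ltac:(lia)). specialize (K2 n ltac:(lia)).
      pose proof (Rmin_l r0 (eps / 3 / (K + 1))). pose proof (Rmin_r r0 (eps / 3 / (K + 1))).
      pose proof (radius_pos a b _ r H (k n)) as Pr. set (rho := r (k n)) in *.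
      set (q := vscal (RtoC (/ rho)) (p n)) in *.
      assert (Nq : nrm q <= 2).
      { replace 2 with (2 * 1) by ring. apply nrm_le_2; [lra|]. unfold q, rho. rewrite (sqn_rescaled a b _ r H k p Hp). ring. }
      assert (Nrho : RtoC rho <> RtoC 0) by (intros h; apply RtoC_inj in h; lra).
      assert (Ep : p n = vscal (RtoC rho) q).
      { unfold q. rewrite RtoC_inv by lra. apply C2_eq; unfold vscal; simpl; field; auto. }
      pose proof (Hc q (RtoC rho) Nq) as X. rewrite Cmod_RtoC_pos in X by lra. specialize (X ltac:(lra)). rewrite <- Ep in X.
      specialize (Kd q Nq K1).
      assert (Pm : 0 < rho ^ m) by now apply pow_lt.
      assert (Nm : RtoC (rho ^ m) <> RtoC 0) by (intros h; apply RtoC_inj in h; lra).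
      assert (Y : Cmod (defect (p n) * RtoC (/ rho ^ m) - c q)%C <= K * rho).
      { rewrite RtoC_inv by lra. replace (defect (p n) * / RtoC (rho ^ m) - c q)%C
          with ((defect (p n) - c q * RtoC rho ^ m) * / RtoC (rho ^ m))%C by (rewrite RtoC_pow in *; field; auto).
        rewrite Cmod_mult, Cmod_inv, Cmod_RtoC_pos by (auto; lra).
        apply Rmult_le_reg_r with (1 := Pm). rewrite Rmult_assoc, Rinv_l, Rmult_1_r by lra.
        rewrite pow_add in X. lra. }
      replace (defect (p n) * RtoC (/ rho ^ m) - c t)%C with ((defect (p n) * RtoC (/ rho ^ m) - c q) + (c q - c t))%C by ring.
      eapply Rle_lt_trans; [apply Cmod_triangle|].
      assert (Z : (K + 1) * rho <= eps / 3).
      { apply Rle_trans with ((K + 1) * (eps / 3 / (K + 1))); [apply Rmult_le_compat_l; lra|right; field; lra]. }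
      nra. }
    pose proof (ctends_mult _ _ _ _ TE (ctends_conj _ _ TD)) as TQ.
    assert (Z : snd (c t * Cconj (RtoC (lam + mu) * (fst t * snd t)))%C = 0).
    { apply Rle_antisym; apply Rnot_lt_le; intros h.
      1: set (e := snd (c t * Cconj (RtoC (lam + mu) * (fst t * snd t)))%C) in h.
      2: set (e := - snd (c t * Cconj (RtoC (lam + mu) * (fst t * snd t)))%C).
      all: destruct (TQ (e / 2)) as [N HN]; [unfold e in *; lra|]; specialize (HN N (le_n _)); cbv beta in HN.
      all: match type of HN with Cmod (?X - _)%C < _ => assert (S0 : snd X = 0) end.
      1, 3: destruct (Hp N) as [Sq Tg]; pose proof (radius_pos a b _ r H (k N)) as Pr;
        assert (Nz : ~ (fst (p N) = RtoC 0 /\ snd (p N) = RtoC 0)) by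
          (intros [z1 z2]; unfold sqn in Sq; rewrite z1, z2, Cmod_0 in Sq; simpl in Sq; nra);
        pose proof (tangency_real_ratio lam mu _ _ _ _ Nz Tg) as S1;
        unfold vfield in S1; cbn [fst snd] in S1;
        set (i1 := / r (k N)); set (i2 := / r (k N) ^ m);
        transitivity (i2 * i1 * i1 * snd ((RtoC mu * snd (p N) * a (p N) + RtoC lam * fst (p N) * b (p N)) * Cconj (a (p N) * snd (p N) - b (p N) * fst (p N)))%C);
        [unfold defect, vscal; simpl; ring|rewrite S1; ring].
      all: match type of HN with Cmod ?X < _ => pose proof (Rabs_Im_le X) as S2 end.
      all: match type of S2 with Rabs (snd (?X - ?Y)%C) <= _ => replace (snd (X - Y)%C) with (snd X - snd Y) in S2 by (simpl; ring) end.
      all: rewrite S0 in S2; pose proof (Rle_lt_trans _ _ _ S2 HN) as S3; apply Rabs_lt_between in S3; unfold e in *; lra. }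
    apply Rmult_eq_reg_l with (lam + mu); [|lra].
    transitivity (snd (c t * Cconj (RtoC (lam + mu) * (fst t * snd t)))%C); [|rewrite Z; ring].
    rewrite (Cmult_conj (RtoC (lam + mu))), conj_of_real. simpl. ring. }
  intros t Ht.
  set (X := (c t * Cconj (fst t * snd t))%C).
  destruct (clifford_components t Ht) as [N1 N2].
  (* the rotation by [PI / 2 / n] multiplies the real number [X] by [i] *)
  set (n := (m - 2)%nat). assert (Pn : 0 < INR n) by (apply lt_0_INR; unfold n; lia).
  set (s := PI / 2 / INR n).
  assert (Hr : clifford lam mu (rot s s t)).
  { destruct Ht as [A B]. split; unfold rot; simpl fst; simpl snd; rewrite Cmod_mult, Cmod_cis, Rmult_1_l; auto. }
  pose proof (Re0 _ Hr) as Q1. pose proof (Re0 t Ht) as Q2. rewrite (Hom s t Ht) in Q1.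
  assert (E : (cis s ^ m * c t * Cconj (fst (rot s s t) * snd (rot s s t)))%C = (Ci * X)%C).
  { unfold rot, X. cbn [fst snd]. rewrite !Cmult_conj.
    assert (U : (cis s * Cconj (cis s))%C = RtoC 1) by (rewrite mul_conj, Cmod_cis; f_equal; ring).
    replace m with (n + 2)%nat by (unfold n; lia). rewrite Cpow_add_r.
    transitivity (cis s ^ n * (cis s * Cconj (cis s)) * (cis s * Cconj (cis s)) * (c t * (Cconj (fst t) * Cconj (snd t))))%C; [simpl; ring|].
    rewrite U, cis_pow. replace (INR n * s) with (PI / 2) by (unfold s; field; lra). rewrite cis_half_pi. ring. }
  rewrite E in Q1. fold X in Q2.
  assert (X0 : X = RtoC 0).
  { apply injective_projections; [|exact Q2]. simpl in Q1. simpl. lra. }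
  destruct (Ceq_dec (c t) (RtoC 0)) as [h|h]; auto. exfalso.
  apply (Cmult_neq_0 (c t) (Cconj (fst t * snd t))%C h); auto.
  intros h2. apply (Cmult_neq_0 _ _ N1 N2). rewrite <- (Cconj_conj (fst t * snd t)%C), h2. apply (conj_of_real 0).
Qed.

Lemma hol_defect : forall R0, hol a R0 -> hol b R0 -> hol defect R0.
Proof.
  intros R0 hA hB q Hq. destruct (hA q Hq) as [a1 [a2 Ka]]. destruct (hB q Hq) as [b1 [b2 Kb]].
  do 2 eexists. unfold defect. apply hd_plus; apply hd_mult; try eassumption; apply hd_scal; [apply hd_snd|apply hd_fst].
Qed.

(** From the cone over the torus the estimate spreads to a full neighbourhood by the maximum
    principle, applied on the discs of horizontal or vertical lines bounded by circles of the cone. *)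
Lemma spread_from_cone : forall n K r0 R0, 0 < r0 -> 2 * r0 < R0 -> 0 <= K -> hol defect R0 ->
  (forall t s, clifford lam mu t -> 0 <= s <= r0 -> Cmod (defect (vscal (RtoC s) t)) <= K * s ^ S n) ->
  exists K' r1, 0 < r1 /\ 0 <= K' /\ forall q, nrm q <= r1 -> Cmod (defect q) <= K' * nrm q ^ S n.
Proof.
  intros n K r0 R0 Pr HR PK Hh Hcone.
  set (al := sqrt (mu / (lam + mu))). set (be := sqrt (lam / (lam + mu))).
  assert (Pal0 : 0 < mu / (lam + mu)) by (apply Rdiv_lt_0_compat; lra).
  assert (Pbe0 : 0 < lam / (lam + mu)) by (apply Rdiv_lt_0_compat; lra).
  assert (Pal : 0 < al) by now apply sqrt_lt_R0. assert (Pbe : 0 < be) by now apply sqrt_lt_R0.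
  assert (Sal : al ^ 2 = mu / (lam + mu)) by (apply pow2_sqrt; lra).
  assert (Sbe : be ^ 2 = lam / (lam + mu)) by (apply pow2_sqrt; lra).
  assert (S1 : al ^ 2 + be ^ 2 = 1) by (rewrite Sal, Sbe; field; lra).
  assert (al1 : al <= 1) by nra. assert (be1 : be <= 1) by nra.
  (* a point with these moduli is [s] times a point of the torus *)
  assert (Cone : forall q s, 0 <= s <= r0 -> Cmod (fst q) = al * s -> Cmod (snd q) = be * s -> Cmod (defect q) <= K * s ^ S n).
  { intros q s Hs E1 E2. destruct (Req_dec s 0) as [->|Ns].
    - assert (q = origin). { apply nrm_eq_0. unfold nrm. rewrite E1, E2. ring. }
      subst q. unfold defect, origin. simpl.
      match goal with |- Cmod ?X <= _ => replace X with (RtoC 0) by ring end. rewrite Cmod_0. lra.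
    - assert (Nc : RtoC s <> RtoC 0) by (intros h; apply RtoC_inj in h; auto).
      replace q with (vscal (RtoC s) (vscal (/ RtoC s) q)).
      + apply Hcone; auto. unfold clifford, vscal. simpl fst. simpl snd.
        rewrite !Cmod_mult, Cmod_inv, Cmod_RtoC_pos, E1, E2 by (auto; lra). rewrite <- Sal, <- Sbe. split; field; auto.
      + apply C2_eq; unfold vscal; simpl; field; auto. }
  assert (Main : forall q s, 0 <= s <= r0 -> Cmod (fst q) <= al * s -> Cmod (snd q) <= be * s ->
     (Cmod (fst q) = al * s \/ Cmod (snd q) = be * s) -> Cmod (defect q) <= K * s ^ S n).
  { intros [z w] s Hs E1 E2 D. simpl fst in *. simpl snd in *.
    destruct (Req_dec s 0) as [->|Ns].
    { apply Cone; auto; simpl; pose proof (Cmod_ge_0 z); pose proof (Cmod_ge_0 w); lra. }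
    assert (P : 0 < s) by lra.
    assert (Small : forall x y : C, Cmod x <= al * s -> Cmod y <= be * s -> nrm (x, y) < R0).
    { intros x y hx hy. unfold nrm. simpl. nra. }
    destruct D as [D|D].
    - apply (maximum_principle (fun y => defect (z, y)) (be * s)); [nra| | |exact E2].
      + intros y Hy. destruct (Hh (z, y) (Small z y E1 Hy)) as [c1 [c2 K1]]. eexists.
        apply (cd_ext (fun t => defect (vadd (z, RtoC 0) (vscal t (RtoC 0, RtoC 1))))).
        * intros t. f_equal. apply C2_eq; unfold vadd, vscal; simpl; ring.
        * apply hd_slice. replace (vadd (z, RtoC 0) (vscal y (RtoC 0, RtoC 1))) with ((z, y) : C2) by c2ring. exact K1.
      + intros y Hy. apply Cone; auto.
    - apply (maximum_principle (fun y => defect (y, w)) (al * s)); [nra| | |exact E1].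
      + intros y Hy. destruct (Hh (y, w) (Small y w Hy E2)) as [c1 [c2 K1]]. eexists.
        apply (cd_ext (fun t => defect (vadd (RtoC 0, w) (vscal t (RtoC 1, RtoC 0))))).
        * intros t. f_equal. apply C2_eq; unfold vadd, vscal; simpl; ring.
        * apply hd_slice. replace (vadd (RtoC 0, w) (vscal y (RtoC 1, RtoC 0))) with ((y, w) : C2) by c2ring. exact K1.
      + intros y Hy. apply Cone; auto. }
  set (ga := Rmin al be). assert (Pga : 0 < ga) by (apply Rmin_glb_lt; auto).
  assert (g1 : ga <= al) by apply Rmin_l. assert (g2 : ga <= be) by apply Rmin_r.
  exists (K * (/ ga) ^ S n), (r0 * ga).
  split; [nra|]. split; [apply Rmult_le_pos; auto; apply pow_le; left; now apply Rinv_0_lt_compat|].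
  intros q Hq. pose proof (nrm_ge_0 q) as Nq. pose proof (Cmod_ge_0 (fst q)). pose proof (Cmod_ge_0 (snd q)).
  set (s := Rmax (Cmod (fst q) / al) (Cmod (snd q) / be)).
  assert (Div : forall x y c, 0 < c -> x / c <= y -> x <= c * y).
  { intros x y c0 hc h. apply Rmult_le_compat_r with (r := c0) in h; [|lra]. unfold Rdiv in h. rewrite Rmult_assoc, Rinv_l in h by lra. lra. }
  assert (s1 : Cmod (fst q) <= al * s) by (apply Div; auto; apply Rmax_l).
  assert (s2 : Cmod (snd q) <= be * s) by (apply Div; auto; apply Rmax_r).
  assert (s0 : 0 <= s).
  { eapply Rle_trans; [|apply Rmax_l]. apply Rmult_le_pos; auto. left. now apply Rinv_0_lt_compat. }
  assert (Ls : s <= nrm q * / ga).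
  { unfold s. pose proof (Cmod_fst_nrm q). pose proof (Cmod_snd_nrm q).
    apply Rmax_lub; apply Rmult_le_compat; auto; try (left; now apply Rinv_0_lt_compat); apply Rinv_le_contravar; auto. }
  assert (sr : s <= r0).
  { eapply Rle_trans; [exact Ls|]. apply Rmult_le_reg_r with (1 := Pga). rewrite Rmult_assoc, Rinv_l; lra. }
  eapply Rle_trans; [apply (Main q s); auto|].
  - unfold s, Rmax. destruct (Rle_dec (Cmod (fst q) / al) (Cmod (snd q) / be)); [right|left]; field; lra.
  - replace (K * / ga ^ S n * nrm q ^ S n) with (K * (nrm q * / ga) ^ S n) by (rewrite Rpow_mult_distr, pow_inv; ring).
    rewrite Rmult_assoc, <- Rpow_mult_distr, (Rmult_comm (/ ga)).
    apply Rmult_le_compat_l; auto. apply pow_incr. auto.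
Qed.

(** The order of vanishing starts at 3, where the linear part cancels, and can be raised forever:
    the leading term is zero over the torus, and the better estimate spreads from there.  Schwarz's
    lemma turns vanishing to all orders into vanishing. *)
Theorem defect_vanishes : exists rho, 0 < rho /\ forall q, nrm q < rho -> defect q = RtoC 0.
Proof.
  pose proof H as [[R0 [PR [hA hB]]] [a0 [b0 [Ha [Hb _]]]]].
  destruct (quadratic_remainder a R0 _ _ PR hA a0 Ha) as [r1 [K1 [P1 [PK1 Q1]]]].
  destruct (quadratic_remainder b R0 _ _ PR hB b0 Hb) as [r2 [K2 [P2 [PK2 Q2]]]].
  set (rho := Rmin (Rmin r1 r2) 1).
  assert (Prho : 0 < rho) by (repeat apply Rmin_glb_lt; lra).
  assert (Lr : rho <= r1 /\ rho <= r2 /\ rho <= 1 /\ rho < R0).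
  { pose proof (Rmin_l (Rmin r1 r2) 1). pose proof (Rmin_r (Rmin r1 r2) 1). pose proof (Rmin_l r1 r2). pose proof (Rmin_r r1 r2). unfold rho. lra. }
  clearbody rho. destruct Lr as [Lr1 [Lr2 [Lr3 Lr4]]].
  pose proof (hol_defect R0 hA hB) as hD.
  assert (O3 : exists M, 0 <= M /\ forall q, nrm q <= rho -> Cmod (defect q) <= M * nrm q ^ 3).
  { exists (mu * K1 + lam * K2). split; [nra|]. intros q Hq.
    specialize (Q1 q ltac:(lra)). specialize (Q2 q ltac:(lra)).
    replace (defect q) with (RtoC mu * snd q * (a q - lin (m11 (dmat lam mu)) (m12 (dmat lam mu)) q) + RtoC lam * fst q * (b q - lin (m21 (dmat lam mu)) (m22 (dmat lam mu)) q))%C.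
    2:{ unfold defect, dmat, lin. simpl. rewrite RtoC_opp. ring. }
    eapply Rle_trans; [apply Cmod_triangle|]. rewrite !Cmod_mult, !Cmod_RtoC_pos by lra.
    pose proof (Cmod_fst_nrm q). pose proof (Cmod_snd_nrm q). pose proof (nrm_ge_0 q).
    pose proof (Cmod_ge_0 (fst q)). pose proof (Cmod_ge_0 (snd q)).
    replace ((mu * K1 + lam * K2) * nrm q ^ 3) with ((mu * nrm q) * (K1 * nrm q ^ 2) + (lam * nrm q) * (K2 * nrm q ^ 2)) by ring.
    apply Rplus_le_compat; apply Rmult_le_compat; auto using Cmod_ge_0; nra. }
  assert (Slice : forall v z, nrm v <= 2 -> Cmod z <= rho / 2 -> nrm (vscal z v) <= rho).
  { intros v z Hv Hz. rewrite nrm_scal. pose proof (Cmod_ge_0 z). pose proof (nrm_ge_0 v). nra. }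
  assert (CdSlice : forall v z, nrm (vscal z v) < R0 -> exists l, cd (fun z => defect (vscal z v)) z l).
  { intros v z Hz. destruct (hD _ Hz) as [c1 [c2 K]]. eexists.
    apply (cd_ext (fun t => defect (vadd origin (vscal t v)))); [intros t; f_equal; c2ring|].
    apply hd_slice. replace (vadd origin (vscal z v)) with (vscal z v) by c2ring. exact K. }
  assert (Ord : forall n, exists M, 0 <= M /\ forall q, nrm q <= rho -> Cmod (defect q) <= M * nrm q ^ (n + 3)).
  { induction n; [exact O3|]. destruct IHn as [M [PM HM]].
    set (m := (n + 1 + 2)%nat). replace (n + 3)%nat with m in HM by (unfold m; lia).
    set (r0 := rho / 18). assert (Pr0 : 0 < r0) by (unfold r0; lra).
    set (K := 648 * (M * 2 ^ m) / r0).
    assert (PK : 0 <= K).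
    { apply Rmult_le_pos; [|left; now apply Rinv_0_lt_compat]. assert (0 < 2 ^ m) by (apply pow_lt; lra). nra. }
    assert (Lead : forall v, exists c, nrm v <= 2 -> forall z, Cmod z <= r0 -> Cmod (defect (vscal z v) - c * z ^ m)%C <= K * Cmod z ^ (m + 1)).
    { intros v. destruct (Rle_dec (nrm v) 2) as [Hv|Hv]; [|exists (RtoC 0); intros; contradiction].
      destruct (leading_coefficient (fun z => defect (vscal z v)) (n + 1) (M * 2 ^ m) r0 Pr0) as [c Hc].
      - intros z Hz. apply CdSlice. pose proof (Slice v z Hv). unfold r0 in Hz. lra.
      - intros z Hz. eapply Rle_trans; [apply HM, Slice; auto; unfold r0 in Hz; lra|].
        rewrite Rmult_assoc, nrm_scal. apply Rmult_le_compat_l; auto. fold m. rewrite <- Rpow_mult_distr.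
        apply pow_incr. pose proof (Cmod_ge_0 z). pose proof (nrm_ge_0 v). nra.
      - exists c. intros _ z Hz. replace (m + 1)%nat with (n + 1 + 3)%nat by (unfold m; lia). apply Hc. auto. }
    destruct (choice_function _ _ _ Lead) as [c Hc].
    assert (C0 : forall t, clifford lam mu t -> c t = RtoC 0).
    { apply (leading_term_zero m c K r0); auto; [unfold m; lia|unfold r0; lra|].
      intros t z Ht Hz. destruct (hD (vscal z t)) as [c1 [c2 K3]].
      - pose proof (Slice t z (clifford_nrm t Ht)). unfold r0 in Hz. lra.
      - eapply hd_cont, K3. }
    destruct (spread_from_cone m K r0 R0 Pr0) as [K' [r' [Pr' [PK' HK']]]]; auto.
    { unfold r0. lra. }
    { intros t s Ht Hs. specialize (Hc t (clifford_nrm t Ht) (RtoC s)). rewrite Cmod_RtoC_pos, (C0 t Ht) in Hc by lra.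
      replace (defect (vscal (RtoC s) t)) with (defect (vscal (RtoC s) t) - RtoC 0 * RtoC s ^ m)%C by ring.
      replace (S m) with (m + 1)%nat by lia. apply Hc. lra. }
    (* for [r' < nrm q <= rho] the new estimate follows from the old one *)
    exists (K' + M / r'). split; [apply Rplus_le_le_0_compat; auto; apply Rmult_le_pos; auto; left; now apply Rinv_0_lt_compat|].
    intros q Hq. replace (S n + 3)%nat with (S m) by (unfold m; lia).
    pose proof (nrm_ge_0 q) as Nq. assert (Pq : 0 <= nrm q ^ S m) by (apply pow_le; auto).
    assert (PM' : 0 <= M / r') by (apply Rmult_le_pos; auto; left; now apply Rinv_0_lt_compat).
    destruct (Rle_dec (nrm q) r') as [h|h].
    - eapply Rle_trans; [apply HK'; auto|]. apply Rmult_le_compat_r; auto. lra.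
    - eapply Rle_trans; [apply HM; auto|]. apply Rle_trans with (M / r' * nrm q ^ S m); [|apply Rmult_le_compat_r; auto; lra].
      simpl. replace (M / r' * (nrm q * nrm q ^ m)) with (M * nrm q ^ m * (nrm q / r')) by (field; lra).
      assert (1 <= nrm q / r') by (apply Rmult_le_reg_r with (1 := Pr'); unfold Rdiv; rewrite Rmult_assoc, Rinv_l; lra).
      assert (0 <= M * nrm q ^ m) by (apply Rmult_le_pos; auto; apply pow_le; auto). nra. }
  exists rho. split; auto. intros q Hq.
  destruct (Req_dec (nrm q) 0) as [E|E].
  { rewrite (nrm_eq_0 q E). unfold defect, origin. simpl. ring. }
  pose proof (nrm_ge_0 q) as Nq. assert (Pq : 0 < nrm q) by lra.
  assert (Nc : RtoC (nrm q) <> RtoC 0) by (intros h; apply RtoC_inj in h; auto).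
  set (v := vscal (/ RtoC (nrm q)) q).
  assert (Nv : nrm v = 1) by (unfold v; rewrite nrm_scal, Cmod_inv, Cmod_RtoC_pos by (auto; lra); field; lra).
  assert (Ev : q = vscal (RtoC (nrm q)) v) by (unfold v; apply C2_eq; unfold vscal; simpl; field; auto).
  assert (Nz : forall z, nrm (vscal z v) = Cmod z) by (intros z; rewrite nrm_scal, Nv; ring).
  destruct (Ord 0%nat) as [B [PB HB]]. simpl in HB.
  assert (Sch : forall n, Cmod (defect q) <= B * (nrm q / rho) ^ n).
  { intros n. destruct (Ord n) as [M [PM HM]].
    pose proof (schwarz (fun z => defect (vscal z v)) n rho (M * rho) B Prho) as Sch0.
    specialize (Sch0 ltac:(intros z Hz; apply CdSlice; rewrite Nz; lra)).
    assert (S1 : forall z, Cmod z <= rho -> Cmod (defect (vscal z v)) <= M * rho * Cmod z ^ (n + 2)).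
    { intros z Hz. eapply Rle_trans; [apply HM; rewrite Nz; auto|]. rewrite Nz.
      replace (n + 3)%nat with (S (n + 2)) by lia. simpl. pose proof (Cmod_ge_0 z).
      assert (0 <= Cmod z ^ (n + 2)) by (apply pow_le; auto).
      rewrite Rmult_assoc. apply Rmult_le_compat_l; auto. apply Rmult_le_compat_r; auto. }
    specialize (Sch0 S1).
    assert (S2 : forall z, Cmod z <= rho -> Cmod (defect (vscal z v)) <= B).
    { intros z Hz. eapply Rle_trans; [apply HB; rewrite Nz; auto|]. rewrite Nz. pose proof (Cmod_ge_0 z).
      assert (Cmod z * (Cmod z * (Cmod z * 1)) <= 1).
      { assert (Cmod z <= 1) by lra. assert (Cmod z * Cmod z <= 1) by nra. nra. }
      nra. }
    specialize (Sch0 S2 (RtoC (nrm q))). cbv beta in Sch0. rewrite <- Ev, Cmod_RtoC_pos in Sch0 by lra. apply Sch0. lra. }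
  apply Cmod_lt_of_all. intros eps He.
  assert (Hx : Rabs (nrm q / rho) < 1).
  { rewrite Rabs_pos_eq; [|left; now apply Rdiv_lt_0_compat].
    apply Rmult_lt_reg_r with (1 := Prho). unfold Rdiv. rewrite Rmult_assoc, Rinv_l; lra. }
  destruct (pow_lt_1_zero _ Hx (eps / (B + 1))) as [N HN]; [apply Rdiv_lt_0_compat; lra|].
  specialize (HN N (le_n _)). specialize (Sch N). eapply Rle_trans; [exact Sch|].
  pose proof (Rle_abs ((nrm q / rho) ^ N)) as Q.
  assert (0 <= (nrm q / rho) ^ N) by (apply pow_le; left; now apply Rdiv_lt_0_compat).
  apply Rle_trans with ((B + 1) * (eps / (B + 1))); [apply Rmult_le_compat; lra|right; field; lra].
Qed.

End Vanishing.

(** * Holomorphic maps and charts *)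

Lemma ball_C_R : forall (p q : C2) e, nrm (vsub q p) < e -> ball (M := C2_R) p e q.
Proof.
  intros p q e H.
  pose proof (Cmod_fst_nrm (vsub q p)) as H1. pose proof (Cmod_snd_nrm (vsub q p)) as H2.
  pose proof (Rabs_Re_le (fst (vsub q p))) as H3. pose proof (Rabs_Im_le (fst (vsub q p))) as H4.
  pose proof (Rabs_Re_le (snd (vsub q p))) as H5. pose proof (Rabs_Im_le (snd (vsub q p))) as H6.
  simpl in *.
  split; split; eapply Rle_lt_trans; try exact H;
    unfold abs, minus, plus, opp; simpl; lra.
Qed.

Lemma locally_R_nrm : forall (p : C2) (P : C2 -> Prop), locally (T := C2_R) p P ->
  exists d, 0 < d /\ forall q, nrm (vsub q p) < d -> P q.
Proof. intros p P [e He]. exists e. split; [apply cond_pos|]. intros q Hq. apply He. now apply ball_C_R. Qed.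

Lemma locally_C_nrm : forall (p : C2) (P : C2 -> Prop), locally (T := C2_C) p P ->
  exists d, 0 < d /\ forall q, nrm (vsub q p) < d -> P q.
Proof. exact locally_R_nrm. Qed.

Lemma nrm_locally_C : forall (p : C2) (P : C2 -> Prop) d, 0 < d -> (forall q, nrm (vsub q p) < d -> P q) ->
  locally (T := C2_C) p P.
Proof.
  intros p P d Hd H. assert (Hd4 : 0 < d / 4) by lra. exists (mkposreal _ Hd4). intros q [[H1 H2] [H3 H4]]. apply H.
  unfold ball in *; simpl in *. unfold AbsRing_ball, abs, minus, plus, opp in *; simpl in *.
  unfold nrm, vsub. simpl.
  pose proof (Cmod_le_ReIm (fst q - fst p)%C) as Q1. pose proof (Cmod_le_ReIm (snd q - snd p)%C) as Q2. simpl in Q1, Q2. lra.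
Qed.

Lemma open_nrm : forall (U : C2 -> Prop) p, open (T := C2_C) U -> U p -> exists d, 0 < d /\ forall q, nrm (vsub q p) < d -> U q.
Proof. intros U p HU Up. apply locally_C_nrm. exact (HU p Up). Qed.

Lemma prod_norm_nrm : forall q : C2, sqrt (Cmod (fst q) ^ 2 + Cmod (snd q) ^ 2) <= nrm q.
Proof.
  intros q. rewrite <- (sqrt_pow2 (nrm q)) by apply nrm_ge_0. apply sqrt_le_1_alt. apply sqn_le_nrm.
Qed.

Lemma Cmod_fst_norm : forall q : C2, Cmod (fst q) <= sqrt (Cmod (fst q) ^ 2 + Cmod (snd q) ^ 2).
Proof.
  intros q. rewrite <- (sqrt_pow2 (Cmod (fst q))) at 1 by apply Cmod_ge_0. apply sqrt_le_1_alt.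
  pose proof (pow2_ge_0 (Cmod (snd q))). lra.
Qed.

Lemma Cmod_snd_norm : forall q : C2, Cmod (snd q) <= sqrt (Cmod (fst q) ^ 2 + Cmod (snd q) ^ 2).
Proof.
  intros q. rewrite <- (sqrt_pow2 (Cmod (snd q))) at 1 by apply Cmod_ge_0. apply sqrt_le_1_alt.
  pose proof (pow2_ge_0 (Cmod (fst q))). lra.
Qed.

Lemma hd_of_filterdiff : forall (f : C2 -> C2) p,
  ex_filterdiff (K := C_AbsRing) (U := C2_C) (V := C2_C) f (locally (T := C2_C) p) ->
  exists M, hd (fun q => fst (f q)) p (m11 M) (m12 M) /\ hd (fun q => snd (f q)) p (m21 M) (m22 M).
Proof.
  intros f p [l [Hl Hd]].
  specialize (Hd p (fun P HP => HP)).
  set (u := l (RtoC 1, RtoC 0)). set (v := l (RtoC 0, RtoC 1)).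
  exists (Mat (fst u) (fst v) (snd u) (snd v)).
  assert (Lin : forall h : C2, l h = mv (Mat (fst u) (fst v) (snd u) (snd v)) h).
  { intros h.
    assert (E : h = plus (G := C2_C) (scal (V := C2_C) (fst h) ((RtoC 1, RtoC 0) : C2)) (scal (V := C2_C) (snd h) ((RtoC 0, RtoC 1) : C2))).
    { apply C2_eq; [change (fst h = fst h * 1 + snd h * 0)%C|change (snd h = fst h * 0 + snd h * 1)%C]; ring. }
    rewrite E at 1. rewrite (linear_plus _ Hl), !(linear_scal _ Hl). fold u v.
    apply C2_eq; [change (fst h * fst u + snd h * fst v = fst u * fst h + fst v * snd h)%C
      |change (fst h * snd u + snd h * snd v = snd u * fst h + snd v * snd h)%C]; ring. }
  assert (Main : forall eps, 0 < eps -> exists d, 0 < d /\ forall h, nrm h < d ->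
     sqrt (Cmod (fst (vsub (vsub (f (vadd p h)) (f p)) (mv (Mat (fst u) (fst v) (snd u) (snd v)) h))) ^ 2 +
           Cmod (snd (vsub (vsub (f (vadd p h)) (f p)) (mv (Mat (fst u) (fst v) (snd u) (snd v)) h))) ^ 2) <= eps * nrm h).
  { intros eps He. specialize (Hd (mkposreal eps He)). apply locally_C_nrm in Hd. destruct Hd as [d [Hd K]].
    exists d. split; auto. intros h Hh. specialize (K (vadd p h)). rewrite vsub_add in K. specialize (K Hh).
    assert (Em : minus (G := C2_C) (vadd p h) p = h).
    { apply C2_eq; [change (fst p + fst h + - fst p = fst h)%C|change (snd p + snd h + - snd p = snd h)%C]; ring. }
    rewrite Em in K. rewrite Lin in K.
    eapply Rle_trans; [|eapply Rle_trans; [exact K|]].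
    - right. reflexivity.
    - apply Rmult_le_compat_l; [simpl; lra|]. exact (prod_norm_nrm h). }
  split; intros eps He; destruct (Main eps He) as [d [Hd' K]]; exists d; split; auto; intros h Hh; specialize (K h Hh).
  - eapply Rle_trans; [|exact K]. eapply Rle_trans; [|apply Cmod_fst_norm]. right. reflexivity.
  - eapply Rle_trans; [|exact K]. eapply Rle_trans; [|apply Cmod_snd_norm]. right. reflexivity.
Qed.

Lemma is_derive_of_cd : forall f z l, cd f z l -> is_derive (K := C_AbsRing) (V := C_NormedModule) f z l.
Proof.
  intros f z l H. split; [apply is_linear_scal_l|].
  intros x Hx. apply (is_filter_lim_locally_unique (K := C_AbsRing) (V := AbsRing_NormedModule C_AbsRing)) in Hx. subst x. intros eps.
  destruct (H eps (cond_pos eps)) as [d [Hd K]]. exists (mkposreal d Hd). intros y Hy.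
  assert (Hh : Cmod (y - z)%C < d) by exact Hy.
  specialize (K _ Hh).
  assert (E1 : (z + (y - z) = (y : C))%C) by (unfold Cminus; rewrite (Cplus_comm (y : C)), Cplus_assoc, Cplus_opp_r; apply Cplus_0_l).
  rewrite E1, (Cmult_comm l) in K. exact K.
Qed.

Lemma partial_z_unique : forall F p a b, hd F p a b -> partial_z F p = a.
Proof.
  intros F [z w] a b H. unfold partial_z. simpl. apply is_C_derive_unique, is_derive_of_cd.
  assert (E : vadd (RtoC 0, w) (vscal z (RtoC 1, RtoC 0)) = (z, w)) by c2ring.
  rewrite <- E in H. apply hd_slice in H. replace (lin a b (RtoC 1, RtoC 0)) with a in H by (unfold lin; simpl; ring).
  apply (cd_ext (fun t => F (vadd (RtoC 0, w) (vscal t (RtoC 1, RtoC 0))))); auto.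
  intros t. f_equal. c2ring.
Qed.

Lemma partial_w_unique : forall F p a b, hd F p a b -> partial_w F p = b.
Proof.
  intros F [z w] a b H. unfold partial_w. simpl. apply is_C_derive_unique, is_derive_of_cd.
  assert (E : vadd (z, RtoC 0) (vscal w (RtoC 0, RtoC 1)) = (z, w)) by c2ring.
  rewrite <- E in H. apply hd_slice in H. replace (lin a b (RtoC 0, RtoC 1)) with b in H by (unfold lin; simpl; ring).
  apply (cd_ext (fun t => F (vadd (z, RtoC 0) (vscal t (RtoC 0, RtoC 1))))); auto.
  intros t. f_equal. c2ring.
Qed.

Definition jac (f : C2 -> C2) (p : C2) : mat :=
  Mat (partial_z (fun q => fst (f q)) p) (partial_w (fun q => fst (f q)) p)
      (partial_z (fun q => snd (f q)) p) (partial_w (fun q => snd (f q)) p).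

Definition holo_at (f : C2 -> C2) (p : C2) : Prop :=
  hd (fun q => fst (f q)) p (m11 (jac f p)) (m12 (jac f p)) /\
  hd (fun q => snd (f q)) p (m21 (jac f p)) (m22 (jac f p)).

Lemma holo_at_intro : forall f p M, hd (fun q => fst (f q)) p (m11 M) (m12 M) ->
  hd (fun q => snd (f q)) p (m21 M) (m22 M) -> jac f p = M /\ holo_at f p.
Proof.
  intros f p M H1 H2.
  assert (E : jac f p = M).
  { unfold jac. rewrite (partial_z_unique _ _ _ _ H1), (partial_w_unique _ _ _ _ H1),
      (partial_z_unique _ _ _ _ H2), (partial_w_unique _ _ _ _ H2). now destruct M. }
  split; auto. unfold holo_at. rewrite E. auto.
Qed.

Lemma holo_at_of_holomorphic : forall U f p, holomorphic_on U f -> U p -> holo_at f p.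
Proof.
  intros U f p H Up. destruct (hd_of_filterdiff f p (H p Up)) as [M [H1 H2]]. now apply (holo_at_intro f p M).
Qed.

Lemma hd_comp_map : forall F f p a b, hd F (f p) a b -> holo_at f p ->
  hd (fun q => F (f q)) p (a * m11 (jac f p) + b * m21 (jac f p))%C (a * m12 (jac f p) + b * m22 (jac f p))%C.
Proof.
  intros F f p a b HF [H1 H2]. rewrite (surjective_pairing (f p)) in HF.
  apply (hd_ext (fun q => F (fst (f q), snd (f q)))); [intros q; now rewrite <- surjective_pairing|].
  exact (hd_comp F _ _ p a b _ _ _ _ H1 H2 HF).
Qed.

Definition mid : mat := Mat (RtoC 1) (RtoC 0) (RtoC 0) (RtoC 1).

Lemma mv_mid : forall q, mv mid q = q.
Proof. intros q. apply C2_eq; unfold mv, mid, lin; simpl; ring. Qed.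

Lemma jac_inverse : forall U V Phi Phi' p, biholomorphism U V Phi Phi' -> U p ->
  mmul (jac Phi' (Phi p)) (jac Phi p) = mid.
Proof.
  intros U V Phi Phi' p [OU [OV [HP [HP' [H1 H2]]]]] Up.
  pose proof (holo_at_of_holomorphic U Phi p HP Up) as A.
  pose proof (holo_at_of_holomorphic V Phi' (Phi p) HP' (proj1 (H1 p Up))) as [B1 B2].
  pose proof (hd_comp_map _ Phi p _ _ B1 A) as C1. pose proof (hd_comp_map _ Phi p _ _ B2 A) as C3.
  destruct (open_nrm U p OU Up) as [d [Hd K]].
  assert (D1 : hd (fun q => fst (Phi' (Phi q))) p (RtoC 1) (RtoC 0)).
  { apply (hd_ext_loc (fun q => fst q)); [|apply hd_fst]. exists d. split; auto. intros q Hq.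
    destruct (H1 q (K q Hq)) as [_ E]. now rewrite E. }
  assert (D2 : hd (fun q => snd (Phi' (Phi q))) p (RtoC 0) (RtoC 1)).
  { apply (hd_ext_loc (fun q => snd q)); [|apply hd_snd]. exists d. split; auto. intros q Hq.
    destruct (H1 q (K q Hq)) as [_ E]. now rewrite E. }
  destruct (hd_unique _ _ _ _ _ _ C1 D1) as [E1 E2]. destruct (hd_unique _ _ _ _ _ _ C3 D2) as [E3 E4].
  unfold mmul, mid. now rewrite E1, E2, E3, E4.
Qed.

Lemma pushforward_mv : forall Phi Phi' X q, pushforward Phi Phi' X q = mv (jac Phi (Phi' q)) (X (Phi' q)).
Proof. reflexivity. Qed.

Lemma mdet_mid : mdet mid = RtoC 1.
Proof. unfold mdet, mid. simpl. ring. Qed.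

Lemma mmul_mid_det : forall m n, mmul m n = mid -> mdet m <> RtoC 0 /\ mdet n <> RtoC 0.
Proof.
  intros m n E. apply (f_equal mdet) in E. rewrite mdet_mmul, mdet_mid in E.
  split; intros h; rewrite h in E; apply C1_nz; rewrite <- E; ring.
Qed.

Lemma pushforward_nonzero : forall X U V Phi Phi' q, coordinates_for X U V Phi Phi' -> V q -> q <> origin ->
  pushforward Phi Phi' X q <> origin.
Proof.
  intros X U V Phi Phi' q [[OU [U0 [HX HZ]]] [Bi P0]] Vq Nq E.
  pose proof Bi as [_ [_ [_ [_ [H1 H2]]]]]. destruct (H2 q Vq) as [Up Eq].
  pose proof (jac_inverse U V Phi Phi' (Phi' q) Bi Up) as J.
  rewrite pushforward_mv in E.
  assert (X0 : X (Phi' q) = origin).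
  { rewrite <- (mv_mid (X (Phi' q))), <- J, mv_mmul, E. apply mv_origin. }
  apply (HZ _ Up) in X0. apply Nq. rewrite <- Eq, X0. exact P0.
Qed.

(** The coefficients involve the partial derivatives of the chart, which are holomorphic by
    [hd_partials]. *)
Lemma pushforward_holomorphic : forall X U V Phi Phi' q, coordinates_for X U V Phi Phi' -> V q ->
  (exists a b, hd (fun x => fst (pushforward Phi Phi' X x)) q a b) /\
  (exists a b, hd (fun x => snd (pushforward Phi Phi' X x)) q a b).
Proof.
  intros X U V Phi Phi' q [[OU [U0 [HX HZ]]] [Bi P0]] Vq.
  pose proof Bi as [_ [OV [HP [HP' [H1 H2]]]]]. destruct (H2 q Vq) as [Up Eq].
  pose proof (holo_at_of_holomorphic V Phi' q HP' Vq) as A.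
  destruct (holo_at_of_holomorphic U X _ HX Up) as [X1 X2].
  destruct (open_nrm U _ OU Up) as [d [Hd K]].
  assert (N1 : hd_near (fun x => fst (Phi x)) (fun x => m11 (jac Phi x)) (fun x => m12 (jac Phi x)) (Phi' q)).
  { exists d. split; auto. intros x Hx. apply (holo_at_of_holomorphic U Phi x HP (K x Hx)). }
  assert (N2 : hd_near (fun x => snd (Phi x)) (fun x => m21 (jac Phi x)) (fun x => m22 (jac Phi x)) (Phi' q)).
  { exists d. split; auto. intros x Hx. apply (holo_at_of_holomorphic U Phi x HP (K x Hx)). }
  destruct (hd_partials _ _ _ _ N1) as [[c1 [c2 J11]] [c3 [c4 J12]]].
  destruct (hd_partials _ _ _ _ N2) as [[c5 [c6 J21]] [c7 [c8 J22]]].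
  split; do 2 eexists; unfold pushforward, Defs.differential; cbn [fst snd].
  - apply hd_plus; apply hd_mult.
    + exact (hd_comp_map _ Phi' q _ _ J11 A).
    + exact (hd_comp_map _ Phi' q _ _ X1 A).
    + exact (hd_comp_map _ Phi' q _ _ J12 A).
    + exact (hd_comp_map _ Phi' q _ _ X2 A).
  - apply hd_plus; apply hd_mult.
    + exact (hd_comp_map _ Phi' q _ _ J21 A).
    + exact (hd_comp_map _ Phi' q _ _ X1 A).
    + exact (hd_comp_map _ Phi' q _ _ J22 A).
    + exact (hd_comp_map _ Phi' q _ _ X2 A).
Qed.

Lemma chart_origin : forall X U V Phi Phi', coordinates_for X U V Phi Phi' ->
  V origin /\ Phi' origin = origin /\ X origin = origin.
Proof.
  intros X U V Phi Phi' [[OU [U0 [HX HZ]]] [Bi P0]].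
  pose proof Bi as [_ [_ [_ [_ [H1 _]]]]]. destruct (H1 origin U0) as [A B]. rewrite P0 in A, B.
  repeat split; auto. now apply HZ.
Qed.

Lemma mdet_mult_nonzero : forall m n, mdet m <> RtoC 0 -> mdet n <> RtoC 0 -> mdet (mmul m n) <> RtoC 0.
Proof. intros m n Hm Hn. rewrite mdet_mmul. now apply Cmult_neq_0. Qed.

(** As [X] vanishes at the origin, the linear part is conjugated by the derivative of the chart. *)
Lemma pushforward_linear_part : forall X U V Phi Phi', coordinates_for X U V Phi Phi' -> jacobian_det X origin <> RtoC 0 ->
  exists L, mdet L <> RtoC 0 /\
  hd (fun x => fst (pushforward Phi Phi' X x)) origin (m11 L) (m12 L) /\
  hd (fun x => snd (pushforward Phi Phi' X x)) origin (m21 L) (m22 L).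
Proof.
  intros X U V Phi Phi' HC HJ. destruct (chart_origin _ _ _ _ _ HC) as [V0 [P0' X0]].
  pose proof HC as [[OU [U0 [HX HZ]]] [Bi P0]].
  pose proof Bi as [_ [OV [HP [HP' [H1 H2]]]]].
  pose proof (holo_at_of_holomorphic V Phi' origin HP' V0) as A.
  pose proof (holo_at_of_holomorphic U X _ HX U0) as [X1 X2].
  destruct (open_nrm U _ OU U0) as [d [Hd K]].
  assert (N1 : hd_near (fun x => fst (Phi x)) (fun x => m11 (jac Phi x)) (fun x => m12 (jac Phi x)) origin).
  { exists d. split; auto. intros x Hx. apply (holo_at_of_holomorphic U Phi x HP (K x Hx)). }
  assert (N2 : hd_near (fun x => snd (Phi x)) (fun x => m21 (jac Phi x)) (fun x => m22 (jac Phi x)) origin).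
  { exists d. split; auto. intros x Hx. apply (holo_at_of_holomorphic U Phi x HP (K x Hx)). }
  destruct (hd_partials _ _ _ _ N1) as [[c1 [c2 J11]] [c3 [c4 J12]]].
  destruct (hd_partials _ _ _ _ N2) as [[c5 [c6 J21]] [c7 [c8 J22]]].
  rewrite <- P0' in J11, J12, J21, J22, X1, X2.
  pose proof (hd_comp_map _ Phi' origin _ _ J11 A) as K11. pose proof (hd_comp_map _ Phi' origin _ _ J12 A) as K12.
  pose proof (hd_comp_map _ Phi' origin _ _ J21 A) as K21. pose proof (hd_comp_map _ Phi' origin _ _ J22 A) as K22.
  pose proof (hd_comp_map _ Phi' origin _ _ X1 A) as Y1. pose proof (hd_comp_map _ Phi' origin _ _ X2 A) as Y2.
  exists (mmul (jac Phi origin) (mmul (jac X origin) (jac Phi' origin))).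
  split; [|split].
  - pose proof (jac_inverse U V Phi Phi' origin Bi U0) as J. rewrite P0 in J. destruct (mmul_mid_det _ _ J) as [D1 D2].
    repeat apply mdet_mult_nonzero; auto.
  - eapply hd_eq; [| |exact (hd_plus _ _ _ _ _ _ _ (hd_mult _ _ _ _ _ _ _ K11 Y1) (hd_mult _ _ _ _ _ _ _ K12 Y2))];
      cbv beta; rewrite P0', X0; unfold mmul; cbn [m11 m12 m21 m22 fst snd origin]; ring.
  - eapply hd_eq; [| |exact (hd_plus _ _ _ _ _ _ _ (hd_mult _ _ _ _ _ _ _ K21 Y1) (hd_mult _ _ _ _ _ _ _ K22 Y2))];
      cbv beta; rewrite P0', X0; unfold mmul; cbn [m11 m12 m21 m22 fst snd origin]; ring.
Qed.

(** * Tangency with spheres *)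

Lemma Cmod_norm_R : forall z : C, norm (V := C_R_NormedModule) z = Cmod z.
Proof.
  intros z. unfold Cmod. change (sqrt (Rabs (fst z) ^ 2 + Rabs (snd z) ^ 2) = sqrt (fst z ^ 2 + snd z ^ 2)).
  f_equal. now rewrite !pow2_abs.
Qed.

Lemma norm_C2_R_le : forall q : C2, norm (V := C2_R) q <= nrm q.
Proof.
  intros q. change (norm (V := C2_R) q) with (sqrt (norm (V := C_R_NormedModule) (fst q) ^ 2 + norm (V := C_R_NormedModule) (snd q) ^ 2)).
  rewrite !Cmod_norm_R. apply prod_norm_nrm.
Qed.

Lemma nrm_le_norm_C2_R : forall q : C2, nrm q <= 2 * norm (V := C2_R) q.
Proof.
  intros q. change (norm (V := C2_R) q) with (sqrt (norm (V := C_R_NormedModule) (fst q) ^ 2 + norm (V := C_R_NormedModule) (snd q) ^ 2)).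
  rewrite !Cmod_norm_R. pose proof (Cmod_fst_norm q). pose proof (Cmod_snd_norm q). unfold nrm. lra.
Qed.

Lemma vscal_R : forall (t : R) (v : C2), scal (V := C2_R) t v = vscal (RtoC t) v.
Proof.
  intros t v. apply C2_eq; apply injective_projections; simpl; unfold scal; simpl; unfold mult; simpl; ring.
Qed.

Lemma minus_C2_R : forall p q : C2, minus (G := C2_R) p q = vsub p q.
Proof.
  intros p q. apply C2_eq; apply injective_projections; simpl; unfold minus, plus, opp; simpl; ring.
Qed.

Lemma is_derive_C2 : forall (g : R -> C2) v, is_derive (K := R_AbsRing) (V := C2_R) g 0 v <->
  forall eps, 0 < eps -> exists d, 0 < d /\ forall t, Rabs t < d ->
    nrm (vsub (vsub (g t) (g 0)) (vscal (RtoC t) v)) <= eps * Rabs t.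
Proof.
  intros g v. split.
  - intros [_ H] eps He. specialize (H 0 (fun P HP => HP)). assert (He2 : 0 < eps / 2) by lra.
    destruct (H (mkposreal _ He2)) as [d K]. exists d. split; [apply cond_pos|]. intros t Ht.
    specialize (K t). assert (B : ball (M := R_UniformSpace) 0 d t).
    { unfold ball; simpl. unfold AbsRing_ball, abs, minus, plus, opp; simpl. now rewrite Ropp_0, Rplus_0_r. }
    specialize (K B).
    assert (K' : norm (V := C2_R) (minus (G := C2_R) (minus (G := C2_R) (g t) (g 0)) (scal (V := C2_R) (t - 0) v)) <= eps / 2 * Rabs (t - 0))
      by exact K.
    rewrite !minus_C2_R, vscal_R, Rminus_0_r in K'.
    eapply Rle_trans; [apply nrm_le_norm_C2_R|].
    eapply Rle_trans; [apply Rmult_le_compat_l; [lra|exact K']|]. right. field.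
  - intros H. split; [apply is_linear_scal_l|]. intros x Hx.
    apply (is_filter_lim_locally_unique (K := R_AbsRing) (V := AbsRing_NormedModule R_AbsRing)) in Hx. subst x.
    intros eps. destruct (H eps (cond_pos eps)) as [d [Hd K]]. exists (mkposreal d Hd). intros t Ht.
    assert (B : Rabs t < d).
    { unfold ball in Ht; simpl in Ht. unfold AbsRing_ball, abs, minus, plus, opp in Ht; simpl in Ht. now rewrite Ropp_0, Rplus_0_r in Ht. }
    specialize (K t B).
    change (norm (V := C2_R) (minus (G := C2_R) (minus (G := C2_R) (g t) (g 0)) (scal (V := C2_R) (t - 0) v)) <= eps * Rabs (t - 0)).
    rewrite !minus_C2_R, vscal_R, Rminus_0_r.
    eapply Rle_trans; [apply norm_C2_R_le|]. exact K.
Qed.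

Lemma sphere_sqn : forall rho q, sphere rho q <-> sqn q = rho ^ 2.
Proof. intros rho q. unfold sphere, sqn. tauto. Qed.

(** Along a curve in the sphere the norm is constant, and its derivative is a multiple of [ip p v];
    conversely great circles have all such velocities. *)
Lemma tangent_space_sphere : forall rho p v, 0 < rho -> sphere rho p ->
  (tangent_space (sphere rho) p v <-> ip p v = 0).
Proof.
  intros rho p v Hr Hp. split.
  - intros [g [G0 [Hloc Hd]]].
    destruct Hloc as [d1 K1]. pose proof (proj1 (is_derive_C2 g v) Hd) as Hd0. clear Hd. rename Hd0 into Hd.
    destruct (Req_dec (ip p v) 0) as [E|E]; auto. exfalso.
    pose proof (rd_sqdist origin p) as RD.
    set (L := nrm v + 1). assert (PL : 0 < L) by (unfold L; pose proof (nrm_ge_0 v); lra).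
    set (M := 2 * nrm p + L). assert (PM : 0 < M) by (unfold M; pose proof (nrm_ge_0 p); lra).
    set (e := Rabs (ip p v) / (2 * M)). assert (Pe : 0 < e) by (apply Rdiv_lt_0_compat; [now apply Rabs_pos_lt|lra]).
    destruct (RD e Pe) as [d2 [Hd2 K2]].
    destruct (Hd (Rmin 1 e)) as [d3 [Hd3 K3]]; [apply Rmin_glb_lt; lra|].
    assert (P2L : 0 < d2 / L) by now apply Rdiv_lt_0_compat.
    set (t := Rmin (Rmin d1 d3) (d2 / L) / 2).
    assert (Pt : 0 < Rmin (Rmin d1 d3) (d2 / L)) by (repeat apply Rmin_glb_lt; auto; apply cond_pos).
    assert (Bt : 0 < t /\ t < d1 /\ t < d3 /\ t < d2 / L).
    { pose proof (Rmin_l (Rmin d1 d3) (d2 / L)). pose proof (Rmin_r (Rmin d1 d3) (d2 / L)).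
      pose proof (Rmin_l d1 d3). pose proof (Rmin_r d1 d3). unfold t. lra. }
    destruct Bt as [B0 [B1 [B2 B3]]].
    assert (S1 : sphere rho (g t)).
    { apply K1. unfold ball; simpl. unfold AbsRing_ball, abs, minus, plus, opp; simpl. rewrite Ropp_0, Rplus_0_r, Rabs_pos_eq; lra. }
    specialize (K3 t). rewrite Rabs_pos_eq in K3 by lra. specialize (K3 B2). rewrite G0 in K3.
    set (h := vsub (g t) p) in *.
    pose proof (Rmin_l 1 e) as M1. pose proof (Rmin_r 1 e) as M2.
    assert (Nh : nrm h <= L * t).
    { replace h with (vadd (vsub h (vscal (RtoC t) v)) (vscal (RtoC t) v)) by c2ring.
      eapply Rle_trans; [apply nrm_add|]. rewrite nrm_scal, Cmod_RtoC_pos by lra. unfold L. nra. }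
    specialize (K2 h). assert (Nh2 : nrm h < d2).
    { eapply Rle_lt_trans; [exact Nh|]. apply Rmult_lt_compat_l with (r := L) in B3; auto.
      replace (L * (d2 / L)) with d2 in B3 by (field; lra). exact B3. }
    specialize (K2 Nh2). unfold h in K2 at 1 2. rewrite vadd_sub in K2.
    replace (vsub (g t) origin) with (g t) in K2 by c2ring. replace (vsub p origin) with p in K2 by c2ring.
    rewrite !ip_self in K2. apply sphere_sqn in S1. apply sphere_sqn in Hp. rewrite S1, Hp in K2.
    replace (rho ^ 2 - rho ^ 2 - ip (vscal (RtoC 2) p) h) with (- (2 * (t * ip p v + ip p (vsub h (vscal (RtoC t) v))))) in K2
      by (unfold ip; simpl; ring).
    pose proof (ip_bound p (vsub h (vscal (RtoC t) v))) as IB.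
    assert (F : Rabs (t * ip p v) <= (e * M) * t).
    { replace (t * ip p v) with ((t * ip p v + ip p (vsub h (vscal (RtoC t) v))) - ip p (vsub h (vscal (RtoC t) v))) by ring.
      eapply Rle_trans; [apply Rabs_triang|]. rewrite !Rabs_Ropp in *. rewrite Rabs_mult, (Rabs_pos_eq 2) in K2 by lra.
      pose proof (nrm_ge_0 p). unfold M.
      assert (e * nrm h <= e * (L * t)) by (apply Rmult_le_compat_l; lra).
      assert (nrm p * nrm (vsub h (vscal (RtoC t) v)) <= nrm p * (e * t)) by (apply Rmult_le_compat_l; [auto|nra]).
      assert (0 <= nrm p * (e * t)) by (apply Rmult_le_pos; nra).
      assert (0 <= e * (L * t)) by (apply Rmult_le_pos; nra).
      replace (e * (2 * nrm p + L) * t) with (2 * (nrm p * (e * t)) + e * (L * t)) by ring.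
      unfold Rminus in K2. lra. }
    rewrite Rabs_mult, (Rabs_pos_eq t) in F by lra.
    replace (e * M) with (Rabs (ip p v) / 2) in F by (unfold e; field; lra).
    pose proof (Rabs_pos_lt _ E). nra.
  - intros E.
    destruct (Req_dec (sqn v) 0) as [Ev|Ev].
    { assert (v = origin). { apply nrm_eq_0. pose proof (nrm_sqr_le v). pose proof (nrm_ge_0 v). nra. }
      subst v. exists (fun _ => p). split; auto. split.
      - exists (mkposreal 1 Rlt_0_1). auto.
      - apply (proj2 (is_derive_C2 _ _)). intros eps He. exists 1. split; [lra|]. intros t _.
        replace (vsub (vsub p p) (vscal (RtoC t) origin)) with origin by c2ring. rewrite nrm_origin. pose proof (Rabs_pos t). nra. }
    assert (Pv : 0 < sqn v).
    { assert (0 <= sqn v) by (unfold sqn; pose proof (pow2_ge_0 (Cmod (fst v))); pose proof (pow2_ge_0 (Cmod (snd v))); lra). lra. }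
    (* the angular speed at which the great circle through [p] has velocity [v] *)
    set (s := sqrt (sqn v) / rho).
    assert (Ps : 0 < s) by (apply Rdiv_lt_0_compat; auto; now apply sqrt_lt_R0).
    assert (Es : s ^ 2 * rho ^ 2 = sqn v).
    { unfold s. replace ((sqrt (sqn v) / rho) ^ 2 * rho ^ 2) with (sqrt (sqn v) ^ 2) by (field; lra). apply pow2_sqrt. lra. }
    exists (fun t => vadd (vscal (RtoC (cos (s * t))) p) (vscal (RtoC (sin (s * t) / s)) v)).
    split; [|split].
    + rewrite Rmult_0_r, cos_0, sin_0. unfold Rdiv. rewrite Rmult_0_l. c2ring.
    + exists (mkposreal 1 Rlt_0_1). intros t _. apply sphere_sqn. apply sphere_sqn in Hp.
      rewrite <- ip_self.
      replace (ip (vadd (vscal (RtoC (cos (s * t))) p) (vscal (RtoC (sin (s * t) / s)) v)) (vadd (vscal (RtoC (cos (s * t))) p) (vscal (RtoC (sin (s * t) / s)) v)))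
        with (cos (s * t) ^ 2 * ip p p + 2 * cos (s * t) * (sin (s * t) / s) * ip p v + (sin (s * t) / s) ^ 2 * ip v v)
        by (unfold ip; simpl; ring).
      rewrite E, !ip_self, Hp, <- Es. replace ((sin (s * t) / s) ^ 2 * (s ^ 2 * rho ^ 2)) with (sin (s * t) ^ 2 * rho ^ 2) by (field; lra).
      pose proof (sin2_cos2 (s * t)) as SC. unfold Rsqr in SC. nra.
    + apply (proj2 (is_derive_C2 _ _)). intros eps He.
      assert (D1 : derivable_pt_lim (fun t => cos (s * t)) 0 0).
      { apply is_derive_Reals. auto_derive; auto. rewrite Rmult_0_r, sin_0. ring. }
      assert (D2 : derivable_pt_lim (fun t => sin (s * t) / s) 0 1).
      { apply is_derive_Reals. auto_derive; auto. rewrite Rmult_0_r, cos_0. field. lra. }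
      set (M := nrm p + nrm v + 1). assert (PM : 0 < M) by (unfold M; pose proof (nrm_ge_0 p); pose proof (nrm_ge_0 v); lra).
      assert (Pe : 0 < eps / M) by now apply Rdiv_lt_0_compat.
      destruct (derivative_at_0 _ _ D1 _ Pe) as [d1 [Hd1 K1]]. destruct (derivative_at_0 _ _ D2 _ Pe) as [d2 [Hd2 K2]].
      exists (Rmin d1 d2). split; [now apply Rmin_glb_lt|]. intros t Ht.
      specialize (K1 t (Rlt_le_trans _ _ _ Ht (Rmin_l _ _))). specialize (K2 t (Rlt_le_trans _ _ _ Ht (Rmin_r _ _))).
      cbv beta in K1, K2. rewrite Rmult_0_r in *. rewrite cos_0, sin_0 in *.
      set (x := cos (s * t)) in *. set (y := sin (s * t) / s) in *.
      replace (vsub (vsub (vadd (vscal (RtoC x) p) (vscal (RtoC y) v)) (vadd (vscal (RtoC 1) p) (vscal (RtoC (0 / s)) v))) (vscal (RtoC t) v))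
        with (vadd (vscal (RtoC (x - 1 - 0 * t)) p) (vscal (RtoC (y - 0 / s - 1 * t)) v)).
      2:{ apply C2_eq; apply injective_projections; simpl; ring. }
      eapply Rle_trans; [apply nrm_add|]. rewrite !nrm_scal, !Cmod_R.
      apply Rle_trans with (eps / M * Rabs t * nrm p + eps / M * Rabs t * nrm v).
      * apply Rplus_le_compat; apply Rmult_le_compat_r; auto using nrm_ge_0.
      * pose proof (Rabs_pos t).
        replace (eps / M * Rabs t * nrm p + eps / M * Rabs t * nrm v) with (eps / M * Rabs t * (nrm p + nrm v)) by ring.
        apply Rle_trans with (eps / M * Rabs t * M); [|right; field; lra].
        apply Rmult_le_compat_l; [nra|unfold M; lra].
Qed.

Lemma scal_C2_C : forall (c : C) (v : C2), scal (V := C2_C) c v = vscal c v.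
Proof. reflexivity. Qed.

(** The real and imaginary parts of the Hermitian product with the position vector express that the
    field and [Ci] times the field are tangent to the sphere. *)
Lemma tangency_locus_tang : forall Y rho q, 0 < rho ->
  (tangency_locus Y (sphere rho) q <-> tang (fun x => fst (Y x)) (fun x => snd (Y x)) rho q /\ Y q <> origin).
Proof.
  intros Y rho q Hr. unfold tangency_locus, tang.
  assert (Ev : vfield (fun x => fst (Y x)) (fun x => snd (Y x)) q = Y q) by (unfold vfield; now destruct (Y q)).
  rewrite Ev. split.
  - intros [Hs [Hn Ht]]. split; auto. split; [now apply sphere_sqn|].
    destruct (Ht (Y q)) as [T1 T2].
    { exists (RtoC 1). rewrite scal_C2_C. c2ring. }
    apply tangent_space_sphere in T1; auto. apply tangent_space_sphere in T2; auto.
    rewrite scal_C2_C in T2. rewrite ip_hermitian in T1, T2.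
    apply injective_projections; [exact T1|].
    replace (fst (hermitian (vscal Ci (Y q)) q)) with (- snd (hermitian (Y q) q)) in T2 by (unfold hermitian, vscal; simpl; ring).
    change (snd (hermitian (Y q) q) = 0). lra.
  - intros [[Hs Hh] Hn]. apply sphere_sqn in Hs. split; auto. split; auto.
    intros v [c Hc]. rewrite scal_C2_C in Hc.
    assert (Z : forall k, ip q (vscal k (Y q)) = 0).
    { intros k. rewrite ip_hermitian. replace (hermitian (vscal k (Y q)) q) with (k * hermitian (Y q) q)%C.
      - rewrite Hh. simpl. ring.
      - unfold hermitian, vscal. simpl. ring. }
    subst v. split; apply tangent_space_sphere; auto. rewrite scal_C2_C.
    replace (vscal Ci (vscal c (Y q))) with (vscal (Ci * c)%C (Y q)) by c2ring. auto.
Qed.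

(** * Smooth surfaces are rigid *)

Definition real_grad (f : C2 -> R) (q : C2) : C2 :=
  ((dir_derive f ((1, 0), RtoC 0) q, dir_derive f ((0, 1), RtoC 0) q),
   (dir_derive f (RtoC 0, (1, 0)) q, dir_derive f (RtoC 0, (0, 1)) q)).

Lemma rd_dir_derive : forall f p G v, rd f p G -> dir_derive f v p = ip G v.
Proof.
  intros f p G v H. unfold dir_derive. apply is_derive_unique, is_derive_Reals. intros eps He.
  pose proof (nrm_ge_0 v) as Pv.
  destruct (H (eps / 2 / (nrm v + 1))) as [d [Hd K]]; [repeat apply Rdiv_lt_0_compat; lra|].
  assert (Pd : 0 < d / (nrm v + 1)) by (apply Rdiv_lt_0_compat; lra).
  exists (mkposreal _ Pd). simpl. intros t Nt Ht. rewrite Rplus_0_l.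
  assert (Ep : forall x : R, plus (G := C2_R) p (scal (V := C2_R) x v) = vadd p (vscal (RtoC x) v)).
  { intros x. rewrite vscal_R. apply C2_eq; apply injective_projections; simpl; unfold plus; simpl; ring. }
  rewrite !Ep. replace (vadd p (vscal (RtoC 0) v)) with p by c2ring.
  assert (Pt : 0 < Rabs t) by now apply Rabs_pos_lt.
  specialize (K (vscal (RtoC t) v)). rewrite nrm_scal, Cmod_R in K.
  assert (Sm : Rabs t * nrm v < d).
  { apply Rmult_lt_compat_r with (r := nrm v + 1) in Ht; [|lra].
    replace (d / (nrm v + 1) * (nrm v + 1)) with d in Ht by (field; lra). nra. }
  specialize (K Sm). rewrite ip_scal in K.
  replace ((f (vadd p (vscal (RtoC t) v)) - f p) / t - ip G v) with ((f (vadd p (vscal (RtoC t) v)) - f p - t * ip G v) / t) by (field; auto).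
  unfold Rdiv at 1. rewrite Rabs_mult, Rabs_inv.
  apply Rmult_lt_reg_r with (1 := Pt). rewrite Rmult_assoc, Rinv_l, Rmult_1_r by lra.
  eapply Rle_lt_trans; [exact K|].
  replace (eps / 2 / (nrm v + 1) * (Rabs t * nrm v)) with (eps / 2 * Rabs t * (nrm v / (nrm v + 1))) by (field; lra).
  assert (nrm v / (nrm v + 1) <= 1).
  { apply Rmult_le_reg_r with (nrm v + 1); [lra|]. unfold Rdiv. rewrite Rmult_assoc, Rinv_l by lra. lra. }
  assert (0 < eps / 2 * Rabs t) by nra. nra.
Qed.

Lemma rd_of_filterdiff : forall f p,
  ex_filterdiff (K := R_AbsRing) (U := C2_R) (V := R_NormedModule) f (locally (T := C2_R) p) ->
  rd f p (real_grad f p).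
Proof.
  intros f p [l [Hl Hd]]. specialize (Hd p (fun P HP => HP)).
  set (G := ((l ((1, 0), RtoC 0), l ((0, 1), RtoC 0)), (l (RtoC 0, (1, 0)), l (RtoC 0, (0, 1)))) : C2).
  assert (Lin : forall h : C2, l h = ip G h).
  { intros h.
    assert (E : h = plus (G := C2_R) (plus (G := C2_R) (scal (V := C2_R) (fst (fst h)) (((1, 0), RtoC 0) : C2)) (scal (V := C2_R) (snd (fst h)) (((0, 1), RtoC 0) : C2)))
       (plus (G := C2_R) (scal (V := C2_R) (fst (snd h)) ((RtoC 0, (1, 0)) : C2)) (scal (V := C2_R) (snd (snd h)) ((RtoC 0, (0, 1)) : C2)))).
    { rewrite !vscal_R. apply C2_eq; apply injective_projections; simpl; unfold plus; simpl; ring. }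
    rewrite E at 1. rewrite !(linear_plus _ Hl), !(linear_scal _ Hl).
    set (l1 := l ((1, 0), RtoC 0) : R). set (l2 := l ((0, 1), RtoC 0) : R).
    set (l3 := l (RtoC 0, (1, 0)) : R). set (l4 := l (RtoC 0, (0, 1)) : R).
    change (@eq R (fst (fst h) * l1 + snd (fst h) * l2 + (fst (snd h) * l3 + snd (snd h) * l4))
      (l1 * fst (fst h) + l2 * snd (fst h) + (l3 * fst (snd h) + l4 * snd (snd h)))). ring. }
  assert (R : rd f p G).
  { intros eps He. specialize (Hd (mkposreal eps He)). apply locally_R_nrm in Hd. destruct Hd as [d [Hd K]].
    exists d. split; auto. intros h Hh. specialize (K (vadd p h)). rewrite vsub_add in K. specialize (K Hh).
    rewrite !minus_C2_R, vsub_add, Lin in K.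
    eapply Rle_trans; [|eapply Rle_trans; [exact K|]].
    - right. reflexivity.
    - apply Rmult_le_compat_l; [simpl; lra|]. apply norm_C2_R_le. }
  assert (Q : forall v, dir_derive f v p = l v) by (intros v; rewrite Lin; exact (rd_dir_derive f p G v R)).
  eapply rd_eq; [|exact R]. unfold real_grad. rewrite !Q. reflexivity.
Qed.

Lemma c1_of_smooth : forall U f p, open (T := C2_R) U -> U p -> smooth_on U f -> c1_at f (real_grad f) p.
Proof.
  intros U f p OU Up H. destruct (H 1%nat) as [H1 H2]. split.
  - destruct (locally_R_nrm p U (OU p Up)) as [d [Hd K]]. exists d. split; auto. intros q Hq. apply rd_of_filterdiff, H1, K, Hq.
  - assert (Cv : forall v, contR (dir_derive f v) p).
    { intros v eps He. specialize (H2 v p Up).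
      assert (B : locally (T := R_UniformSpace) (dir_derive f v p) (fun y => Rabs (y - dir_derive f v p) < eps)).
      { exists (mkposreal eps He). intros y Hy. exact Hy. }
      apply H2 in B. apply locally_R_nrm in B. exact B. }
    apply cont_vec_seq. intros u Hu.
    assert (T : forall v eps, 0 < eps -> exists N, forall n, (N <= n)%nat -> Rabs (dir_derive f v (u n) - dir_derive f v p) < eps).
    { intros v. apply contR_tends; auto. }
    assert (T2 : forall v w, ctends (fun n => ((dir_derive f v (u n), dir_derive f w (u n)) : C)) (dir_derive f v p, dir_derive f w p)).
    { intros v w eps He. destruct (T v (eps / 2)) as [N1 K1]; [lra|]. destruct (T w (eps / 2)) as [N2 K2]; [lra|].
      exists (Nat.max N1 N2). intros n Hn. specialize (K1 n ltac:(lia)). specialize (K2 n ltac:(lia)).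
      eapply Rle_lt_trans; [apply Cmod_le_ReIm|]. simpl. unfold Rminus in *. lra. }
    apply tends_pair; unfold real_grad; simpl; apply T2.
Qed.

Lemma smooth_surface_rigid : forall M, smooth_surface M -> rigid M.
Proof.
  intros M HM. apply rigid_of_equations. intros p Mp.
  destruct (HM p Mp) as [U [f [g [OU [Up [Sf [Sg [Eq Ind]]]]]]]].
  exists f, g, (real_grad f), (real_grad g).
  pose proof (c1_of_smooth U f p OU Up Sf) as Cf. pose proof (c1_of_smooth U g p OU Up Sg) as Cg.
  split; auto. split; auto. split.
  - destruct (locally_R_nrm p U (OU p Up)) as [d [Hd K]]. exists d. split; auto.
  - intros a b E. apply (Ind p Up Mp). intros v.
    assert (Zp : nrm (vsub p p) = 0) by (replace (vsub p p) with origin by c2ring; apply nrm_origin).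
    destruct Cf as [[d1 [Hd1 R1]] _]. destruct Cg as [[d2 [Hd2 R2]] _].
    rewrite (rd_dir_derive f p _ v (R1 p ltac:(lra))), (rd_dir_derive g p _ v (R2 p ltac:(lra))).
    transitivity (ip (vadd (vscal (RtoC a) (real_grad f p)) (vscal (RtoC b) (real_grad g p))) v).
    + unfold ip. simpl. ring.
    + rewrite E. unfold ip, origin. simpl. ring.
Qed.

Lemma rigid_ext : forall M M' : C2 -> Prop, (forall q, M q <-> M' q) -> rigid M -> rigid M'.
Proof.
  intros M M' E H p F1 F2 F3 G1 G2 G3 Mp C1 C2' C3 L1 L2 L3.
  assert (T : forall F, local_min_on M' F p -> local_min_on M F p).
  { intros F [d [Hd K]]. exists d. split; auto. intros q Mq. apply K. now apply E. }
  apply (H p F1 F2 F3 G1 G2 G3); auto. now apply E.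
Qed.

(** * The Clifford torus *)

Lemma rd_filterdiff : forall f p G, rd f p G ->
  ex_filterdiff (K := R_AbsRing) (U := C2_R) (V := R_NormedModule) f (locally (T := C2_R) p).
Proof.
  intros f p G H. exists (fun h => ip G h). split.
  - split.
    + intros x y. unfold ip, plus; simpl. unfold plus; simpl. ring.
    + intros k x. rewrite vscal_R, ip_scal. reflexivity.
    + exists (2 * nrm G + 1). split; [pose proof (nrm_ge_0 G); lra|]. intros x.
      change (norm (ip G x)) with (Rabs (ip G x)). eapply Rle_trans; [apply ip_bound|].
      pose proof (nrm_le_norm_C2_R x). pose proof (nrm_ge_0 G). pose proof (nrm_ge_0 x). nra.
  - intros x Hx. apply (is_filter_lim_locally_unique (K := R_AbsRing) (V := C2_R)) in Hx. subst x.
    intros eps. assert (He : 0 < eps / 2) by (pose proof (cond_pos eps); lra). destruct (H _ He) as [d [Hd K]].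
    assert (Hd4 : 0 < d / 4) by lra. exists (mkposreal _ Hd4). intros q Hq.
    rewrite !minus_C2_R.
    assert (Nq : nrm (vsub q p) < d).
    { destruct Hq as [[h1 h2] [h3 h4]]. unfold ball in *; simpl in *. unfold AbsRing_ball, abs, minus, plus, opp in *; simpl in *.
      unfold nrm, vsub. simpl.
      pose proof (Cmod_le_ReIm (fst q - fst p)%C) as Q1. pose proof (Cmod_le_ReIm (snd q - snd p)%C) as Q2. simpl in Q1, Q2. lra. }
    specialize (K (vsub q p) Nq). rewrite vadd_sub in K.
    apply Rle_trans with (eps / 2 * nrm (vsub q p)); [exact K|].
    pose proof (nrm_le_norm_C2_R (vsub q p)). pose proof (cond_pos eps). nra.
Qed.

Lemma Ck_ext : forall k U f g, (forall q, f q = g q) -> Ck k U f -> Ck k U g.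
Proof.
  intros k U f g E H. replace g with f; auto.
  apply FunctionalExtensionality.functional_extensionality. exact E.
Qed.

Lemma Ck_step : forall k U f G, (forall q, rd f q (G q)) -> (forall v, Ck k U (fun q => ip (G q) v)) -> Ck (S k) U f.
Proof.
  intros k U f G HR HC. split.
  - intros p _. eapply rd_filterdiff, HR.
  - intros v. eapply Ck_ext; [|apply HC]. intros q. symmetry. apply rd_dir_derive, HR.
Qed.

Lemma Ck_continuous : forall U f G, (forall q, rd f q (G q)) -> Ck 0 U f.
Proof.
  intros U f G HR p _ P [e He]. destruct (rd_cont f p (G p) (HR p) e (cond_pos e)) as [d [Hd K]].
  apply (nrm_locally_C p (fun q => P (f q)) d Hd). intros q Hq. apply He. exact (K q Hq).
Qed.

Lemma smooth_const : forall U c, smooth_on U (fun _ => c).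
Proof.
  intros U c k. revert c. induction k; intros c.
  - apply (Ck_continuous U _ (fun _ => origin)). intros q. apply rd_const.
  - apply (Ck_step k U _ (fun _ => origin)); [intros q; apply rd_const|].
    intros v. eapply Ck_ext; [|apply (IHk 0)]. intros q. unfold ip, origin. simpl. ring.
Qed.

Lemma smooth_linear : forall U g, smooth_on U (fun q => ip g q).
Proof.
  intros U g [|k].
  - apply (Ck_continuous U _ (fun _ => g)). intros q. apply rd_ip.
  - apply (Ck_step k U _ (fun _ => g)); [intros q; apply rd_ip|]. intros v. apply smooth_const.
Qed.

(** Derivatives of a quadratic form are linear, those of a linear form constant: the recursion in the
    definition of smoothness stops after two steps. *)
Lemma smooth_quadratic : forall U (m : C2 -> C2) c,
  (forall q, rd (fun x => ip (m x) x - c) q (vscal (RtoC 2) (m q))) -> (forall q v, ip (m q) v = ip (m v) q) ->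
  smooth_on U (fun x => ip (m x) x - c).
Proof.
  intros U m c HR Sym [|k].
  - exact (Ck_continuous U _ _ HR).
  - apply (Ck_step k U _ _ HR). intros v.
    eapply Ck_ext; [|apply (smooth_linear U (vscal (RtoC 2) (m v)) k)].
    intros q. cbv beta. transitivity (2 * ip (m v) q); [unfold ip; simpl; ring|].
    rewrite <- Sym. unfold ip. simpl. ring.
Qed.

Lemma smooth_surface_torus : forall (M : C2 -> Prop) x y, 0 < x -> 0 < y ->
  (forall q, M q <-> Cmod (fst q) ^ 2 = x /\ Cmod (snd q) ^ 2 = y) -> smooth_surface M.
Proof.
  intros M x y Px Py HM p Mp.
  set (m1 := fun q : C2 => (fst q, RtoC 0) : C2). set (m2 := fun q : C2 => (RtoC 0, snd q) : C2).
  assert (R1 : forall q, rd (fun z => ip (m1 z) z - x) q (vscal (RtoC 2) (m1 q))).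
  { intros q eps He. exists eps. split; auto. intros h Hh.
    replace (ip (m1 (vadd q h)) (vadd q h) - x - (ip (m1 q) q - x) - ip (vscal (RtoC 2) (m1 q)) h) with (Cmod (fst h) ^ 2)
      by (rewrite Cmod_sqr; unfold m1, ip; simpl; ring).
    pose proof (Cmod_fst_nrm h). pose proof (Cmod_ge_0 (fst h)). rewrite Rabs_pos_eq by apply pow2_ge_0. nra. }
  assert (R2 : forall q, rd (fun z => ip (m2 z) z - y) q (vscal (RtoC 2) (m2 q))).
  { intros q eps He. exists eps. split; auto. intros h Hh.
    replace (ip (m2 (vadd q h)) (vadd q h) - y - (ip (m2 q) q - y) - ip (vscal (RtoC 2) (m2 q)) h) with (Cmod (snd h) ^ 2)
      by (rewrite Cmod_sqr; unfold m2, ip; simpl; ring).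
    pose proof (Cmod_snd_nrm h). pose proof (Cmod_ge_0 (snd h)). rewrite Rabs_pos_eq by apply pow2_ge_0. nra. }
  exists (fun _ => True), (fun z => ip (m1 z) z - x), (fun z => ip (m2 z) z - y).
  split; [intros q _; exists (mkposreal 1 Rlt_0_1); auto|]. split; auto.
  split; [apply smooth_quadratic; auto; intros q v; unfold m1, ip; simpl; ring|].
  split; [apply smooth_quadratic; auto; intros q v; unfold m2, ip; simpl; ring|].
  assert (E1 : forall q, ip (m1 q) q = Cmod (fst q) ^ 2) by (intros q; rewrite Cmod_sqr; unfold m1, ip; simpl; ring).
  assert (E2 : forall q, ip (m2 q) q = Cmod (snd q) ^ 2) by (intros q; rewrite Cmod_sqr; unfold m2, ip; simpl; ring).
  split.
  - intros q _. rewrite E1, E2, HM. lra.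
  - intros q _ Mq a b Hab. apply HM in Mq. destruct Mq as [Q1 Q2].
    split.
    + specialize (Hab (fst q, RtoC 0)). rewrite (rd_dir_derive _ _ _ _ (R1 q)), (rd_dir_derive _ _ _ _ (R2 q)) in Hab.
      assert (Z : a * (2 * Cmod (fst q) ^ 2) = 0) by (rewrite <- Hab, Cmod_sqr; unfold m1, m2, ip; simpl; ring).
      rewrite Q1 in Z. nra.
    + specialize (Hab (RtoC 0, snd q)). rewrite (rd_dir_derive _ _ _ _ (R1 q)), (rd_dir_derive _ _ _ _ (R2 q)) in Hab.
      assert (Z : b * (2 * Cmod (snd q) ^ 2) = 0) by (rewrite <- Hab, Cmod_sqr; unfold m1, m2, ip; simpl; ring).
      rewrite Q2 in Z. nra.
Qed.

(** * Linear foliations in the normal form *)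

(** The kernel of a nonzero linear form on C^2 is a line. *)
Lemma parallel_of_form : forall (P Q : C) (y v : C2), ~ (P = RtoC 0 /\ Q = RtoC 0) -> y <> origin ->
  (P * fst y + Q * snd y)%C = RtoC 0 -> (P * fst v + Q * snd v)%C = RtoC 0 -> exists c, v = vscal c y.
Proof.
  intros P Q [y1 y2] [v1 v2] N Ny E1 E2. simpl in *.
  assert (D : (v1 * y2 - v2 * y1)%C = RtoC 0).
  { assert (DP : (P * (v1 * y2 - v2 * y1))%C = RtoC 0).
    { transitivity ((P * v1 + Q * v2) * y2 - (P * y1 + Q * y2) * v2)%C; [ring|rewrite E1, E2; ring]. }
    assert (DQ : (Q * (v1 * y2 - v2 * y1))%C = RtoC 0).
    { transitivity (- ((P * v1 + Q * v2) * y1 - (P * y1 + Q * y2) * v1))%C; [ring|rewrite E1, E2; ring]. }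
    destruct (Ceq_dec (v1 * y2 - v2 * y1)%C (RtoC 0)) as [h|h]; auto. exfalso. apply N.
    split; [destruct (Ceq_dec P (RtoC 0)) as [h1|h1]|destruct (Ceq_dec Q (RtoC 0)) as [h1|h1]]; auto; exfalso.
    - exact (Cmult_neq_0 _ _ h1 h DP).
    - exact (Cmult_neq_0 _ _ h1 h DQ). }
  destruct (Ceq_dec y1 (RtoC 0)) as [h|h].
  - assert (Ny2 : y2 <> RtoC 0) by (intros h2; apply Ny; subst; reflexivity).
    exists (v2 / y2)%C. apply C2_eq; unfold vscal; simpl.
    + subst y1. transitivity ((v1 * y2 - v2 * 0) / y2)%C; [field; auto|rewrite D; field; auto].
    + field. auto.
  - exists (v1 / y1)%C. apply C2_eq; unfold vscal; simpl; [field; auto|].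
    transitivity (v1 * y2 / y1 - (v1 * y2 - v2 * y1) / y1)%C; [field; auto|rewrite D; field; auto].
Qed.

Lemma form_nonzero : forall (lam mu : R) (q : C2), 0 < lam -> 0 < mu -> q <> origin ->
  ~ ((RtoC mu * snd q)%C = RtoC 0 /\ (RtoC lam * fst q)%C = RtoC 0).
Proof.
  intros lam mu q Pl Pm Nq [h1 h2].
  assert (Nm : RtoC mu <> RtoC 0) by (intros h; apply RtoC_inj in h; lra).
  assert (Nl : RtoC lam <> RtoC 0) by (intros h; apply RtoC_inj in h; lra).
  apply Nq. apply C2_eq; unfold origin; simpl.
  - destruct (Ceq_dec (fst q) (RtoC 0)) as [h|h]; auto. exfalso. exact (Cmult_neq_0 _ _ Nl h h2).
  - destruct (Ceq_dec (snd q) (RtoC 0)) as [h|h]; auto. exfalso. exact (Cmult_neq_0 _ _ Nm h h1).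
Qed.

Lemma given_by_form_of_defect : forall Y (lam mu : R) d, 0 < lam -> 0 < mu -> 0 < d ->
  (forall q, nrm q < d -> q <> origin -> Y q <> origin /\ (RtoC mu * snd q * fst (Y q) + RtoC lam * fst q * snd (Y q))%C = RtoC 0) ->
  given_by_form Y (fun q => (RtoC mu * snd q)%C) (fun q => (RtoC lam * fst q)%C).
Proof.
  intros Y lam mu d Pl Pm Pd H. apply (nrm_locally_C origin _ d Pd). intros q Hq Nq v.
  replace (vsub q origin) with q in Hq by c2ring. destruct (H q Hq Nq) as [NY E]. split.
  - intros [c ->]. rewrite scal_C2_C. unfold vscal. simpl.
    transitivity (c * (RtoC mu * snd q * fst (Y q) + RtoC lam * fst q * snd (Y q)))%C; [ring|rewrite E; ring].
  - intros E2. destruct (parallel_of_form _ _ (Y q) v (form_nonzero lam mu q Pl Pm Nq) NY E E2) as [c Hc]. exists c. exact Hc.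
Qed.

(** Up to a nonzero factor the field is [(lam z, - mu w)], and its Hermitian product with the position
    is [lam |z|^2 - mu |w|^2]. *)
Lemma tangency_locus_clifford : forall Y (lam mu : R), 0 < lam -> 0 < mu ->
  given_by_form Y (fun q => (RtoC mu * snd q)%C) (fun q => (RtoC lam * fst q)%C) ->
  exists eps, 0 < eps /\ forall rho, 0 < rho < eps -> forall q, tangency_locus Y (sphere rho) q <->
    Cmod (fst q) ^ 2 = mu / (lam + mu) * rho ^ 2 /\ Cmod (snd q) ^ 2 = lam / (lam + mu) * rho ^ 2.
Proof.
  intros Y lam mu Pl Pm H. apply locally_C_nrm in H. destruct H as [d [Hd H]].
  exists (d / 2). split; [lra|]. intros rho Hr q. rewrite tangency_locus_tang by lra. unfold tang.
  assert (Ev : vfield (fun x => fst (Y x)) (fun x => snd (Y x)) q = Y q) by (unfold vfield; now destruct (Y q)).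
  rewrite Ev.
  assert (Main : sqn q = rho ^ 2 -> Y q <> origin /\ (hermitian (Y q) q = RtoC 0 <-> lam * Cmod (fst q) ^ 2 = mu * Cmod (snd q) ^ 2)).
  { intros Hs.
    assert (Nq : q <> origin).
    { intros ->. unfold sqn, origin in Hs. simpl fst in Hs. simpl snd in Hs. rewrite Cmod_0 in Hs. nra. }
    assert (Sm : nrm (vsub q origin) < d).
    { replace (vsub q origin) with q by c2ring. pose proof (nrm_le_2 q rho ltac:(lra) Hs). lra. }
    specialize (H q Sm Nq).
    set (v := ((RtoC lam * fst q)%C, (- (RtoC mu * snd q))%C) : C2).
    destruct (proj2 (H v)) as [c Hc]; [unfold v; simpl; ring|]. rewrite scal_C2_C in Hc.
    assert (Nv : v <> origin).
    { intros h. apply (form_nonzero lam mu q Pl Pm Nq). unfold v, origin in h.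
      assert (h1 := f_equal fst h). assert (h2 := f_equal snd h). cbn [fst snd] in h1, h2. split; auto.
      transitivity (- - (RtoC mu * snd q))%C; [ring|rewrite h2; ring]. }
    assert (Nc : c <> RtoC 0) by (intros ->; apply Nv; rewrite Hc; c2ring).
    split; [intros h; apply Nv; rewrite Hc, h; c2ring|].
    assert (Ec : (c * hermitian (Y q) q)%C = RtoC (lam * Cmod (fst q) ^ 2 - mu * Cmod (snd q) ^ 2)).
    { transitivity (hermitian v q).
      - rewrite Hc. unfold hermitian, vscal. simpl. ring.
      - unfold hermitian, v. cbn [fst snd]. rewrite RtoC_minus, !RtoC_mult, <- !mul_conj. ring. }
    split; intros h.
    - rewrite h, Cmult_0_r in Ec. apply RtoC_inj in Ec. lra.
    - destruct (Ceq_dec (hermitian (Y q) q) (RtoC 0)) as [h1|h1]; auto. exfalso.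
      apply (Cmult_neq_0 _ _ Nc h1). rewrite Ec, h. f_equal. ring. }
  assert (Alg : forall u w : R, (u + w = rho ^ 2 /\ lam * u = mu * w) <-> (u = mu / (lam + mu) * rho ^ 2 /\ w = lam / (lam + mu) * rho ^ 2)).
  { intros u w. split.
    - intros [h1 h2]. split; apply Rmult_eq_reg_l with (lam + mu); try lra; field_simplify; nra.
    - intros [-> ->]. split; field; lra. }
  split.
  - intros [[Hs Hh] _]. apply Alg. split; [exact Hs|]. now apply Main.
  - intros h. apply Alg in h. destruct h as [Hs Hb]. change (sqn q = rho ^ 2) in Hs.
    destruct (Main Hs) as [NY Iff]. split; auto. split; auto. now apply Iff.
Qed.

(** * The two implications *)

Lemma tangency_surfaces_of_chart : forall X U V Phi Phi' r,
  jacobian_det X origin <> RtoC 0 -> coordinates_for X U V Phi Phi' -> surface_tangency X V Phi Phi' r ->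
  exists L, tangency_surfaces (fun q => fst (pushforward Phi Phi' X q)) (fun q => snd (pushforward Phi Phi' X q)) L r.
Proof.
  intros X U V Phi Phi' r HJ HC [Hdec [Hlim HM]].
  destruct (pushforward_linear_part X U V Phi Phi' HC HJ) as [L [DL [L1 L2]]].
  destruct (chart_origin _ _ _ _ _ HC) as [V0 [P0 X0]].
  pose proof HC as [_ [[_ [OV _]] _]].
  destruct (open_nrm V origin OV V0) as [R0 [PR HV]].
  assert (Sub : forall q, vsub q origin = q) by (intros q; c2ring).
  assert (Y0 : pushforward Phi Phi' X origin = origin) by (rewrite pushforward_mv, P0, X0; apply mv_origin).
  assert (Pr : forall j, 0 < r j).
  { intros j. specialize (Hdec j). lra. }
  assert (Loc : forall j q, tangency_locus (pushforward Phi Phi' X) (sphere (r j)) q <->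
     tang (fun q => fst (pushforward Phi Phi' X q)) (fun q => snd (pushforward Phi Phi' X q)) (r j) q).
  { intros j q. rewrite tangency_locus_tang by apply Pr. split; [intros [h _]; exact h|]. intros h. split; auto.
    apply (pushforward_nonzero X U V Phi Phi' q HC).
    - apply (HM j). apply sphere_sqn. apply h.
    - intros ->. destruct h as [h _]. unfold sqn, origin in h. simpl fst in h. simpl snd in h. rewrite Cmod_0 in h.
      specialize (Pr j). nra. }
  exists L. unfold tangency_surfaces.
  split.
  { exists R0. split; auto. split; intros q Hq; apply (pushforward_holomorphic X U V Phi Phi' q HC); apply HV; now rewrite Sub. }
  split; [rewrite Y0; reflexivity|]. split; [rewrite Y0; reflexivity|].
  split; auto. split; auto. split; auto. split; auto. split.
  { intros eps He. assert (B : locally (T := R_UniformSpace) 0 (fun y => y < eps)).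
    { exists (mkposreal eps He). intros y Hy. unfold ball in Hy; simpl in Hy. unfold AbsRing_ball, abs, minus, plus, opp in Hy; simpl in Hy.
      apply Rabs_lt_between in Hy. lra. }
    destruct (Hlim _ B) as [N HN]. exists N. auto. }
  split.
  - intros j. destruct (HM j) as [_ [[q Hq] _]]. exists q. now apply Loc.
  - intros j. destruct (HM j) as [_ [_ Hs]]. apply smooth_surface_rigid in Hs. now apply (rigid_ext _ _ (Loc j)).
Qed.

Lemma unitary_mv : forall B, munitary B -> unitary (mv B).
Proof.
  intros B UB. split.
  - split.
    + intros x y. change (mv B (vadd x y) = vadd (mv B x) (mv B y)). apply mv_vadd.
    + intros k x. change (mv B (vscal k x) = vscal k (mv B x)). apply mv_vscal.
    + exists 1. split; [lra|]. intros x. rewrite Rmult_1_l.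
      change (sqrt (sqn (mv B x)) <= sqrt (sqn x)). rewrite sqn_unitary by auto. lra.
  - intros u v. now apply hermitian_unitary.
Qed.

Lemma holomorphic_mv : forall B U, holomorphic_on U (mv B).
Proof.
  intros B U p _. exists (mv B). split.
  - destruct (mv_bound B) as [K [PK HK]]. split.
    + intros x y. change (mv B (vadd x y) = vadd (mv B x) (mv B y)). apply mv_vadd.
    + intros k x. change (mv B (vscal k x) = vscal k (mv B x)). apply mv_vscal.
    + exists (2 * K). split; [lra|]. intros x.
      change (sqrt (sqn (mv B x)) <= 2 * K * sqrt (sqn x)).
      pose proof (prod_norm_nrm (mv B x)) as Q1. change (sqrt (sqn (mv B x)) <= nrm (mv B x)) in Q1.
      pose proof (Cmod_fst_norm x) as Q2. pose proof (Cmod_snd_norm x) as Q3.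
      fold (sqn x) in Q2, Q3. specialize (HK x). unfold nrm in HK at 2.
      eapply Rle_trans; [exact Q1|]. eapply Rle_trans; [exact HK|].
      replace (2 * K * sqrt (sqn x)) with (K * (sqrt (sqn x) + sqrt (sqn x))) by ring. apply Rmult_le_compat_l; lra.
  - intros x _ eps. apply (nrm_locally_C p _ 1 Rlt_0_1). intros q _.
    change (sqrt (sqn (vsub (vsub (mv B q) (mv B x)) (mv B (vsub q x)))) <= eps * sqrt (sqn (vsub q x))).
    rewrite mv_vsub. replace (vsub (vsub (mv B q) (mv B x)) (vsub (mv B q) (mv B x))) with origin by c2ring.
    unfold sqn at 1, origin. simpl fst. simpl snd. rewrite Cmod_0.
    replace (0 ^ 2 + 0 ^ 2) with 0 by ring. rewrite sqrt_0. apply Rmult_le_pos; [left; apply cond_pos|apply sqrt_pos].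
Qed.

Lemma holomorphic_comp : forall (U V : C2 -> Prop) f g, holomorphic_on U f -> holomorphic_on V g -> (forall p, U p -> V (f p)) ->
  holomorphic_on U (fun p => g (f p)).
Proof.
  intros U V f g Hf Hg HUV p Up.
  apply (ex_filterdiff_comp' (K := C_AbsRing) (U := C2_C) (V := C2_C) (W := C2_C) f g p); auto.
Qed.

Lemma open_preimage_mv : forall B V, open (T := C2_C) V -> open (T := C2_C) (fun q => V (mv B q)).
Proof.
  intros B V OV q Vq. destruct (open_nrm V (mv B q) OV Vq) as [d [Hd K]].
  destruct (mv_continuous B q d Hd) as [d' [Hd' K']].
  apply (nrm_locally_C q _ d' Hd'). intros x Hx. apply K, K', Hx.
Qed.

Lemma coordinates_rotate : forall X U V Phi Phi' B, munitary B -> coordinates_for X U V Phi Phi' ->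
  coordinates_for X U (fun q => V (mv (adj B) q)) (fun p => mv B (Phi p)) (fun q => Phi' (mv (adj B) q)).
Proof.
  intros X U V Phi Phi' B [U1 U2] [HF [[OU [OV [HP [HP' [H1 H2]]]]] P0]].
  split; [exact HF|]. split; [|rewrite P0; apply mv_origin].
  split; [exact OU|]. split; [now apply open_preimage_mv|].
  split; [apply (holomorphic_comp U (fun _ => True) Phi (mv B)); auto; apply holomorphic_mv|].
  split; [apply (holomorphic_comp _ V (mv (adj B)) Phi'); auto; apply holomorphic_mv|].
  split.
  - intros p Up. rewrite U2. now apply H1.
  - intros q Vq. destruct (H2 _ Vq) as [A1 A2]. split; auto. now rewrite A2, U1.
Qed.

Lemma pushforward_rotate : forall X U V Phi Phi' B q, munitary B -> coordinates_for X U V Phi Phi' -> V (mv (adj B) q) ->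
  pushforward (fun p => mv B (Phi p)) (fun q => Phi' (mv (adj B) q)) X q = mv B (pushforward Phi Phi' X (mv (adj B) q)).
Proof.
  intros X U V Phi Phi' B q UB HC Vq. rewrite !pushforward_mv, <- mv_mmul. f_equal.
  destruct HC as [_ [[_ [_ [HP [_ [_ H2]]]]] _]]. destruct (H2 _ Vq) as [Up _].
  destruct (holo_at_of_holomorphic U Phi _ HP Up) as [A1 A2].
  apply (holo_at_intro (fun p => mv B (Phi p)) (Phi' (mv (adj B) q)) (mmul B (jac Phi (Phi' (mv (adj B) q))))).
  - unfold mv, lin. cbn [fst snd].
    exact (hd_plus _ _ _ _ _ _ _ (hd_scal (m11 B) _ _ _ _ A1) (hd_scal (m12 B) _ _ _ _ A2)).
  - unfold mv, lin. cbn [fst snd].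
    exact (hd_plus _ _ _ _ _ _ _ (hd_scal (m21 B) _ _ _ _ A1) (hd_scal (m22 B) _ _ _ _ A2)).
Qed.

(** [normal_form] supplies the rotation, and [defect_vanishes] says that the rotated field is
    annihilated by the form [mu w dz + lambda z dw]. *)
Lemma normal_form_of_surface_tangency : forall X U V Phi Phi' r,
  jacobian_det X origin <> RtoC 0 -> coordinates_for X U V Phi Phi' -> surface_tangency X V Phi Phi' r ->
  exists B (lambda mu : R), munitary B /\ 0 < lambda /\ 0 < mu /\
    given_by_form (pushforward (fun p => mv B (Phi p)) (fun q => Phi' (mv (adj B) q)) X)
      (fun q => (RtoC mu * snd q)%C) (fun q => (RtoC lambda * fst q)%C).
Proof.
  intros X U V Phi Phi' r HJ HC HS.
  destruct (tangency_surfaces_of_chart X U V Phi Phi' r HJ HC HS) as [L HT].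
  destruct (normal_form _ _ _ _ HT) as [a [b [B [k [l [[UB [Nk Ecj]] [Pl HT']]]]]]].
  exists B, l, (/ l). assert (Pm : 0 < / l) by now apply Rinv_0_lt_compat.
  split; auto. split; auto. split; auto.
  destruct (defect_vanishes a b l (/ l) r Pl Pm HT') as [rho [Pr Hz]].
  destruct (chart_origin _ _ _ _ _ HC) as [V0 _].
  pose proof (coordinates_rotate X U V Phi Phi' B UB HC) as HC'.
  pose proof HC' as [_ [[_ [OV _]] _]].
  assert (V0' : V (mv (adj B) origin)) by (rewrite mv_origin; exact V0).
  destruct (open_nrm _ origin OV V0') as [d [Hd HV]].
  apply (given_by_form_of_defect _ l (/ l) (Rmin rho d)); auto; [now apply Rmin_glb_lt|].
  intros q Hq Nq.
  assert (Vq : V (mv (adj B) q)).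
  { apply (HV q). replace (vsub q origin) with q by c2ring. eapply Rlt_le_trans; [exact Hq|apply Rmin_r]. }
  split; [exact (pushforward_nonzero X U _ _ _ q HC' Vq Nq)|].
  rewrite (pushforward_rotate X U V Phi Phi' B q UB HC Vq).
  specialize (Hz q (Rlt_le_trans _ _ _ Hq (Rmin_l _ _))). specialize (Ecj q).
  assert (Ev : vfield (fun q => fst (pushforward Phi Phi' X q)) (fun q => snd (pushforward Phi Phi' X q)) (mv (adj B) q)
     = pushforward Phi Phi' X (mv (adj B) q)) by (unfold vfield; now rewrite <- surjective_pairing).
  rewrite Ev in Ecj. set (y := mv B (pushforward Phi Phi' X (mv (adj B) q))) in *.
  assert (Ea := f_equal fst Ecj). assert (Eb := f_equal snd Ecj). unfold vfield, vscal in Ea, Eb. cbn [fst snd] in Ea, Eb.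
  unfold defect in Hz. rewrite Ea, Eb in Hz.
  destruct (Ceq_dec (RtoC (/ l) * snd q * fst y + RtoC l * fst q * snd y)%C (RtoC 0)) as [h|h]; auto. exfalso.
  apply (Cmult_neq_0 _ _ Nk h). rewrite <- Hz. ring.
Qed.

Lemma given_by_form_scale : forall Y P Q P' Q' (c : C), c <> RtoC 0 ->
  (forall q, P' q = (c * P q)%C) -> (forall q, Q' q = (c * Q q)%C) -> given_by_form Y P Q -> given_by_form Y P' Q'.
Proof.
  intros Y P Q P' Q' c Nc EP EQ H. apply locally_C_nrm in H. destruct H as [d [Hd K]].
  apply (nrm_locally_C origin _ d Hd). intros q Hq Nq v. rewrite (K q Hq Nq v), EP, EQ.
  replace (c * P q * fst v + c * Q q * snd v)%C with (c * (P q * fst v + Q q * snd v))%C by ring.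
  split; intros h.
  - rewrite h. ring.
  - destruct (Ceq_dec (P q * fst v + Q q * snd v)%C (RtoC 0)) as [h1|h1]; auto. exfalso. exact (Cmult_neq_0 _ _ Nc h1 h).
Qed.

(** The linear foliation is the normal form with [lambda = 1] and [mu = - tau], whose loci on all
    small spheres are tori. *)
Lemma surface_tangency_of_linear : forall X U V Phi Phi' (tau : R), tau < 0 -> coordinates_for X U V Phi Phi' ->
  given_by_form (pushforward Phi Phi' X) (fun q => (- (RtoC tau * snd q))%C) (fun q => fst q) ->
  exists r, surface_tangency X V Phi Phi' r.
Proof.
  intros X U V Phi Phi' tau Ht HC HG.
  assert (Pm : 0 < - tau) by lra.
  destruct (tangency_locus_clifford (pushforward Phi Phi' X) 1 (- tau) Rlt_0_1 Pm) as [eps [He HL]].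
  { apply (given_by_form_scale _ _ _ _ _ (RtoC 1) C1_nz) with (3 := HG); intros q; rewrite ?RtoC_opp; ring. }
  destruct (chart_origin _ _ _ _ _ HC) as [V0 _].
  pose proof HC as [_ [[_ [OV _]] _]].
  destruct (open_nrm V origin OV V0) as [d [Hd HV]].
  set (r0 := Rmin eps d / 4). assert (P0 : 0 < Rmin eps d) by now apply Rmin_glb_lt.
  pose proof (Rmin_l eps d). pose proof (Rmin_r eps d).
  assert (Pr : forall j, 0 < r0 / (INR j + 1) <= r0).
  { intros j. pose proof (pos_INR j). assert (Pr0 : 0 < r0) by (unfold r0; lra).
    split; [apply Rdiv_lt_0_compat; lra|]. apply Rmult_le_reg_r with (INR j + 1); [lra|].
    unfold Rdiv. rewrite Rmult_assoc, Rinv_l by lra. nra. }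
  exists (fun j => r0 / (INR j + 1)). split; [|split].
  - intros j. split; [apply Pr|]. pose proof (pos_INR j). rewrite S_INR.
    apply Rmult_lt_compat_l; [unfold r0; lra|]. apply Rinv_lt_contravar; nra.
  - intros P [e HP]. destruct (inv_succ_lt (e / (r0 + 1))) as [N HN]; [apply Rdiv_lt_0_compat; [apply cond_pos|unfold r0; lra]|].
    exists N. intros n Hn. apply HP. specialize (HN n Hn). destruct (Pr n) as [Q1 Q2].
    unfold ball; simpl. unfold AbsRing_ball, abs, minus, plus, opp; simpl. rewrite Ropp_0, Rplus_0_r, Rabs_pos_eq by lra.
    assert (Pr0 : 0 < r0) by (unfold r0; lra).
    apply Rmult_lt_compat_l with (r := r0 + 1) in HN; [|lra]. replace ((r0 + 1) * (e / (r0 + 1))) with (pos e) in HN by (field; lra).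
    pose proof (pos_INR n). assert (0 < / (INR n + 1)) by (apply Rinv_0_lt_compat; lra). unfold Rdiv. nra.
  - intros j. set (rho := r0 / (INR j + 1)). destruct (Pr j) as [Q1 Q2]. fold rho in Q1, Q2.
    assert (Br : 0 < rho < eps) by (unfold r0 in Q2; lra).
    set (x := - tau / (1 + - tau) * rho ^ 2). set (y := 1 / (1 + - tau) * rho ^ 2).
    assert (P2 : 0 < rho ^ 2) by (apply pow_lt; lra).
    assert (Px : 0 < x) by (apply Rmult_lt_0_compat; auto; apply Rdiv_lt_0_compat; lra).
    assert (Py : 0 < y) by (apply Rmult_lt_0_compat; auto; apply Rdiv_lt_0_compat; lra).
    split; [|split].
    + intros q Hq. apply HV. replace (vsub q origin) with q by c2ring. apply sphere_sqn in Hq.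
      pose proof (nrm_le_2 q rho ltac:(lra) Hq). unfold r0 in Q2. lra.
    + exists (RtoC (sqrt x), RtoC (sqrt y)). apply (HL rho Br). simpl fst. simpl snd.
      rewrite !Cmod_RtoC_pos, !pow2_sqrt by (try apply sqrt_pos; lra). auto.
    + apply (smooth_surface_torus _ x y Px Py). intros q. apply (HL rho Br).
Qed.

Theorem theorem1 : forall X : C2 -> C2,
  nondegenerate_foliation_germ X ->
  (linearizable_Siegel X <->
     exists (U V : C2 -> Prop) (Phi Phi' : C2 -> C2) (r : nat -> R),
       coordinates_for X U V Phi Phi' /\ surface_tangency X V Phi Phi' r) /\
  (forall (U V : C2 -> Prop) (Phi Phi' : C2 -> C2) (r : nat -> R),
     coordinates_for X U V Phi Phi' -> surface_tangency X V Phi Phi' r ->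
     exists (A A' : C2 -> C2) (lambda mu : R),
       unitary A /\ (forall v, A' (A v) = v) /\ (forall v, A (A' v) = v) /\
       (0 < lambda)%R /\ (0 < mu)%R /\
       let Y := pushforward (fun p => A (Phi p)) (fun q => Phi' (A' q)) X in
       given_by_form Y (fun q => (RtoC mu * snd q)%C)
                       (fun q => (RtoC lambda * fst q)%C) /\
       exists eps : R, (0 < eps)%R /\
         forall rho : R, (0 < rho < eps)%R ->
         forall q : C2, tangency_locus Y (sphere rho) q <->
           (Cmod (fst q) ^ 2 = mu / (lambda + mu) * rho ^ 2)%R /\
           (Cmod (snd q) ^ 2 = lambda / (lambda + mu) * rho ^ 2)%R).
Proof.
  intros X [_ HJ]. split; [split|].
  - intros [tau [U [V [Psi [Psi' [Ht [HC HG]]]]]]].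
    destruct (surface_tangency_of_linear X U V Psi Psi' tau Ht HC HG) as [r Hr].
    exists U, V, Psi, Psi', r. auto.
  - intros [U [V [Phi [Phi' [r [HC HS]]]]]].
    destruct (normal_form_of_surface_tangency X U V Phi Phi' r HJ HC HS) as [B [lambda [mu [UB [Pl [Pm HG]]]]]].
    exists (- (mu / lambda)), U, (fun q => V (mv (adj B) q)), (fun p => mv B (Phi p)), (fun q => Phi' (mv (adj B) q)).
    assert (Nl : RtoC lambda <> RtoC 0) by (intros h; apply RtoC_inj in h; lra).
    split; [|split; [now apply coordinates_rotate|]].
    + assert (0 < mu / lambda) by now apply Rdiv_lt_0_compat. lra.
    + apply (given_by_form_scale _ _ _ _ _ (/ RtoC lambda)%C) with (4 := HG).
      * intros h. apply C1_nz. rewrite <- (Cinv_r _ Nl), h. ring.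
      * intros q. rewrite RtoC_opp, RtoC_div by lra. field. exact Nl.
      * intros q. field. exact Nl.
  - intros U V Phi Phi' r HC HS.
    destruct (normal_form_of_surface_tangency X U V Phi Phi' r HJ HC HS) as [B [lambda [mu [UB [Pl [Pm HG]]]]]].
    exists (mv B), (mv (adj B)), lambda, mu.
    split; [now apply unitary_mv|]. split; [apply UB|]. split; [apply UB|]. split; auto. split; auto.
    split; [exact HG|]. exact (tangency_locus_clifford _ lambda mu Pl Pm HG).
Qed.
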